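(* Let $\mathcal{A}$ be a unital $*$-subalgebra of a unital $C^*$-algebra $A$ such that $\mathcal{A}$ and all the matrix algebras $M_m(\mathcal{A})$, $m\ge2$, are closed under holomorphic functional calculus. Suppose that $h,h'\in\mathrm{GL}_m^+(\mathcal{A})$ are compatible and commute with each other (as matrices). Then $hh'\in\mathrm{GL}_m^+(\mathcal{A})$ and $$\det(hh')=\det(h)\det(h')=\det(h')\det(h).$$
   Context: $\mathrm{GL}_m^+(\mathcal{A})$ is the set of positive invertible elements of $M_m(\mathcal{A})$ (positivity in the $C^*$-algebra $M_m(A)$); $\mathcal{A}^{++}$ is the set of positive invertible elements of $\mathcal{A}$. The determinant $\det:\mathrm{GL}_m^+(\mathcal{A})\to\mathcal{A}^{++}$ is defined by $\det(h)=\exp(\mathrm{Tr}[\log h])$, where $\log h\in M_m(\mathcal{A})$ and $\exp$ are given by holomorphic functional calculus and $\mathrm{Tr}[a]=\sum_ia_{ii}\in\mathcal{A}$ for $a=(a_{ij})\in M_m(\mathcal{A})$. Matrices $a=(a_{ij})\in M_p(\mathcal{A})$ and $b=(b_{kl})\in M_q(\mathcal{A})$ are compatible when each entry of $a$ commutes with every entry of $b$, i.e., $[a_{ij},b_{kl}]=0$ for all $i,j,k,l$. *)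

(* Defs.v *)
From HB Require Import structures.
From mathcomp Require Import all_boot all_order all_algebra.
From mathcomp Require Import complex.
From mathcomp Require Import all_classical all_reals all_analysis.

Set Implicit Arguments.
Unset Strict Implicit.
Unset Printing Implicit Defensive.

Import Order.TTheory GRing.Theory Num.Theory.
Import numFieldNormedType.Exports.

Local Open Scope classical_set_scope.
Local Open Scope ring_scope.
Local Open Scope complex_scope.

(* Complex numbers are [R[i]] with [R : realType].  The topology and the norm
   are those of the regular module [R[i]^o]; on [R[i]], [0 <= z] means that [z]
   is real and nonnegative, and norms of complex normed modules are
   [R[i]]-valued. *)

(* As for the [PreTopological*] structures of the library, no compatibility
   between the topology and the operations is required. *)
#[short(type="preTopologicalAlgType")]
HB.structure Definition PreTopologicalAlgebra (K : numDomainType) :=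
  {B of Topological B & GRing.Algebra K B}.

HB.mixin Record Algebra_isStarAlgebra (R : realType) B
    of GRing.Algebra R[i] B := {
  adj : B -> B;
  adjK : involutive adj;
  adjD : {morph adj : x y / x + y};
  adjZ : forall (c : R[i]) (x : B), adj (c *: x) = c^* *: adj x;
  adjM : forall x y : B, adj (x * y) = adj y * adj x
}.

#[short(type="starAlgType")]
HB.structure Definition StarAlgebra (R : realType) :=
  {B of GRing.Algebra R[i] B & Algebra_isStarAlgebra R B}.

#[short(type="preTopologicalStarAlgType")]
HB.structure Definition PreTopologicalStarAlgebra (R : realType) :=
  {B of Topological B & StarAlgebra R B}.

(* Unital C*-algebras.  The library hierarchy admits no common substructure of
   rings and normed modules (number domains, which are both, were declared
   first), hence the multiplication is a field of the mixin and the algebra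
   structures are derived below. *)
HB.mixin Record CompleteNormedModule_isCStarAlgebra (R : realType) A
    of CompleteNormedModule R[i] A := {
  cstar_one : A;
  cstar_mul : A -> A -> A;
  cstar_adj : A -> A;
  cstar_mulA : associative cstar_mul;
  cstar_mul1r : left_id cstar_one cstar_mul;
  cstar_mulr1 : right_id cstar_one cstar_mul;
  cstar_mulDl : left_distributive cstar_mul +%R;
  cstar_mulDr : right_distributive cstar_mul +%R;
  cstar_oner_neq0 : cstar_one != 0;
  cstar_scalerAl : forall (c : R[i]) (x y : A),
    c *: cstar_mul x y = cstar_mul (c *: x) y;
  cstar_scalerAr : forall (c : R[i]) (x y : A),
    c *: cstar_mul x y = cstar_mul x (c *: y);
  cstar_adjK : involutive cstar_adj;
  cstar_adjD : {morph cstar_adj : x y / x + y};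
  cstar_adjZ : forall (c : R[i]) (x : A),
    cstar_adj (c *: x) = c^* *: cstar_adj x;
  cstar_adjM : forall x y : A,
    cstar_adj (cstar_mul x y) = cstar_mul (cstar_adj y) (cstar_adj x);
  cstar_normM : forall x y : A, `|cstar_mul x y| <= `|x| * `|y|;
  cstar_norm_adjM : forall x : A,
    `|cstar_mul (cstar_adj x) x| = `|x| ^+ 2
}.

#[short(type="cstarAlgType")]
HB.structure Definition CStarAlgebra (R : realType) :=
  {A of CompleteNormedModule R[i] A & CompleteNormedModule_isCStarAlgebra R A}.

Section CStarAlgebraInstances.
Variables (R : realType) (A : cstarAlgType R).

HB.instance Definition _ :=
  GRing.Zmodule_isNzRing.Build (CStarAlgebra.sort A)
    cstar_mulA cstar_mul1r cstar_mulr1 cstar_mulDl cstar_mulDr cstar_oner_neq0.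
HB.instance Definition _ :=
  GRing.Lmodule_isLalgebra.Build R[i] (CStarAlgebra.sort A) cstar_scalerAl.
HB.instance Definition _ :=
  GRing.Lalgebra_isAlgebra.Build R[i] (CStarAlgebra.sort A) cstar_scalerAr.
HB.instance Definition _ :=
  Algebra_isStarAlgebra.Build R (CStarAlgebra.sort A)
    cstar_adjK cstar_adjD cstar_adjZ cstar_adjM.

End CStarAlgebraInstances.

(* [mxalg A m.+1] is the matrix algebra M_{m+1}(A) as a *complex* *-algebra:
   the library makes ['M[A]_m] a module over [A] only, hence the alias.  It
   carries the topology of entrywise convergence, which for a C*-algebra [A]
   is that of the C*-norm of M_{m+1}(A). *)
Definition mxalg (A : Type) (m : nat) := 'M[A]_m.

Section MatrixAlgebra.
Variables (R : realType) (A : preTopologicalStarAlgType R).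

HB.instance Definition _ (m : nat) := GRing.Zmodule.on (mxalg A m).
HB.instance Definition _ (m : nat) := Topological.on (mxalg A m).
HB.instance Definition _ (m : nat) := GRing.NzRing.on (mxalg A m.+1).

Definition mxalg_scale m (c : R[i]) (M : mxalg A m) : mxalg A m :=
  \matrix_(i, j) (c *: M i j).

Definition mxalg_adj m (M : mxalg A m) : mxalg A m :=
  \matrix_(i, j) adj (M j i).

Section Lmodule.
Variable m : nat.
Implicit Types M N : mxalg A m.

Fact mxalg_scalerA (a b : R[i]) M :
  mxalg_scale a (mxalg_scale b M) = mxalg_scale (a * b) M.
Proof. by apply/matrixP => i j; rewrite !mxE scalerA. Qed.

Fact mxalg_scale1r : left_id 1 (@mxalg_scale m).
Proof. by move=> M; apply/matrixP => i j; rewrite !mxE scale1r. Qed.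

Fact mxalg_scalerDr : right_distributive (@mxalg_scale m) +%R.
Proof. by move=> c M N; apply/matrixP => i j; rewrite !mxE scalerDr. Qed.

Fact mxalg_scalerDl M :
  {morph (@mxalg_scale m)^~ M : a b / a + b}.
Proof. by move=> a b; apply/matrixP => i j; rewrite !mxE scalerDl. Qed.

HB.instance Definition _ := GRing.Zmodule_isLmodule.Build R[i] (mxalg A m)
  mxalg_scalerA mxalg_scale1r mxalg_scalerDr mxalg_scalerDl.

End Lmodule.

Section Algebra.
Variable m : nat.
Implicit Types M N : mxalg A m.+1.

Fact mxalg_scalerAl (c : R[i]) M N : c *: (M * N) = (c *: M) * N.
Proof.
apply/matrixP => i j; rewrite !mxE scaler_sumr.
by apply: eq_bigr => k _; rewrite mxE scalerAl.
Qed.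

HB.instance Definition _ :=
  GRing.Lmodule_isLalgebra.Build R[i] (mxalg A m.+1) mxalg_scalerAl.

Fact mxalg_scalerAr (c : R[i]) M N : c *: (M * N) = M * (c *: N).
Proof.
apply/matrixP => i j; rewrite !mxE scaler_sumr.
by apply: eq_bigr => k _; rewrite mxE scalerAr.
Qed.

HB.instance Definition _ :=
  GRing.Lalgebra_isAlgebra.Build R[i] (mxalg A m.+1) mxalg_scalerAr.

Fact mxalg_adjK : involutive (@mxalg_adj m.+1).
Proof. by move=> M; apply/matrixP => i j; rewrite !mxE adjK. Qed.

Fact mxalg_adjD : {morph @mxalg_adj m.+1 : M N / M + N}.
Proof. by move=> M N; apply/matrixP => i j; rewrite !mxE adjD. Qed.

Fact mxalg_adjZ (c : R[i]) M : mxalg_adj (c *: M) = c^* *: mxalg_adj M.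
Proof. by apply/matrixP => i j; rewrite !mxE adjZ. Qed.

Fact mxalg_adjM M N : mxalg_adj (M * N) = mxalg_adj N * mxalg_adj M.
Proof.
have adj0 : adj (0 : A) = 0 by apply: (@addrI _ (adj 0)); rewrite -adjD !addr0.
apply/matrixP => i j; rewrite !mxE (big_morph _ (@adjD R A) adj0).
by apply: eq_bigr => k _; rewrite !mxE adjM.
Qed.

HB.instance Definition _ := Algebra_isStarAlgebra.Build R (mxalg A m.+1)
  mxalg_adjK mxalg_adjD mxalg_adjZ mxalg_adjM.

End Algebra.
End MatrixAlgebra.

Section Spectrum.
Variable R : realType.

Definition is_inverse (B : nzRingType) (x y : B) : Prop :=
  x * y = 1 /\ y * x = 1.

Definition spectrum (B : algType R[i]) (a : B) : set R[i] :=
  [set z | ~ exists y, is_inverse (z%:A - a) y].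

Definition resolvent (B : algType R[i]) (a : B) (z : R[i]) : B :=
  xget 0 [set y | is_inverse (z%:A - a) y].

Definition positive (B : starAlgType R) (x : B) : Prop :=
  adj x = x /\ spectrum x `<=` [set z | 0 <= z].

End Spectrum.

(* Contour integrals along cycles made of finitely many closed polygons.  A
   polygon is the list of its vertices. *)
Section ContourIntegral.
Variable R : realType.

Definition polygon_edges (s : seq R[i]) : seq (R[i] * R[i]) := zip s (rot 1 s).

Definition cycle_edges (G : seq (seq R[i])) : seq (R[i] * R[i]) :=
  flatten (map polygon_edges G).

Definition segment_point (e : R[i] * R[i]) (t : R) : R[i] :=
  e.1 + t%:C * (e.2 - e.1).

Definition cycle_support (G : seq (seq R[i])) : set R[i] :=
  [set z | exists2 e, e \in cycle_edges G &
           exists2 t : R, 0 <= t <= 1 & z = segment_point e t].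

(* Riemann sum of [g z dz], each edge being divided into [n.+1] equal parts. *)
Definition contour_sum (V : lmodType R[i]) (G : seq (seq R[i]))
    (g : R[i] -> V) (n : nat) : V :=
  \sum_(e <- cycle_edges G) \sum_(k < n.+1)
    ((e.2 - e.1) / n.+1%:R) *: g (segment_point e (k%:R / n.+1%:R)).

(* Only used for integrands that are continuous on the support of [G]. *)
Definition is_contour_int (V : preTopologicalLmodType R[i])
    (G : seq (seq R[i])) (g : R[i] -> V) (v : V) : Prop :=
  contour_sum G g n @[n --> \oo] --> v.

Definition two_pi_i : R[i] := 0 +i* (pi *+ 2).

Definition is_winding_number (G : seq (seq R[i])) (w k : R[i]) : Prop :=
  @is_contour_int (R[i]^o : normedModType R[i]) G (fun z => (two_pi_i * (z - w))^-1) k.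

Definition holomorphic_on (U : set R[i]) (f : R[i] -> R[i]) : Prop :=
  forall z, U z -> derivable (f : R[i]^o -> R[i]^o) z 1.

End ContourIntegral.

Section HolomorphicFunctionalCalculus.
Variable R : realType.

(* [b] = f(a), defined by the Cauchy integral of
   [f z (z - a)^-1 / (2 pi i)] along a cycle [G] in [U] that winds once around
   the spectrum of [a] and does not wind around any point outside [U]. *)
Definition is_hfc (B : preTopologicalAlgType R[i]) (f : R[i] -> R[i])
    (a b : B) : Prop :=
  exists (U : set R[i]^o) (G : seq (seq R[i])),
    [/\ open U, spectrum a `<=` U & holomorphic_on U f] /\
    [/\ cycle_support G `<=` U `\` spectrum a,
        forall w, spectrum a w -> is_winding_number G w 1,
        forall w, ~ U w -> is_winding_number G w 0 &
        is_contour_int G (fun z => (f z / two_pi_i R) *: resolvent a z) b].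

Definition hfc (B : preTopologicalAlgType R[i]) (f : R[i] -> R[i]) (a : B) : B :=
  xget 0 [set b | is_hfc f a b].

Definition hfc_closed (B : preTopologicalAlgType R[i]) (S : {pred B}) : Prop :=
  forall (f : R[i] -> R[i]) (a b : B), a \in S -> is_hfc f a b -> b \in S.

Definition cexp (z : R[i]) : R[i] :=
  let: x +i* y := z in (expR x * cos y) +i* (expR x * sin y).

(* Principal branch of the logarithm: tan (Arg z / 2) = y / (|z| + x) off the
   half-line ]-oo, 0]. *)
Definition clog (z : R[i]) : R[i] :=
  let: x +i* y := z in
  let r := Num.sqrt (x ^+ 2 + y ^+ 2) in
  ln r +i* (2 * atan (y / (r + x))).

End HolomorphicFunctionalCalculus.

Section PositiveMatrices.
Variables (R : realType) (A : cstarAlgType R).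

Definition star_subalg_closed (S : {pred A}) : Prop :=
  GRing.subalg_closed S /\ {in S, forall x, adj x \in S}.

Definition mx_hfc_closed (S : {pred A}) (m : nat) : Prop :=
  hfc_closed (mxOver S : {pred mxalg A m.+1}).

(* GL_{m+1}^+(S): positivity refers to M_{m+1}(A), invertibility to
   M_{m+1}(S). *)
Definition GLpos (S : {pred A}) (m : nat) (h : 'M[A]_m.+1) : Prop :=
  [/\ h \is a mxOver S,
      exists2 k, k \is a mxOver S & is_inverse h k &
      positive (h : mxalg A m.+1)].

Definition mx_log (m : nat) (h : 'M[A]_m.+1) : 'M[A]_m.+1 :=
  hfc (@clog R) (h : mxalg A m.+1).

Definition det (m : nat) (h : 'M[A]_m.+1) : A :=
  hfc (@cexp R) (\tr (mx_log h)).

Definition mx_compatible (p q : nat) (a : 'M[A]_p) (b : 'M[A]_q) : Prop :=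
  forall i j k l, a i j * b k l = b k l * a i j.

End PositiveMatrices.

(* Main.v *)
Require Import Defs.
From mathcomp Require Import all_boot all_order all_algebra.
From mathcomp Require Import complex.
From mathcomp Require Import all_classical all_reals all_analysis.
From mathcomp Require Import ring lra.

(** The functional calculus is defined by a choice among the Cauchy integrals
    along all admissible cycles, so each of [log h] and [exp x] must first be
    shown to have exactly one value. Everything rests on [contour_resolvent]:
    along any polygonal cycle that avoids the spectrum of [a] and winds [k] times
    around each of its points, the resolvent of [a] integrates to [2 pi i k]. If
    [P] is the integral, the element [2 pi i k - P] can be divided by [w - a] for
    every [w]: near the spectrum by the Cauchy transform of the resolvent, and
    elsewhere because [w - a] is invertible. The quotient is entire and small at
    infinity, and Liouville's theorem applies; the form of Cauchy's theorem that
    it needs is [box_stokes], which compares Riemann sums on a grid.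

    A function that is approximated uniformly on the cycle by functions whose
    value at [a] is known has the corresponding limit as its Cauchy integral
    ([contour_approx]). For the exponential the approximations are
    [(1 + z / n) ^ n]; for the logarithm they are the Riemann sums of
    [(z - 1) / (1 + t (z - 1))] over [0, 1]. The limits [alg_exp] and [alg_log]
    do not depend on the cycle, which gives [hfc_cexp] and [hfc_clog]. For
    [clog] this uses that no domain of holomorphy meets the half-line of
    nonpositive reals.

    The product [h h'] is self-adjoint, and invertible over the subalgebra. Its
    spectrum is positive ([pos_spectrumM]): for [z] not positive, some number [u]
    puts the spectra of [u h] and [u z h' ^-1] on different sides of the imaginary
    axis, and then the difference of these commuting elements is invertible,
    an inverse being a contour integral of the product of the resolvents
    ([separated_invertible]).

    Next, [log (h h') = log h + log h'] ([alg_logM]), by differentiating the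
    logarithm along the path [h (1 + s (h' - 1))], and the trace is additive.
    Finally, whatever commutes with a positive element commutes with its
    logarithm ([alg_log_commute]). Applied to scalar matrices, this shows that
    the entries of [log h] commute with those of [log h'], as the entries of [h]
    do with those of [h']. So the two traces commute, and the exponential of
    their sum is the product of their exponentials, in either order
    ([alg_expD]). *)

Set Implicit Arguments.
Unset Strict Implicit.
Unset Printing Implicit Defensive.

Import Order.TTheory GRing.Theory Num.Theory.
Import numFieldNormedType.Exports.

Local Open Scope classical_set_scope.
Local Open Scope ring_scope.
Local Open Scope complex_scope.

(** * The modulus and the exponential of complex numbers *)

(** The modulus with real values: the norm of [R[i]] is valued in [R[i]],
    whereas the estimates compare real numbers. *)
Notation cabs := (@Normc.normc _).
Arguments Normc.normc : simpl never.

Section ComplexModulus.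
Variable R : realType.
Implicit Types (x y z w : R[i]) (t : R).

Lemma cabs_normE z : `|z| = (cabs z)%:C.
Proof. by rewrite normc_def; case: z. Qed.

Lemma cabsM x y : cabs (x * y) = cabs x * cabs y.
Proof. exact: Normc.normcM. Qed.

Lemma cabsV x : cabs x^-1 = (cabs x)^-1.
Proof. exact: Normc.normcV. Qed.

Lemma cabsD x y : cabs (x + y) <= cabs x + cabs y.
Proof. by rewrite -lecR rmorphD/= -!cabs_normE ler_normD. Qed.

Lemma cabsN x : cabs (- x) = cabs x.
Proof. by apply: complexI; rewrite -!cabs_normE normrN. Qed.

Lemma cabs_ge0 x : 0 <= cabs x.
Proof. by case: x => a b; exact: sqrtr_ge0. Qed.

Lemma cabs0 : cabs (0 : R[i]) = 0.
Proof. exact: Normc.normc0. Qed.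

Lemma cabs1 : cabs (1 : R[i]) = 1.
Proof. exact: Normc.normc1. Qed.

Lemma cabs_real t : cabs t%:C = `|t|.
Proof. by rewrite /Normc.normc /= expr0n addr0 sqrtr_sqr. Qed.

Lemma cabs_i : cabs ('i : R[i]) = 1.
Proof. by rewrite /Normc.normc /= expr0n expr1n add0r sqrtr1. Qed.

Lemma cabs_eq0 x : cabs x = 0 -> x = 0.
Proof. exact: Normc.eq0_normc. Qed.

Lemma cabs_gt0 x : x != 0 -> 0 < cabs x.
Proof.
by move=> x0; rewrite lt_def cabs_ge0 andbT; apply: contra x0 => /eqP/cabs_eq0->.
Qed.

Lemma cabs_neq0 x : 0 < cabs x -> x != 0.
Proof. by move=> h; apply/eqP => x0; rewrite x0 cabs0 ltxx in h. Qed.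

Lemma cabsX x n : cabs (x ^+ n) = cabs x ^+ n.
Proof. by elim: n => [|n IH]; rewrite ?expr0 ?cabs1 // !exprS cabsM IH. Qed.

Lemma cabsB x y : cabs (x - y) = cabs (y - x).
Proof. by rewrite -cabsN opprB. Qed.

Lemma cabs_ge_Re z : `|complex.Re z| <= cabs z.
Proof.
by case: z => a b; rewrite /Normc.normc /= -sqrtr_sqr ler_sqrt ?lerDl ?addr_ge0 ?sqr_ge0.
Qed.

Lemma cabs_ge_Im z : `|complex.Im z| <= cabs z.
Proof.
by case: z => a b; rewrite /Normc.normc /= -sqrtr_sqr ler_sqrt ?lerDr ?addr_ge0 ?sqr_ge0.
Qed.

Lemma cabs_le z : cabs z <= `|complex.Re z| + `|complex.Im z|.
Proof.
have ->: z = (complex.Re z)%:C + 'i * (complex.Im z)%:C by rewrite -complexE.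
by apply: (le_trans (cabsD _ _)); rewrite cabsM cabs_i !cabs_real mul1r -complexE.
Qed.

Lemma sqr_cabs z : cabs z ^+ 2 = complex.Re z ^+ 2 + complex.Im z ^+ 2.
Proof. by case: z => a b; rewrite /Normc.normc /= sqr_sqrtr ?addr_ge0 ?sqr_ge0. Qed.

Lemma real_complexD t s : (t + s)%:C = t%:C + s%:C.
Proof. exact: rmorphD. Qed.

End ComplexModulus.

Section ComplexExponential.
Variable R : realType.
Implicit Types (x y z w : R[i]) (t : R).

Lemma cexp0 : cexp (0 : R[i]) = 1.
Proof. by rewrite /cexp /= expR0 cos0 sin0 mulr1 mulr0. Qed.

Lemma cexpD z w : cexp (z + w) = cexp z * cexp w.
Proof.
case: z w => [a b] [c d]; rewrite /cexp /=.
have mulcE (p q r s : R) : (p +i* q) * (r +i* s) = (p * r - q * s) +i* (p * s + q * r).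
  by [].
by rewrite mulcE expRD cosD sinD; congr (_ +i* _); ring.
Qed.

Lemma cabs_cexp z : cabs (cexp z) = expR (complex.Re z).
Proof.
case: z => a b; rewrite /Normc.normc /= !exprMn -mulrDr cos2Dsin2 mulr1 sqrtr_sqr.
by rewrite ger0_norm ?expR_ge0.
Qed.

Lemma cexp_neq0 z : cexp z != 0.
Proof. by apply: cabs_neq0; rewrite cabs_cexp expR_gt0. Qed.

Lemma sin_le_norm t : `|sin t| <= `|t|.
Proof.
have pos (s : R) : 0 < s -> `|sin s| <= s.
  move=> s0.
  have [c _] := @MVT R sin cos 0 s s0 (fun u _ => is_derive_sin u)
     (continuous_subspaceT (@continuous_sin R)).
  rewrite sin0 !subr0 => ->; rewrite normrM (gtr0_norm s0) ler_piMl ?cos_max//.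
  exact: ltW.
case: (ltrgt0P t) => [/pos//|t0|->]; last by rewrite sin0 normr0.
by move: (pos (- t)); rewrite sinN normrN oppr_gt0; apply.
Qed.

Lemma cos_sub1_le t : `|cos t - 1| <= t ^+ 2.
Proof.
have -> : cos t - 1 = - (sin (t / 2) ^+ 2 *+ 2).
  rewrite [in LHS](_ : t = (t / 2) *+ 2) ?cos_mulr2n ?sin2cos2; last by field.
  by ring.
rewrite normrN normrMn normrX.
have /(lerXn2r 2) : `|sin (t / 2)| <= `|t / 2| by exact: sin_le_norm.
rewrite !nnegrE !normr_ge0 => /(_ isT isT).
rewrite -[X in _ <= X -> _]normrX [X in _ <= X -> _]ger0_norm ?sqr_ge0 // => h.
have := sqr_ge0 t; move: h; rewrite exprMn; lra.
Qed.

Lemma sin_sub_le t : `|t| <= 1 -> `|sin t - t| <= t ^+ 2.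
Proof.
have pos (s : R) : 0 < s -> s <= 1 -> `|sin s - s| <= s ^+ 2.
  move=> s0 s1.
  have [] := @MVT R (fun u => sin u - u) (fun u => cos u - 1) 0 s s0.
  - by apply: continuous_subspaceT => u; apply: cvgB; [exact: continuous_sin|].
  move=> c; rewrite in_itv/= sin0 !subr0 => /andP[c0 cs] ->.
  rewrite normrM (gtr0_norm s0) expr2 ler_pM2r//.
  apply: le_trans (cos_sub1_le _) _; nra.
case: (ltrgt0P t) => [t0|t0|->]; last by rewrite sin0 subrr normr0 expr0n.
- exact: pos.
- move=> t1; move: (pos (- t)); rewrite sinN -opprD normrN sqrrN oppr_gt0; exact.
Qed.

Lemma expR_sub1_le t : `|t| <= 1/2 -> `|expR t - 1 - t| <= 2 * t ^+ 2.
Proof.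
rewrite ler_norml => /andP[h1 h2].
have e1 := expR_ge1Dx t; have e2 := expR_ge1Dx (- t).
rewrite ger0_norm; last by lra.
have : expR t * (1 - t) <= 1.
  by apply: le_trans (_ : expR t * expR (- t) <= 1);
    [rewrite ler_pM2l ?expR_gt0|rewrite -expRD subrr expR0].
nra.
Qed.

(** From this quadratic bound come the derivatives of [cexp] and [clog], and the
    rate of convergence of [(1 + z / n) ^ n]. *)
Lemma cexp_sub1_le w : cabs w <= 1/2 -> cabs (cexp w - 1 - w) <= 8 * cabs w ^+ 2.
Proof.
case: w => x y h.
have hx : `|x| <= 1/2 by apply: le_trans h; exact: (cabs_ge_Re (x +i* y)).
have hy : `|y| <= 1/2 by apply: le_trans h; exact: (cabs_ge_Im (x +i* y)).
apply: le_trans (cabs_le _) _; rewrite sqr_cabs /=.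
have hy1 : `|y| <= 1 by lra.
have := sin_sub_le hy1; have := cos_sub1_le y; have := expR_sub1_le hx.
have hc := cos_max y; have hs := sin_le_norm y.
set e := expR x; set c := cos y in hc *; set s := sin y in hs *.
move=> he hcy hsy.
have -> : e * c - 1 - x = (e - 1 - x) * c + (1 + x) * (c - 1) by ring.
have -> : e * s - 0 - y = (e - 1 - x) * s + x * s + (s - y) by ring.
have A1 : `|(e - 1 - x) * c| <= 2 * x ^+ 2.
  by rewrite normrM; apply: le_trans (ler_wpM2l (normr_ge0 _) hc) _; rewrite mulr1.
have A2 : `|(1 + x) * (c - 1)| <= 2 * y ^+ 2.
  rewrite normrM; apply: ler_pM => //.
  apply: le_trans (ler_normD _ _) _; rewrite normr1; lra.
have A3 : `|(e - 1 - x) * s| <= 2 * x ^+ 2.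
  rewrite normrM; apply: le_trans (ler_wpM2l (normr_ge0 _) (_ : `|s| <= 1)) _.
    by lra.
  by rewrite mulr1.
have A4 : `|x * s| <= x ^+ 2 + y ^+ 2.
  rewrite normrM; apply: le_trans (ler_wpM2l (normr_ge0 _) hs) _.
  rewrite -(real_normK (num_real x)) -(real_normK (num_real y)).
  have := normr_ge0 x; have := normr_ge0 y; nra.
have := ler_normD ((e - 1 - x) * c) ((1 + x) * (c - 1)).
have := ler_normD ((e - 1 - x) * s + x * s) (s - y).
have := ler_normD ((e - 1 - x) * s) (x * s).
have := sqr_ge0 x; have := sqr_ge0 y.
lra.
Qed.

End ComplexExponential.

(** * The logarithm on the slit plane *)

Section ComplexTopology.
Variable R : realType.
Implicit Types (z w : R[i]) (t : R).

Lemma nbhs_cabsP (z : R[i]^o) (P : set R[i]^o) :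
  nbhs z P <-> exists2 d : R, 0 < d & forall w, cabs (w - z) < d -> P w.
Proof.
split => [/nbhs_ballP[d d0 dP]|[d d0 dP]].
- exists (complex.Re d); first by move: d0; rewrite /= ltcE => /andP[].
  move=> w wz; apply: dP; rewrite -ball_normE /= distrC cabs_normE.
  by move: d0 wz; case: d => a b; rewrite /= !ltcE /= => /andP[/eqP-> _] ->; rewrite eqxx.
- apply/nbhs_ballP; exists d%:C; first by rewrite /= ltcR.
  by move=> w; rewrite -ball_normE /= distrC cabs_normE ltcR; exact: dP.
Qed.

Lemma cvg_cabsP (T : Type) (F : set_system T) (FF : Filter F) (f : T -> R[i]^o) (l : R[i]^o) :
  f x @[x --> F] --> l <-> forall e : R, 0 < e -> \forall x \near F, cabs (f x - l) < e.
Proof.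
split.
- move=> fl e e0; apply: (fl [set w | cabs (w - l) < e]).
  by apply/nbhs_cabsP; exists e.
- move=> h P /nbhs_cabsP[d d0 dP].
  by apply: filterS (h d d0) => x; exact: dP.
Qed.

Lemma Re_continuous : continuous (@complex.Re R : R[i]^o -> R).
Proof.
move=> z; apply/(@cvgrPdist_lt _ _ _ (nbhs (z : R[i]^o)) (nbhs_filter _)) => e e0; apply/nbhs_cabsP; exists e => // w wz.
have := cabs_ge_Re (z - w); rewrite cabsB => /le_lt_trans/(_ wz).
by case: (z) (w) => [? ?] [? ?].
Qed.

Lemma Im_continuous : continuous (@complex.Im R : R[i]^o -> R).
Proof.
move=> z; apply/(@cvgrPdist_lt _ _ _ (nbhs (z : R[i]^o)) (nbhs_filter _)) => e e0; apply/nbhs_cabsP; exists e => // w wz.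
have := cabs_ge_Im (z - w); rewrite cabsB => /le_lt_trans/(_ wz).
by case: (z) (w) => [? ?] [? ?].
Qed.

Lemma cabs_continuous : continuous (cabs : R[i]^o -> R).
Proof.
move=> z; apply/(@cvgrPdist_lt _ _ _ (nbhs (z : R[i]^o)) (nbhs_filter _)) => e e0; apply/nbhs_cabsP; exists e => // w wz.
apply: le_lt_trans wz; rewrite ler_norml.
have := cabsD (w - z) z; have := cabsD (z - w) w; rewrite !subrK (cabsB z w).
by move=> h1 h2; apply/andP; split; lra.
Qed.

Lemma derivable_expansion (f : R[i] -> R[i]) (z c : R[i]) :
  (forall e : R, 0 < e -> exists2 d : R, 0 < d & forall h, cabs h < d ->
     cabs (f (z + h) - f z - h * c) <= e * cabs h) ->
  derivable (f : R[i]^o -> R[i]^o) z 1.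
Proof.
move=> H; apply/cvg_ex; exists c; apply/cvg_cabsP => e e0.
have e20 : 0 < e / 2 by rewrite divr_gt0.
have [d d0 dH] := H _ e20.
apply/nbhs_cabsP; exists d => // h; rewrite subr0 => hd h0 /=.
have -> : h *: (1 : R[i]^o) + z = z + h by rewrite addrC /GRing.scale /= mulr1.
have -> : h^-1 *: (f (z + h) - f z) - c = h^-1 * (f (z + h) - f z - h * c).
  by rewrite [RHS]mulrBr mulKf.
have h0' := cabs_gt0 h0.
rewrite cabsM cabsV mulrC ltr_pdivrMr//.
by apply: le_lt_trans (dH _ hd) _; rewrite ltr_pM2r//; lra.
Qed.

End ComplexTopology.

Section SlitPlane.
Variable R : realType.
Implicit Types (z w : R[i]) (t : R).

(** The complement of the half-line of nonpositive reals, on which [clog] is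
    holomorphic. *)
Definition slit z := 0 < cabs z + complex.Re z.

(** [clog] divides by [cabs z + Re z], which vanishes on that half-line only. *)
Lemma slitP z : slit z <-> ~ (complex.Im z = 0 /\ complex.Re z <= 0).
Proof.
have h := sqr_cabs z; have h0 := cabs_ge0 z; rewrite /slit; split.
- move=> s [i0 r0]; rewrite i0 expr0n addr0 in h.
  have : cabs z = - complex.Re z.
    by apply/eqP; rewrite -(eqrXn2 (n := 2)) ?oppr_ge0 // sqrrN h.
  by move=> e; rewrite e addNr ltxx in s.
- move=> n; rewrite ltNge; apply/negP => s; apply: n.
  have r0 : complex.Re z <= 0 by lra.
  split => //; apply/eqP; rewrite -sqrf_eq0; apply/eqP.
  have := sqr_ge0 (complex.Im z); nra.
Qed.

Lemma Re_slit z : 0 < complex.Re z -> slit z.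
Proof. by move=> h; rewrite /slit ltr_wpDl// cabs_ge0. Qed.

Lemma slit_neq0 z : slit z -> z != 0.
Proof. by move=> s; apply/eqP => z0; move: s; rewrite z0 /slit cabs0 add0r ltxx. Qed.

Lemma slit_near z : slit z ->
  exists2 d : R, 0 < d & forall w, cabs (w - z) < d -> slit w.
Proof.
rewrite /slit => s; exists ((cabs z + complex.Re z) / 2); first by rewrite divr_gt0.
move=> w wz; have := cabsD (z - w) w; rewrite subrK cabsB.
have := cabs_ge_Re (z - w); rewrite cabsB ler_norml => /andP[_].
have -> : complex.Re (z - w) = complex.Re z - complex.Re w by case: (z) (w) => [? ?] [].
lra.
Qed.

Lemma slit_star z t : slit z -> 0 <= t <= 1 -> slit (1 + t%:C * (z - 1)).
Proof.
case: z => a b /slitP s /andP[t0 t1]; apply/slitP => -[].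
have -> : 1 + t%:C * ((a +i* b) - 1) = (1 + t * (a - 1)) +i* (t * b).
  by apply/eqP; rewrite eq_complex /=; apply/andP; split; apply/eqP; ring.
move=> /= /eqP; rewrite mulf_eq0 => /orP[/eqP-> | /eqP b0].
  by rewrite mul0r addr0 ler10.
move=> h; apply: s; split => //=; nra.
Qed.

(** The ratio [(z - w) / (z - v)] is a nonpositive real exactly when [z] lies on
    the segment from [w] to [v]; the hypothesis excludes this without a
    division. *)
Lemma slit_ratio (z w v : R[i]) : z != v ->
  (forall t, 0 <= t -> (1 + t)%:C * z != w + t%:C * v) -> slit ((z - w) / (z - v)).
Proof.
move=> zv h; apply/slitP; set q := _ / _ => -[q1 q2].
have zv0 : z - v != 0 by rewrite subr_eq0.
have qE : z - w = q * (z - v) by rewrite /q divfK.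
have qr : q = - (- complex.Re q)%:C.
  by rewrite rmorphN opprK; move: q1; case: (q) => a b /= ->.
set t := - complex.Re q in qr; have t0 : 0 <= t by rewrite oppr_ge0.
move/eqP: (h t t0); apply; rewrite real_complexD.
have -> : w = z - q * (z - v) by rewrite -qE; ring.
by rewrite qr; ring.
Qed.

Lemma cexp_clog z : slit z -> cexp (clog z) = z.
Proof.
move=> s; have z0 := cabs_gt0 (slit_neq0 s).
have := sqr_cabs z; case: z s z0 => x y; rewrite /slit /= => s z0.
rewrite -[Num.sqrt _]/(cabs (x +i* y)); set r := cabs _ in s z0 * => r2.
rewrite lnK ?posrE//; set u := y / (r + x).
have u0 : 0 < 1 + u ^+ 2 by rewrite ltr_pwDl// sqr_ge0.
have y2 : y ^+ 2 = r ^+ 2 - x ^+ 2 by rewrite r2; ring.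
have s0 : r + x != 0 by rewrite gt_eqF.
have r0 : r != 0 by rewrite gt_eqF.
have uE : 1 + u ^+ 2 = 2 * r / (r + x).
  by rewrite /u exprMn y2; field.
have c2 : cos (atan u) ^+ 2 = (r + x) / (2 * r).
  by rewrite cos_atan exprVn sqr_sqrtr ?ltW// uE invf_div.
have cn0 : cos (atan u) != 0 by rewrite cos_atan invr_eq0 sqrtr_eq0 -ltNge.
have su : sin (atan u) = u * cos (atan u).
  by move/(congr1 (fun k => k * cos (atan u))): (atanK u); rewrite /tan divfK.
have -> : 2 * atan u = atan u *+ 2 by rewrite mulr_natl.
rewrite cos_mulr2n sin_mulr2n su mulrCA -expr2 c2 /u.
by congr (_ +i* _); field; rewrite ?s0 ?r0.
Qed.

Lemma cexp_clog_nslit z : ~ slit z -> cexp (clog z) != z.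
Proof.
move=> /slitP/contrapT; case: z => x y /= [-> x0].
rewrite mul0r atan0 mulr0 /cexp cos0 sin0 mulr1 mulr0 eq_complex /= eqxx andbT.
by rewrite gt_eqF// (le_lt_trans x0)// expR_gt0.
Qed.

Lemma clog1 : clog (1 : R[i]) = 0.
Proof.
by rewrite /clog /= expr1n expr0n addr0 sqrtr1 ln1 mul0r atan0 mulr0.
Qed.

Lemma clog_i : clog ('i : R[i]) = 0 +i* (pi / 2).
Proof.
rewrite /clog /= expr0n expr1n add0r sqrtr1 ln1 addr0 divr1 atan1.
by congr (_ +i* _); field.
Qed.

Lemma clog_near z (e : R) : slit z -> 0 < e ->
  exists2 d : R, 0 < d & forall w, cabs (w - z) < d -> cabs (clog w - clog z) < e.
Proof.
move=> s e0; apply/nbhs_cabsP.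
pose F := nbhs (z : R[i]^o).
have FF : Filter F by exact: nbhs_filter.
have cc : (cabs w) @[w --> F] --> cabs z by exact: cabs_continuous.
have cR : complex.Re w @[w --> F] --> complex.Re z by exact: Re_continuous.
have cI : complex.Im w @[w --> F] --> complex.Im z by exact: Im_continuous.
have c1 : ln (cabs w) @[w --> F] --> ln (cabs z).
  by apply: continuous_cvg => //; apply: continuous_ln; exact/cabs_gt0/slit_neq0.
have c2 : 2 * atan (complex.Im w / (cabs w + complex.Re w)) @[w --> F] -->
          2 * atan (complex.Im z / (cabs z + complex.Re z)).
  apply: cvgM; first exact: cvg_cst.
  apply: continuous_cvg; first exact: continuous_atan.
  apply: cvgM => //; apply: cvgV; last exact: cvgD.
  by rewrite gt_eqF.
have e20 : 0 < e / 2 by rewrite divr_gt0.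
move/cvgrPdist_lt : c1 => /(_ _ e20) c1.
move/cvgrPdist_lt : c2 => /(_ _ e20) c2.
apply: filterS2 c1 c2 => w h1 h2; apply: le_lt_trans (cabs_le _) _.
rewrite distrC in h1; rewrite distrC in h2; rewrite (splitr e); apply: ltrD.
- by clear -h1; case: (z) (w) h1 => [? ?] [? ?].
- by clear -h2; case: (z) (w) h2 => [? ?] [? ?].
Qed.

(** If [d] is the difference of the logarithms, [w' - w = w * (cexp d - 1)], so
    the bound on [cexp d - 1 - d] gives the derivative. It is strict, that is,
    both points move: this is what telescoping Riemann sums require. *)
Lemma clog_expansion z (e : R) : slit z -> 0 < e ->
  exists2 d : R, 0 < d & forall w w', cabs (w - z) < d -> cabs (w' - z) < d ->
    cabs (clog w' - clog w - (w' - w) / w) <= e * cabs (w' - w).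
Proof.
move=> s e0; have z0 := cabs_gt0 (slit_neq0 s).
pose n := Num.min (1 / 16) (e * cabs z / 32).
have n0 : 0 < n by rewrite lt_min divr_gt0//= divr_gt0// mulr_gt0.
have n1 : n <= 1 / 16 by rewrite /n ge_min lexx.
have n2 : n <= e * cabs z / 32 by rewrite /n ge_min lexx orbT.
have [d1 d10 h1] := slit_near s.
have n20 : 0 < n / 2 by rewrite divr_gt0.
have [d2 d20 h2] := clog_near s n20.
exists (Num.min (cabs z / 2) (Num.min d1 d2)).
  by rewrite !lt_min d10 d20 divr_gt0.
move=> w w'; rewrite !lt_min => /and3P[w1 w2 w3] /and3P[w1' w2' w3'].
have [sw sw'] := (h1 _ w2, h1 _ w2').
have [lw lw'] := (h2 _ w3, h2 _ w3').
set d := clog w' - clog w.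
have dn : cabs d < n.
  have -> : d = (clog w' - clog z) + - (clog w - clog z) by rewrite /d; ring.
  by apply: le_lt_trans (cabsD _ _) _; rewrite cabsN; lra.
have w0 := slit_neq0 sw; have cw0 := cabs_gt0 w0.
have E : w' - w = w * (cexp d - 1).
  have -> : w' = w * cexp d.
    by rewrite -{1}(cexp_clog sw) -{1}(cexp_clog sw') -cexpD; congr cexp; rewrite /d; ring.
  by ring.
have d12 : cabs d <= 1 / 2 by lra.
have {}d12 := cexp_sub1_le d12.
have -> : d - (w' - w) / w = - (cexp d - 1 - d) by rewrite E [X in d - X]mulrC mulKf//; ring.
rewrite cabsN.
have wz : cabs z / 2 <= cabs w.
  by have := cabsD (z - w) w; rewrite subrK cabsB; lra.
have Ec : cabs (w' - w) = cabs w * cabs (cexp d - 1) by rewrite E cabsM.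
have tri : cabs d <= cabs (cexp d - 1) + cabs (cexp d - 1 - d).
  have -> : cabs d = cabs ((cexp d - 1) + - (cexp d - 1 - d)) by congr cabs; ring.
  by rewrite -[in X in _ <= _ + X]cabsN; exact: cabsD.
set D := cabs d in dn d12 tri *; have D0 : 0 <= D := cabs_ge0 d.
set E1 := cabs (cexp d - 1) in Ec tri.
have q1 : D ^+ 2 <= n * D by rewrite expr2 ler_wpM2r// ltW.
have q2 : n * D <= 1 / 16 * D by rewrite ler_wpM2r.
have q3 : D <= 2 * E1 by lra.
have q4 : n * D <= n * (2 * E1) by rewrite ler_pM2l.
have E10 : 0 <= E1 := cabs_ge0 _.
apply: le_trans d12 _; rewrite Ec.
have q5 : 16 * n * E1 <= 16 * (e * cabs z / 32) * E1.
  by rewrite ler_wpM2r// ler_pM2l.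
have q6 : e * E1 * (cabs z / 2) <= e * E1 * cabs w.
  by rewrite ler_wpM2l// mulr_ge0// ltW.
lra.
Qed.

Lemma clog_derivable z : slit z -> derivable (@clog R : R[i]^o -> R[i]^o) z 1.
Proof.
move=> s; apply: (@derivable_expansion _ _ _ z^-1) => e e0.
have [d d0 h] := clog_expansion s e0.
exists d => // k kd; have := h z (z + k); rewrite subrr cabs0 addrC addKr.
exact.
Qed.

Lemma cexp_derivable z : derivable (@cexp R : R[i]^o -> R[i]^o) z 1.
Proof.
apply: (@derivable_expansion _ _ _ (cexp z)) => e e0.
have c0 := cabs_gt0 (cexp_neq0 z).
exists (Num.min (1/2) (e / (8 * cabs (cexp z)))).
  by rewrite lt_min !divr_gt0// mulr_gt0.
move=> h; rewrite lt_min => /andP[h1 h2].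
rewrite ltr_pdivlMr ?mulr_gt0// in h2.
have -> : cexp (z + h) - cexp z - h * cexp z = cexp z * (cexp h - 1 - h).
  by rewrite cexpD; ring.
rewrite cabsM.
apply: le_trans (_ : cabs (cexp z) * (8 * cabs h ^+ 2) <= _).
  by rewrite ler_pM2l// cexp_sub1_le// ltW.
have := cabs_ge0 h; nra.
Qed.

(** At a point [x] of the half-line, [cexp (clog x) <> x], whereas
    [cexp (clog z) = z] off it: so [clog] is not continuous at [x]. *)
Lemma derivable_clog_slit z : derivable (@clog R : R[i]^o -> R[i]^o) z 1 -> slit z.
Proof.
move=> /derivable1_diffP/differentiable_continuous cz; apply: contrapT => nz.
have := cexp_clog_nslit nz; rewrite -subr_eq0 => /cabs_gt0.
set D := cabs _ => D0.
have := nz; move=> /slitP/contrapT[zi zr].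
set l := clog z in D D0.
have cl := cabs_gt0 (cexp_neq0 l).
pose n := Num.min (1/2) (D / (20 * cabs (cexp l))).
have n0 : 0 < n by rewrite lt_min !divr_gt0// mulr_gt0.
move/cvg_cabsP : cz => /(_ n n0) /nbhs_cabsP [d d0 dP].
pose k := Num.min (d / 2) (D / 4).
have k0 : 0 < k by rewrite lt_min !divr_gt0.
have k1 : k < d by rewrite /k gt_min; apply/orP; left; lra.
have k2 : k <= D / 4 by rewrite /k ge_min lexx orbT.
(* a point above the half-line, hence off it, that is close to [z] *)
pose w := z + 'i * k%:C.
have wz : cabs (w - z) = k.
  by rewrite /w addrC addKr cabsM cabs_i cabs_real mul1r gtr0_norm.
have sw : slit w.
  apply/slitP; rewrite /w; case: (z) zi => a b /= -> [/eqP]; rewrite mul0r mul1r !add0r.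
  by rewrite gt_eqF.
have := dP w; rewrite wz => /(_ k1); set h := clog w - _ => hn.
have h1 : n <= 1 / 2 by rewrite ge_min lexx.
have h2 : n <= D / (20 * cabs (cexp l)) by rewrite ge_min lexx orbT.
rewrite ler_pdivlMr ?mulr_gt0// in h2.
have wE : w = cexp l * cexp h.
  by rewrite -cexpD /h addrC subrK cexp_clog.
have hh : cabs h <= 1 / 2 by rewrite ltW// (lt_le_trans hn).
have := cexp_sub1_le hh => e1.
have e2 : cabs (cexp h - 1) <= 5 * cabs h.
  have -> : cexp h - 1 = (cexp h - 1 - h) + h by rewrite subrK.
  by apply: le_trans (cabsD _ _) _; have := cabs_ge0 h; nra.
have : D <= cabs (w - z) + cabs (cexp l * (cexp h - 1)).
  rewrite -[X in _ <= _ + X]cabsN; apply: le_trans (cabsD _ _).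
  by rewrite le_eqVlt; apply/orP; left; apply/eqP; congr cabs; rewrite wE; ring.
rewrite wz cabsM.
have : cabs (cexp l) * cabs (cexp h - 1) <= cabs (cexp l) * (5 * n).
  by rewrite ler_pM2l//; lra.
lra.
Qed.

End SlitPlane.

(** * Real-valued norms and Riemann sums *)

Section UniformOnUnitInterval.
Variable R : realType.

(** Heine-Borel for [0, 1]: a scale-dependent property that holds near every
    point at some scale holds everywhere at a common scale. *)
Lemma uniform_scale01 (P : R -> R -> Prop) :
  (forall d d' t, d' <= d -> P d t -> P d' t) ->
  (forall t, 0 <= t <= 1 -> exists2 d : R, 0 < d &
     forall s, 0 <= s <= 1 -> `|s - t| < d -> P d s) ->
  exists2 d : R, 0 < d & forall s, 0 <= s <= 1 -> P d s.
Proof.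
move=> mono loc.
have /compact_near_coveringP/near_covering_withinP cov := @segment_compact R 0 1.
have [] := cov _ (0:R)^'+ P _ _.
- move=> t; rewrite /= in_itv/= => /loc[d d0 dP].
  exists (ball t d, [set e | 0 < e < d]).
    split => /=; first by apply/nbhs_ballP; exists d.
    rewrite near_simpl; near=> e; apply/andP; split; near: e.
      exact: nbhs_right_gt.
    exact: nbhs_right_lt.
  move=> [s e] /= []; rewrite -ball_normE /= distrC in_itv /= => st /andP[e0 ed] s01.
  exact/(mono d)/dP/st/s01/ltW.
- move=> d /= d0 dP; exists (d / 2); first by rewrite divr_gt0.
  move=> s s01; apply: (dP (d / 2)); [|by rewrite divr_gt0|by rewrite /= in_itv].
  rewrite /= sub0r normrN gtr0_norm ?divr_gt0//; lra.
Unshelve. all: by end_near. Qed.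

Lemma uniform_scale01_2 (P : R -> R -> R -> Prop) :
  (forall d d' t s, d' <= d -> P d t s -> P d' t s) ->
  (forall t s, 0 <= t <= 1 -> 0 <= s <= 1 -> exists2 d : R, 0 < d &
     forall t' s', 0 <= t' <= 1 -> 0 <= s' <= 1 ->
       `|t' - t| < d -> `|s' - s| < d -> P d t' s') ->
  exists2 d : R, 0 < d & forall t s, 0 <= t <= 1 -> 0 <= s <= 1 -> P d t s.
Proof.
move=> mono loc.
have [|t t01|d d0 dP] := @uniform_scale01 (fun d t => forall s, 0 <= s <= 1 -> P d t s).
- by move=> d d' t dd h s s01; apply: mono dd (h s s01).
- have [||d d0 dP] := @uniform_scale01
    (fun d s => forall t', 0 <= t' <= 1 -> `|t' - t| < d -> P d t' s).
  + move=> d d' s dd h t' t'01 tt'; apply: (mono _ _ _ _ dd).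
    by apply: h => //; exact: lt_le_trans tt' dd.
  + move=> s s01; have [d d0 dP] := loc t s t01 s01; exists d => //.
    by move=> s' s'01 ss' t' t'01 tt'; apply: dP.
  + by exists d => // t' t'01 tt' s s01; apply: dP.
- by exists d => // t s t01 s01; apply: dP.
Qed.

End UniformOnUnitInterval.

(** Real-valued norms, as predicates rather than structures: the same theory
    then serves for the scalars, for a C*-algebra and for its matrix algebras,
    whose topology comes without a norm. *)
Record vnorm (R : realType) (V : lmodType R[i]) (N : V -> R) : Prop := VNorm {
  vnormD : forall x y, N (x + y) <= N x + N y;
  vnormZ : forall c x, N (c *: x) = cabs c * N x;
  vnorm_eq0 : forall x, N x = 0 -> x = 0 }.

Definition ncvg (R : realType) (V : lmodType R[i]) (N : V -> R)
    (u : nat -> V) (l : V) : Prop :=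
  forall e, 0 < e -> \forall n \near \oo, N (u n - l) <= e.

Section VectorNorm.
Variables (R : realType) (V : lmodType R[i]) (N : V -> R).
Hypothesis VN : vnorm N.
Implicit Types (x y : V) (u v : nat -> V).

Lemma vnorm0 : N 0 = 0.
Proof. by rewrite -[0](scale0r (0 : V)) (vnormZ VN) cabs0 mul0r. Qed.

Lemma vnormN x : N (- x) = N x.
Proof. by rewrite -scaleN1r (vnormZ VN) cabsN cabs1 mul1r. Qed.

Lemma vnorm_ge0 x : 0 <= N x.
Proof. have := vnormD VN x (- x); rewrite vnormN subrr vnorm0; lra. Qed.

Lemma vnormB x y : N (x - y) <= N x + N y.
Proof. by rewrite -(vnormN y); exact: vnormD. Qed.

Lemma vnorm_distC x y : N (x - y) = N (y - x).
Proof. by rewrite -vnormN opprB. Qed.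

Lemma vnorm_triangle z x y : N (x - y) <= N (x - z) + N (z - y).
Proof. by rewrite -[x - y](subrKA z); exact: vnormD. Qed.

Lemma vnorm_sum (I : Type) (r : seq I) (P : pred I) (F : I -> V) :
  N (\sum_(i <- r | P i) F i) <= \sum_(i <- r | P i) N (F i).
Proof.
elim/big_rec2: _ => [|i y x _ h]; first by rewrite vnorm0.
by apply: le_trans (vnormD VN _ _) _; rewrite lerD2l.
Qed.

Lemma ncvg_near_le (u : nat -> V) l (b : nat -> R) :
  (forall e, 0 < e -> \forall n \near \oo, b n <= e) ->
  (\forall n \near \oo, N (u n - l) <= b n) -> ncvg N u l.
Proof.
move=> hb h e e0; near=> n; apply: (@le_trans _ _ (b n)); near: n => //.
exact: hb.
Unshelve. all: by end_near. Qed.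

Lemma inv_nat_small (C e : R) : 0 < e -> \forall n \near \oo, C / n.+1%:R <= e.
Proof.
move=> e0; have e1 : 0 < e / (`|C| + 1) by rewrite divr_gt0// ltr_wpDl.
near=> n.
have : n.+1%:R^-1 < e / (`|C| + 1).
  by near: n; exact: near_infty_natSinv_lt (PosNum e1).
rewrite ltr_pdivlMr ?ltr_wpDl// => h.
have n0 : 0 < n.+1%:R^-1 :> R by rewrite invr_gt0.
have : C * n.+1%:R^-1 <= `|C| * n.+1%:R^-1 by apply: ler_wpM2r; [exact: ltW|exact: ler_norm].
move: (n.+1%:R^-1) h n0 => k h n0 h'; lra.
Unshelve. all: by end_near. Qed.

Lemma ncvg_inv_nat u l (C : R) : (forall n, N (u n - l) <= C / n.+1%:R) -> ncvg N u l.
Proof.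
move=> h; apply: (@ncvg_near_le _ _ (fun n => C / n.+1%:R)); last exact: nearW.
exact: inv_nat_small.
Qed.

Lemma le_forall_eps (a b : R) : (forall e, 0 < e -> a <= b + e) -> a <= b.
Proof. by move=> h; apply/ler_addgt0Pr => e e0; exact: h. Qed.

Lemma ncvg_unique u l l' : ncvg N u l -> ncvg N u l' -> l = l'.
Proof.
move=> h h'; apply/eqP; rewrite -subr_eq0; apply/eqP/(vnorm_eq0 VN)/eqP.
rewrite eq_le vnorm_ge0 andbT; apply: le_forall_eps => e e0; rewrite add0r.
have e20 : 0 < e / 2 by rewrite divr_gt0.
near \oo => n; apply: le_trans (vnorm_triangle (u n) _ _) _.
rewrite (splitr e) vnorm_distC lerD//; near: n; [exact: h|exact: h'].
Unshelve. all: by end_near. Qed.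

Lemma ncvg_norm_le u l (C : R) : ncvg N u l -> (\forall n \near \oo, N (u n) <= C) -> N l <= C.
Proof.
move=> h b; apply: le_forall_eps => e e0; near \oo => n.
have := vnormD VN (l - u n) (u n); rewrite subrK vnorm_distC.
have : N (u n - l) <= e by near: n; exact: h.
have : N (u n) <= C by near: n.
lra.
Unshelve. all: by end_near. Qed.

Lemma ncvg_dist_le u l v k (C : R) : ncvg N u l -> ncvg N v k ->
  (\forall n \near \oo, N (u n - v n) <= C) -> N (l - k) <= C.
Proof.
move=> h h' b; apply: (@ncvg_norm_le (fun n => u n - v n)) => // e e0.
have e20 : 0 < e / 2 by rewrite divr_gt0.
near=> n.
have -> : u n - v n - (l - k) = (u n - l) - (v n - k) by rewrite (opprD l) addrACA -opprD.
rewrite (splitr e); apply: le_trans (vnormB _ _) _.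
by apply: lerD; near: n; [exact: h|exact: h'].
Unshelve. all: by end_near. Qed.

Lemma eq_ncvg u v l : u =1 v -> ncvg N u l -> ncvg N v l.
Proof. by move=> /funext ->. Qed.

Lemma ncvg_cst l : ncvg N (fun=> l) l.
Proof. by move=> e e0; apply: nearW => n; rewrite subrr vnorm0 ltW. Qed.

Lemma ncvgD u v l k : ncvg N u l -> ncvg N v k -> ncvg N (fun n => u n + v n) (l + k).
Proof.
move=> h h' e e0; have e20 : 0 < e / 2 by rewrite divr_gt0.
near=> n; rewrite opprD addrACA (splitr e); apply: le_trans (vnormD VN _ _) _.
by apply: lerD; near: n; [exact: h|exact: h'].
Unshelve. all: by end_near. Qed.

Lemma ncvgZ c u l : ncvg N u l -> ncvg N (fun n => c *: u n) (c *: l).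
Proof.
move=> h e e0; have d0 : 0 < e / (cabs c + 1) by rewrite divr_gt0// ltr_wpDl// cabs_ge0.
near=> n; rewrite -scalerBr (vnormZ VN).
have : N (u n - l) <= e / (cabs c + 1) by near: n; exact: h.
rewrite ler_pdivlMr ?ltr_wpDl ?cabs_ge0//.
have := cabs_ge0 c; have := vnorm_ge0 (u n - l); nra.
Unshelve. all: by end_near. Qed.

Lemma ncvgN u l : ncvg N u l -> ncvg N (fun n => - u n) (- l).
Proof.
move=> h; rewrite -scaleN1r (_ : (fun n => - u n) = (fun n => -1 *: u n)).
  exact: ncvgZ.
by apply/funext => n; rewrite scaleN1r.
Qed.

Lemma ncvgB u v l k : ncvg N u l -> ncvg N v k -> ncvg N (fun n => u n - v n) (l - k).
Proof. by move=> h /ncvgN h'; exact: ncvgD. Qed.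

Lemma ncvg_sum (I : Type) (r : seq I) (u : I -> nat -> V) (l : I -> V) :
  (forall i, ncvg N (u i) (l i)) ->
  ncvg N (fun n => \sum_(i <- r) u i n) (\sum_(i <- r) l i).
Proof.
move=> h; elim: r => [|i r IH].
  by rewrite big_nil; under eq_fun do rewrite big_nil; exact: ncvg_cst.
by rewrite big_cons; under eq_fun do rewrite big_cons; exact: ncvgD.
Qed.

End VectorNorm.

Section RiemannSums.
Variables (R : realType) (V : lmodType R[i]) (N : V -> R).
Hypothesis VN : vnorm N.

Definition rsum (v : R -> V) (n : nat) : V :=
  \sum_(k < n.+1) (n.+1%:R^-1 : R[i]) *: v (k%:R / n.+1%:R).

Lemma cabs_invn (n : nat) : cabs (n.+1%:R^-1 : R[i]) = n.+1%:R^-1.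
Proof.
by rewrite cabsV -(rmorph_nat (real_complex R)) /= cabs_real ger0_norm.
Qed.

Lemma grid01 (n k : nat) : (k <= n.+1)%N -> 0 <= (k%:R / n.+1%:R : R) <= 1.
Proof.
move=> kn; rewrite divr_ge0//= ler_pdivrMr// mul1r ler_nat//.
Qed.

Lemma ord_grid01 (n : nat) (k : 'I_n.+1) : 0 <= (k%:R / n.+1%:R : R) <= 1.
Proof. by apply: grid01; rewrite ltnW. Qed.

Lemma rsumB v w n : rsum (fun t => v t - w t) n = rsum v n - rsum w n.
Proof. by rewrite /rsum -sumrB; apply: eq_bigr => k _; rewrite scalerBr. Qed.

Lemma vnorm_rsum v n (C : R) : (forall t, 0 <= t <= 1 -> N (v t) <= C) ->
  N (rsum v n) <= C.
Proof.
move=> h; apply: le_trans (vnorm_sum VN _ _ _) _.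
apply: le_trans (_ : \sum_(k < n.+1) n.+1%:R^-1 * C <= _).
  apply: ler_sum => k _; rewrite (vnormZ VN) cabs_invn ler_wpM2l ?invr_ge0//.
  exact/h/ord_grid01.
by rewrite sumr_const card_ord -mulrnAl -mulr_natr mulVf ?mul1r.
Qed.

Lemma eq_rsum v w n : (forall t, 0 <= t <= 1 -> v t = w t) -> rsum v n = rsum w n.
Proof.
by move=> h; apply: eq_bigr => k _; rewrite h// ord_grid01.
Qed.

(** The fundamental theorem of calculus. By compactness the strict derivative
    gives one mesh below which every step of the Riemann sum differs from the
    increment of [u] by at most [e] times its length; the increments
    telescope. *)
Lemma rsum_derivative (u v : R -> V) :
  (forall t (e : R), 0 <= t <= 1 -> 0 < e -> exists2 d : R, 0 < d &
    forall s s', 0 <= s <= 1 -> 0 <= s' <= 1 -> `|s - t| < d -> `|s' - t| < d ->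
    N (u s' - u s - (s' - s)%:C *: v s) <= e * `|s' - s|) ->
  ncvg N (rsum v) (u 1 - u 0).
Proof.
move=> H e e0.
pose P d t := forall s, 0 <= s <= 1 -> `|s - t| < d ->
  N (u s - u t - (s - t)%:C *: v t) <= e * `|s - t|.
have [||d d0 dP] := @uniform_scale01 R P.
- by move=> d d' t dd h s s01 st; apply: h => //; exact: lt_le_trans dd.
- move=> t t01; have [d d0 dP] := H t e t01 e0.
  exists (d / 2); first by rewrite divr_gt0.
  move=> s s01 st s' s'01 s't; apply: dP => //; first lra.
  by have := ler_distD s s' t; lra.
near=> n.
have nd : n.+1%:R^-1 < d by near: n; exact: near_infty_natSinv_lt (PosNum d0).
have tel : u 1 - u 0 = \sum_(k < n.+1) (u (k.+1%:R / n.+1%:R) - u (k%:R / n.+1%:R)).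
  rewrite -(big_mkord xpredT (fun k => u (k.+1%:R / n.+1%:R) - u (k%:R / n.+1%:R))).
  by rewrite telescope_sumr// divff// mul0r.
rewrite (vnorm_distC VN) tel -sumrB.
apply: le_trans (vnorm_sum VN _ _ _) _.
apply: le_trans (_ : \sum_(k < n.+1) e * n.+1%:R^-1 <= _); last first.
  by rewrite sumr_const card_ord -mulrnAr -mulr_natr mulVf ?mulr1.
apply: ler_sum => k _.
have step : k.+1%:R / n.+1%:R - k%:R / n.+1%:R = n.+1%:R^-1 :> R.
  by rewrite -mulrBl -natrB// subSnn mul1r.
have stepn : `|k.+1%:R / n.+1%:R - k%:R / n.+1%:R : R| = n.+1%:R^-1.
  by rewrite step ger0_norm.
have := dP _ (ord_grid01 k) (k.+1%:R / n.+1%:R) (grid01 (ltn_ord k)).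
rewrite stepn => /(_ nd); rewrite step.
by rewrite (_ : (n.+1%:R^-1)%:C = n.+1%:R^-1)// fmorphV rmorph_nat.
Unshelve. all: by end_near. Qed.

Lemma big_nat_mul (F : nat -> V) (n m : nat) :
  \sum_(k < n * m) F k = \sum_(i < n) \sum_(j < m) F (i * m + j)%N.
Proof.
elim: n => [|n IH]; first by rewrite !big_ord0.
rewrite big_ord_recr /= -IH mulSnr big_split_ord /=.
by congr (_ + _).
Qed.

Lemma rsum_refine (v : R -> V) (C : R) (n m : nat) : 0 <= C ->
  (forall s t, 0 <= s <= 1 -> 0 <= t <= 1 -> N (v s - v t) <= C * `|s - t|) ->
  N (rsum v n - rsum v (n.+1 * m.+1).-1) <= C / n.+1%:R.
Proof.
move=> C0 H; rewrite /rsum prednK ?muln_gt0//.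
rewrite (big_nat_mul (fun k => ((n.+1 * m.+1)%:R^-1 : R[i]) *: v (k%:R / (n.+1 * m.+1)%:R))).
rewrite -sumrB; apply: le_trans (vnorm_sum VN _ _ _) _.
apply: le_trans (_ : \sum_(k < n.+1) n.+1%:R^-1 * (C / n.+1%:R) <= _); last first.
  by rewrite sumr_const card_ord -mulrnAl -mulr_natr mulVf ?mul1r.
apply: ler_sum => k _.
have -> : (n.+1%:R^-1 : R[i]) *: v (k%:R / n.+1%:R) =
   \sum_(j < m.+1) ((n.+1 * m.+1)%:R^-1 : R[i]) *: v (k%:R / n.+1%:R).
  rewrite sumr_const card_ord scalerMnl -[in RHS]mulr_natr natrM invfM.
  by rewrite divfK// pnatr_eq0.
rewrite -sumrB; apply: le_trans (vnorm_sum VN _ _ _) _.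
apply: le_trans (_ : \sum_(j < m.+1) (n.+1 * m.+1)%:R^-1 * (C / n.+1%:R) <= _); last first.
  rewrite sumr_const card_ord -mulrnAl -mulr_natr natrM invfM mulfVK// pnatr_eq0//.
apply: ler_sum => j _; rewrite -scalerBr (vnormZ VN).
have -> : cabs ((n.+1 * m.+1)%:R^-1 : R[i]) = (n.+1 * m.+1)%:R^-1.
  by rewrite mulSn addSn cabs_invn.
rewrite ler_wpM2l ?invr_ge0//.
have lt : (k * m.+1 + j < n.+1 * m.+1)%N.
  apply: leq_trans (_ : (k * m.+1 + m.+1 <= _)%N); first by rewrite ltn_add2l.
  by rewrite -mulSnr leq_mul2r ltn_ord orbT.
apply: le_trans (H _ _ (ord_grid01 k) _) _.
  have := @grid01 (n.+1 * m.+1).-1 (k * m.+1 + j)%N; rewrite prednK ?muln_gt0//.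
  by apply; exact: ltnW.
rewrite ler_wpM2l//.
have -> : k%:R / n.+1%:R - (k * m.+1 + j)%:R / (n.+1 * m.+1)%:R =
   - (j%:R / m.+1%:R * n.+1%:R^-1) :> R.
  rewrite natrD !natrM; field.
  by rewrite !nat1r !pnatr_eq0.
rewrite normrN ger0_norm ?mulr_ge0// ler_piMl//.
by have /andP[] := ord_grid01 j.
Qed.

(** Two subdivisions are compared through their common refinement, so no limit
    has to be known beforehand: this is a Cauchy criterion. *)
Lemma rsum_dist (v : R -> V) (C : R) (n m : nat) : 0 <= C ->
  (forall s t, 0 <= s <= 1 -> 0 <= t <= 1 -> N (v s - v t) <= C * `|s - t|) ->
  N (rsum v n - rsum v m) <= C / n.+1%:R + C / m.+1%:R.
Proof.
move=> C0 H; have h1 := rsum_refine n m C0 H; have h2 := rsum_refine m n C0 H.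
rewrite mulnC in h2; apply: le_trans (vnorm_triangle VN (rsum v (n.+1 * m.+1).-1) _ _) _.
by apply: lerD => //; rewrite (vnorm_distC VN).
Qed.

Lemma rsum_rate (v : R -> V) (C : R) (l : V) (n : nat) : 0 <= C ->
  (forall s t, 0 <= s <= 1 -> 0 <= t <= 1 -> N (v s - v t) <= C * `|s - t|) ->
  ncvg N (rsum v) l -> N (rsum v n - l) <= C / n.+1%:R.
Proof.
move=> C0 H vl; apply: le_forall_eps => e e0.
apply: (@ncvg_dist_le _ _ _ VN (fun=> rsum v n) _ (rsum v)) => //.
  exact: ncvg_cst.
near=> m; apply: le_trans (rsum_dist n m C0 H) _; rewrite lerD2l.
by near: m; exact: inv_nat_small.
Unshelve. all: by end_near. Qed.

End RiemannSums.

(** * Strict derivatives of complex functions *)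

Section StrictDerivative.
Variable R : realType.
Implicit Types (z w : R[i]).

Lemma vnorm_cabs : @vnorm R (R[i]^o) cabs.
Proof.
split; [exact: cabsD| |exact: cabs_eq0].
by move=> c x; rewrite -cabsM.
Qed.

(** Strict differentiability, with the derivative evaluated at one of the two
    moving points, as in a term of a Riemann sum: [g] is integrated by means of
    [F] with no separate continuity argument. *)
Definition sdiffc (F g : R[i] -> R[i]) z : Prop :=
  forall e : R, 0 < e -> exists2 d : R, 0 < d & forall w w',
    cabs (w - z) < d -> cabs (w' - z) < d ->
    cabs (F w' - F w - (w' - w) * g w) <= e * cabs (w' - w).

Lemma sdiffc_clog z : slit z -> sdiffc (@clog R) (fun w => w^-1) z.
Proof. by move=> s e e0; exact: clog_expansion. Qed.

Lemma sdiffc_affine a b z : sdiffc (fun w => a + w * b) (fun=> b) z.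
Proof.
move=> e e0; exists 1 => // w w' _ _.
rewrite (_ : _ - _ = 0) ?cabs0 ?mulr_ge0 ?cabs_ge0 ?ltW//.
by ring.
Qed.

Lemma sdiffc_inv v z : z != v ->
  sdiffc (fun w => (w - v)^-1) (fun w => - (w - v) ^- 2) z.
Proof.
move=> zv e e0; have c0 : 0 < cabs (z - v) by rewrite cabs_gt0// subr_eq0.
set c := cabs (z - v) in c0.
pose d := Num.min (c / 2) (e * c ^+ 3 / 16).
have d0 : 0 < d by rewrite lt_min !divr_gt0// mulr_gt0// exprn_gt0.
have d1 : d <= c / 2 by rewrite ge_min lexx.
have d2 : d <= e * c ^+ 3 / 16 by rewrite ge_min lexx orbT.
exists d => // w w' wz wz'.
have low u : cabs (u - z) < d -> c / 2 <= cabs (u - v).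
  move=> uz; have := cabsD (z - u) (u - v); rewrite subrKA (cabsB z u) -/c.
  by lra.
have [l1 l2] := (low _ wz, low _ wz').
have n1 : w - v != 0 by apply: cabs_neq0; lra.
have n2 : w' - v != 0 by apply: cabs_neq0; lra.
have -> : (w' - v)^-1 - (w - v)^-1 - (w' - w) * - (w - v) ^- 2 =
   (w' - w) ^+ 2 / ((w - v) ^+ 2 * (w' - v)).
  by field; rewrite n1 n2.
rewrite (cabsM (_ ^+ 2)) cabsV (cabsM (_ ^+ 2)) !cabsX ler_pdivrMr; last first.
  by rewrite mulr_gt0 ?exprn_gt0//; lra.
have ww : cabs (w' - w) <= 2 * d.
  have := cabsD (w' - z) (z - w); rewrite subrKA (cabsB z w); lra.
have p1 : c ^+ 3 / 8 <= cabs (w - v) ^+ 2 * cabs (w' - v).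
  have -> : c ^+ 3 / 8 = (c / 2) ^+ 2 * (c / 2) by field.
  apply: ler_pM => //; rewrite ?sqr_ge0//; first by rewrite divr_ge0 ?ltW.
  by rewrite lerXn2r ?nnegrE//; lra.
set K := _ ^+ 2 * _ in p1 *; have := cabs_ge0 (w' - w); set D := cabs _ in ww *.
move=> D0; have p2 : e * (c ^+ 3 / 8) <= e * K by rewrite ler_pM2l.
rewrite expr2 mulrAC; apply: ler_wpM2r => //; lra.
Qed.

(** Logarithms of affine maps and of homographies are the primitives by
    which winding numbers are compared. *)
Lemma sdiffc_clog_comp (q q' : R[i] -> R[i]) z :
  slit (q z) -> sdiffc q q' z ->
  sdiffc (fun w => clog (q w)) (fun w => q' w / q w) z.
Proof.
move=> s hq.
have [d1 d10 h1] := hq 1 ltr01.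
pose M := cabs (q' z) + 3.
have M0 : 0 < M by rewrite ltr_wpDl// cabs_ge0.
(* strict differentiability makes q Lipschitz near z *)
have lip w w' : cabs (w - z) < d1 -> cabs (w' - z) < d1 -> cabs (q w' - q w) <= M * cabs (w' - w).
  move=> hw hw'.
  have b1 u : cabs (u - z) < d1 -> cabs (q' u) <= cabs (q' z) + 2.
    move=> hu; have [->|uz] := eqVneq u z; first by lra.
    have z1 : cabs (z - z) < d1 by rewrite subrr cabs0.
    have i1 := h1 z u z1 hu; have i2 := h1 u z hu z1.
    have uz0 : 0 < cabs (u - z) by rewrite cabs_gt0// subr_eq0.
    have : cabs ((u - z) * (q' u - q' z)) <= 2 * cabs (u - z).
      have -> : (u - z) * (q' u - q' z) =
         (q u - q z - (u - z) * q' z) + (q z - q u - (z - u) * q' u) by ring.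
      apply: le_trans (cabsD _ _) _; rewrite mulr_natl mulr2n.
      by apply: lerD; rewrite -[cabs (u - z)]mul1r// -(cabsB z u).
    rewrite cabsM mulrC ler_pM2r// => i3.
    by have := cabsD (q' u - q' z) (q' z); rewrite subrK; lra.
  have := h1 w w' hw hw'; have := b1 _ hw; rewrite /M => i1 i2.
  have := cabsD (q w' - q w - (w' - w) * q' w) ((w' - w) * q' w).
  rewrite subrK cabsM => i3.
  have i4 : cabs (w' - w) * cabs (q' w) <= cabs (w' - w) * (cabs (q' z) + 2).
    by rewrite ler_wpM2l// cabs_ge0.
  have i5 : cabs (q w' - q w - (w' - w) * q' w) <= 1 * cabs (w' - w) by [].
  lra.
move=> e e0; have e1 : 0 < e / (2 * M) by rewrite divr_gt0// mulr_gt0.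
have [d2 d20 h2] := clog_expansion s e1.
have c0 := cabs_gt0 (slit_neq0 s); set c := cabs (q z) in c0.
have e2 : 0 < e * c / 4 by rewrite divr_gt0// mulr_gt0.
have [d3 d30 h3] := hq _ e2.
pose d := Num.min (Num.min d1 d3) (Num.min d2 (c / 2) / M).
have m0 : 0 < Num.min d2 (c / 2) by rewrite lt_min d20 divr_gt0.
have d0 : 0 < d by rewrite !lt_min d10 d30 divr_gt0.
exists d => // w w'; rewrite !lt_min -!andbA => /and3P[w1 w3 w2] /and3P[w1' w3' w2'].
have zz : cabs (z - z) < d1 by rewrite subrr cabs0.
rewrite ltr_pdivlMr// lt_min mulrC in w2; rewrite ltr_pdivlMr// lt_min mulrC in w2'.
have /andP[x1 x2] := w2; have /andP[x1' _] := w2'.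
have l1 := lip z w zz w1; have l2 := lip z w' zz w1'; have l3 := lip w w' w1 w1'.
have y1 := h2 (q w) (q w') (le_lt_trans l1 x1) (le_lt_trans l2 x1').
have y2 : cabs (q w' - q w - (w' - w) * q' w) <= e * c / 4 * cabs (w' - w) := h3 w w' w3 w3'.
have low : c / 2 <= cabs (q w).
  by have := cabsD (q z - q w) (q w); rewrite subrK (cabsB (q z)) -/c; lra.
have qw0 : q w != 0 by apply: cabs_neq0; lra.
have -> : clog (q w') - clog (q w) - (w' - w) * (q' w / q w) =
   (clog (q w') - clog (q w) - (q w' - q w) / q w) +
   (q w' - q w - (w' - w) * q' w) / q w.
  by field.
apply: le_trans (cabsD _ _) _.
have D0 := cabs_ge0 (w' - w); set D := cabs (w' - w) in D0 l3 y1 y2 *.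
have y3 : cabs (clog (q w') - clog (q w) - (q w' - q w) / q w) <= e / 2 * D.
  apply: le_trans y1 _; have -> : e / 2 * D = e / (2 * M) * (M * D).
    by field; rewrite gt_eqF.
  by rewrite ler_pM2l.
have y4 : cabs ((q w' - q w - (w' - w) * q' w) / q w) <= e / 2 * D.
  rewrite cabsM cabsV ler_pdivrMr; last lra.
  apply: le_trans y2 _; have : 0 <= e * D by rewrite mulr_ge0// ltW.
  nra.
lra.
Qed.

End StrictDerivative.

(** * Contour sums along polygonal cycles *)

Section Cycles.
Variable R : realType.
Implicit Types (G : seq (seq R[i])) (z w : R[i]).

Lemma segment_pointB (e : R[i] * R[i]) (s t : R) :
  segment_point e s - segment_point e t = (s - t)%:C * (e.2 - e.1).
Proof. by rewrite /segment_point rmorphB; ring. Qed.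

Lemma segment_point0 (e : R[i] * R[i]) : segment_point e 0 = e.1.
Proof. by rewrite /segment_point mul0r addr0. Qed.

Lemma segment_point1 (e : R[i] * R[i]) : segment_point e 1 = e.2.
Proof. by rewrite /segment_point mul1r addrC subrK. Qed.

Lemma cabs_segment_pointB (e : R[i] * R[i]) (s t : R) :
  cabs (segment_point e s - segment_point e t) = `|s - t| * cabs (e.2 - e.1).
Proof. by rewrite segment_pointB cabsM cabs_real. Qed.

Lemma cycle_supportP G e t : e \in cycle_edges G -> 0 <= t <= 1 ->
  cycle_support G (segment_point e t).
Proof. by move=> eG t01; exists e => //; exists t. Qed.

Lemma big_polygon_edges (V : zmodType) (s : seq R[i]) (f : R[i] -> V) :
  \sum_(e <- polygon_edges s) (f e.2 - f e.1) = 0.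
Proof.
have sz : size s = size (rot 1 s) by rewrite size_rot.
rewrite big_split /= sumrN.
rewrite -(big_map (fun e => e.2) xpredT f) -(big_map (fun e => e.1) xpredT f).
rewrite -/(unzip2 _) -/(unzip1 _) unzip2_zip ?sz// unzip1_zip ?sz//.
by rewrite (perm_big s) ?perm_rot// subrr.
Qed.

Lemma big_cycle_edges (V : zmodType) G (f : R[i] -> V) :
  \sum_(e <- cycle_edges G) (f e.2 - f e.1) = 0.
Proof.
rewrite /cycle_edges; elim: G => [|s G IH] /=; first by rewrite big_nil.
by rewrite big_cat /= IH big_polygon_edges addr0.
Qed.

(** Compactness of the support, from that of [0, 1] on each edge. *)
Lemma uniform_scale_support G (P : R -> R[i] -> Prop) :
  (forall d d' z, d' <= d -> P d z -> P d' z) ->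
  (forall z, cycle_support G z -> exists2 d : R, 0 < d &
     forall w, cabs (w - z) < d -> P d w) ->
  exists2 d : R, 0 < d & forall z, cycle_support G z -> P d z.
Proof.
move=> mono loc.
suff [d d0 dP] : exists2 d : R, 0 < d & forall e, e \in cycle_edges G ->
    forall t, 0 <= t <= 1 -> P d (segment_point e t).
  by exists d => // z [e eG [t t01 ->]]; exact: dP.
have {}loc e t : e \in cycle_edges G -> 0 <= t <= 1 -> exists2 d : R, 0 < d &
    forall w, cabs (w - segment_point e t) < d -> P d w.
  by move=> eG t01; apply: loc; exact: cycle_supportP.
elim: (cycle_edges G) loc => [|e r IH] loc; first by exists 1.
have [e' t er|d1 d10 h1] := IH; first by apply: loc; rewrite inE er orbT.
have [||d2 d20 h2] := @uniform_scale01 R (fun d t => P d (segment_point e t)).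
- by move=> d d' t; exact: mono.
- move=> t t01; have [d d0 dP] := loc e t (mem_head _ _) t01.
  pose c := 1 + cabs (e.2 - e.1).
  have c1 : 1 <= c by rewrite lerDl cabs_ge0.
  have c0 : 0 < c by lra.
  exists (d / c); first by rewrite divr_gt0.
  move=> s s01 st; apply: (mono d); first by rewrite ler_pdivrMr//; nra.
  apply: dP; rewrite cabs_segment_pointB; move: st; rewrite ltr_pdivlMr// => st.
  by have := normr_ge0 (s - t); rewrite /c in st; lra.
exists (Num.min d1 d2); first by rewrite lt_min d10.
move=> e'; rewrite inE => /orP[/eqP->|e'r] t t01.
- by apply: (mono d2); [rewrite ge_min lexx orbT|exact: h2].
- by apply: (mono d1); [rewrite ge_min lexx|exact: h1].
Qed.

Lemma support_dist G w : ~ cycle_support G w ->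
  exists2 d : R, 0 < d & forall z, cycle_support G z -> d <= cabs (z - w).
Proof.
move=> nw; have [||d d0 dP] := @uniform_scale_support G (fun d z => d <= cabs (z - w)).
- by move=> d d' z; exact: le_trans.
- move=> z zG; have zw : 0 < cabs (z - w).
    by rewrite cabs_gt0// subr_eq0; apply/eqP => zw; apply: nw; rewrite -zw.
  exists (cabs (z - w) / 2); first by rewrite divr_gt0.
  move=> u uz; have := cabsD (z - u) (u - w); rewrite subrKA (cabsB z u); lra.
by exists d.
Qed.

Lemma support_bounded G : exists2 M : R, 0 < M & forall z, cycle_support G z -> cabs z <= M.
Proof.
have [||d d0 dP] := @uniform_scale_support G (fun d z => d * cabs z <= 1).
- by move=> d d' z dd; apply: le_trans; rewrite ler_wpM2r ?cabs_ge0.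
- move=> z _; have c0 := cabs_ge0 z; exists (1 / (cabs z + 1)).
    by rewrite divr_gt0// ltr_wpDl.
  move=> w wz; rewrite mulrAC ler_pdivrMr ?ltr_wpDl// !mul1r.
  have := cabsD (w - z) z; rewrite subrK.
  have : 1 / (cabs z + 1) <= 1 by rewrite ler_pdivrMr ?ltr_wpDl// mul1r lerDr.
  lra.
exists d^-1; first by rewrite invr_gt0.
by move=> z /dP; rewrite mulrC -ler_pdivlMr// mul1r.
Qed.

Definition cycle_length G : R := \sum_(e <- cycle_edges G) cabs (e.2 - e.1).

Lemma cycle_length_ge0 G : 0 <= cycle_length G.
Proof. by apply: sumr_ge0 => e _; exact: cabs_ge0. Qed.

Section ContourSum.
Variables (V : lmodType R[i]) (N : V -> R).
Hypothesis VN : vnorm N.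
Implicit Types g : R[i] -> V.

Lemma contour_sum_rsum G g n : contour_sum G g n =
  \sum_(e <- cycle_edges G) rsum (fun t => (e.2 - e.1) *: g (segment_point e t)) n.
Proof.
apply: eq_bigr => e _; apply: eq_bigr => k _.
by rewrite scalerA mulrC.
Qed.

Lemma eq_contour_sum G g g' n : (forall z, cycle_support G z -> g z = g' z) ->
  contour_sum G g n = contour_sum G g' n.
Proof.
move=> h; rewrite !contour_sum_rsum; apply: eq_big_seq => e eG.
by apply: eq_rsum => t t01; rewrite h//; exact: cycle_supportP.
Qed.

Lemma contour_sumB G g g' n :
  contour_sum G (fun z => g z - g' z) n = contour_sum G g n - contour_sum G g' n.
Proof.
rewrite /contour_sum -sumrB; apply: eq_bigr => e _.
by rewrite -sumrB; apply: eq_bigr => k _; rewrite scalerBr.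
Qed.

Lemma contour_sumD G g g' n :
  contour_sum G (fun z => g z + g' z) n = contour_sum G g n + contour_sum G g' n.
Proof.
rewrite /contour_sum -big_split; apply: eq_bigr => e _.
by rewrite -big_split; apply: eq_bigr => k _; rewrite scalerDr.
Qed.

Lemma contour_sumZ G c g n :
  contour_sum G (fun z => c *: g z) n = c *: contour_sum G g n.
Proof.
rewrite /contour_sum scaler_sumr; apply: eq_bigr => e _.
rewrite scaler_sumr; apply: eq_bigr => k _; by rewrite !scalerA mulrC.
Qed.

Lemma contour_sum_sum G (I : Type) (r : seq I) (g : I -> R[i] -> V) n :
  contour_sum G (fun z => \sum_(i <- r) g i z) n = \sum_(i <- r) contour_sum G (g i) n.
Proof.
elim: r => [|i r IH].
  rewrite big_nil /contour_sum big1// => e _; rewrite big1// => k _.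
  by rewrite big_nil scaler0.
rewrite big_cons -IH -contour_sumD; congr (contour_sum _ _ _).
by apply/funext => z; rewrite big_cons.
Qed.

Lemma vnorm_contour_sum G g n (C : R) : 0 <= C ->
  (forall z, cycle_support G z -> N (g z) <= C) ->
  N (contour_sum G g n) <= cycle_length G * C.
Proof.
move=> C0 h; rewrite contour_sum_rsum; apply: le_trans (vnorm_sum VN _ _ _) _.
rewrite /cycle_length mulr_suml big_seq [leRHS]big_seq; apply: ler_sum => e eG.
apply: (vnorm_rsum VN) => t t01; rewrite (vnormZ VN) ler_wpM2l ?cabs_ge0//.
by apply: h; exact: cycle_supportP.
Qed.

Lemma contour_sum_scalar G (k : R[i] -> R[i]) (x : V) n :
  contour_sum G (fun z => k z *: x) n = (contour_sum G (k : R[i] -> R[i]^o) n : R[i]) *: x.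
Proof.
rewrite /contour_sum scaler_suml; apply: eq_bigr => e _.
by rewrite scaler_suml; apply: eq_bigr => j _; rewrite scalerA.
Qed.

Lemma contour_sum_lip G g (C : R) n m : 0 <= C ->
  (forall z w, cycle_support G z -> cycle_support G w -> N (g z - g w) <= C * cabs (z - w)) ->
  N (contour_sum G g n - contour_sum G g m) <=
    (\sum_(e <- cycle_edges G) cabs (e.2 - e.1) ^+ 2) * C * (n.+1%:R^-1 + m.+1%:R^-1).
Proof.
move=> C0 h; rewrite !contour_sum_rsum -sumrB; apply: le_trans (vnorm_sum VN _ _ _) _.
rewrite !mulr_suml big_seq [leRHS]big_seq; apply: ler_sum => e eG.
have D0 : 0 <= cabs (e.2 - e.1) ^+ 2 * C by rewrite mulr_ge0 ?sqr_ge0.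
rewrite mulrDr; apply: (rsum_dist VN _ _ D0) => s t s01 t01.
rewrite -scalerBr (vnormZ VN).
apply: le_trans (_ : cabs (e.2 - e.1) * (C * cabs (segment_point e s - segment_point e t)) <= _).
  by rewrite ler_wpM2l ?cabs_ge0// h//; exact: cycle_supportP.
rewrite cabs_segment_pointB le_eqVlt; apply/orP; left; apply/eqP; ring.
Qed.

End ContourSum.

(** Parametrizing the segment reduces this to [rsum_derivative] for
    [t |-> F (segment_point (a, b) t)]. *)
Lemma segment_primitive (F g : R[i] -> R[i]) (a b : R[i]) :
  (forall t, 0 <= t <= 1 -> sdiffc F g (segment_point (a, b) t)) ->
  @ncvg R R[i]^o cabs (rsum (fun t => (b - a) *: (g (segment_point (a, b) t) : R[i]^o)))
    (F b - F a).
Proof.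
move=> H.
have -> : F b = F (segment_point (a, b) 1) by rewrite segment_point1.
have -> : F a = F (segment_point (a, b) 0) by rewrite segment_point0.
apply: (rsum_derivative (vnorm_cabs R) (u := fun t => F (segment_point (a, b) t))).
move=> t e t01 e0.
pose c := cabs (b - a) + 1; have c0 : 0 < c by rewrite ltr_wpDl// cabs_ge0.
have [d d0 dP] := H t t01 (e / c) (divr_gt0 e0 c0).
exists (d / c); first by rewrite divr_gt0.
move=> s s' s01 s'01; rewrite !ltr_pdivlMr// => st s't.
have close u : `|u - t| * c < d -> cabs (segment_point (a, b) u - segment_point (a, b) t) < d.
  by rewrite cabs_segment_pointB /c /= => h; have := normr_ge0 (u - t); lra.
have := dP _ _ (close _ st) (close _ s't).
rewrite segment_pointB /= => h.
have -> : (s' - s)%:C *: ((b - a) *: (g (segment_point (a, b) s) : R[i]^o)) =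
  (s' - s)%:C * (b - a) * g (segment_point (a, b) s) by rewrite scalerA.
apply: le_trans h _; rewrite cabsM cabs_real mulrAC ler_pdivrMr//.
have := normr_ge0 (s' - s) => n0; rewrite -!mulrA ler_wpM2l ?(ltW e0)//.
rewrite ler_wpM2l// /c; lra.
Qed.

(** Over the edges of closed polygons the increments of a primitive cancel. *)
Lemma contour_primitive G (F g : R[i] -> R[i]) :
  (forall z, cycle_support G z -> sdiffc F g z) ->
  @ncvg R R[i]^o cabs (contour_sum G (g : R[i] -> R[i]^o)) 0.
Proof.
move=> H; rewrite -(@big_cycle_edges R[i]^o G F).
have -> : contour_sum G (g : R[i] -> R[i]^o) = fun n =>
  \sum_(e <- cycle_edges G) (if e \in cycle_edges G then
     rsum (fun t => (e.2 - e.1) *: (g (segment_point e t) : R[i]^o)) n else 0).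
  by apply/funext => n; rewrite contour_sum_rsum; apply: eq_big_seq => e ->.
rewrite (@eq_big_seq R[i]^o 0 +%R _ _ _ (fun e => if e \in cycle_edges G then F e.2 - F e.1 else 0 : R[i]^o)).
  apply: (ncvg_sum (vnorm_cabs R)) => e; case: ifP => eG; last exact: (ncvg_cst (vnorm_cabs R)).
  case: e eG => a b eG; apply: segment_primitive => t t01.
  by apply: H; exact: cycle_supportP.
by move=> e ->.
Qed.

End Cycles.

(** * Winding numbers *)

Section Winding.
Variable R : realType.
Implicit Types (G : seq (seq R[i])) (z w c s : R[i]).

Local Notation CN := (vnorm_cabs R).

Lemma cvg_cabs_ncvg (u : nat -> R[i]^o) (l : R[i]^o) :
  u n @[n --> \oo] --> l <-> ncvg cabs u l.
Proof.
split => [/cvg_cabsP h e e0|h].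
- by apply: filterS (h e e0) => n /ltW.
- apply/cvg_cabsP => e e0; have e20 : 0 < e / 2 by rewrite divr_gt0.
  by apply: filterS (h _ e20) => n /le_lt_trans; apply; lra.
Qed.

Lemma two_pi_i_neq0 : two_pi_i R != 0.
Proof. by rewrite /two_pi_i eq_complex /= eqxx /= mulrn_eq0 /= gt_eqF ?pi_gt0. Qed.

(** Winding numbers, in the form that the estimates produce: a convergence of
    moduli, without the factor [1 / (2 pi i)] inside the sums. *)
Definition winding G w k : Prop := @ncvg R R[i]^o cabs
  (contour_sum G (fun z => (z - w)^-1 : R[i]^o)) (two_pi_i R * k).

Lemma winding_numberP G w k : is_winding_number G w k <-> winding G w k.
Proof.
have t0 := two_pi_i_neq0.
have E n : contour_sum G (fun z => (two_pi_i R * (z - w))^-1 : R[i]^o) n =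
    (two_pi_i R)^-1 *: (contour_sum G (fun z => (z - w)^-1 : R[i]^o) n : R[i]^o).
  by rewrite -contour_sumZ; congr contour_sum; apply/funext => z; rewrite invfM.
apply: iff_trans (cvg_cabs_ncvg _ _) _; rewrite (funext E); split => h.
- have := ncvgZ CN (two_pi_i R) h.
  by under eq_fun do rewrite scalerA divff// scale1r.
- have := ncvgZ CN (two_pi_i R)^-1 h.
  by rewrite /GRing.scale /= mulKf.
Qed.

(** On the support, [clog (u * (z - w))] is a primitive of [(z - w)^-1]. *)
Lemma winding_slit G w (u : R[i]) :
  (forall z, cycle_support G z -> slit (u * (z - w))) -> winding G w 0.
Proof.
move=> H; rewrite /winding mulr0.
apply: (@contour_primitive R G (fun z => clog (- (u * w) + z * u))) => z zG.
have u0 : u != 0.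
  by apply/eqP => u0; have := slit_neq0 (H z zG); rewrite u0 mul0r eqxx.
have E y : - (u * w) + y * u = u * (y - w) by ring.
have s : slit (- (u * w) + z * u) by rewrite E; exact: H.
have zw : z - w != 0 by have := slit_neq0 (H z zG); rewrite mulf_eq0 negb_or => /andP[].
have := @sdiffc_clog_comp R (fun y => - (u * w) + y * u) _ z s (sdiffc_affine (- (u * w)) u z).
have -> : (fun y => u / (- (u * w) + y * u)) = (fun y => (y - w)^-1); last by [].
by apply/funext => y; rewrite E invfM mulrA divff// mul1r.
Qed.

(** The logarithm of [(z - w) / (z - v)] is a primitive of the difference of the
    two integrands; written as [1 + (v - w) / (z - v)] it falls under
    [sdiffc_clog_comp]. *)
Lemma winding_ratio G w v k :
  (forall z, cycle_support G z -> z != v) ->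
  (forall z, cycle_support G z -> slit ((z - w) / (z - v))) ->
  winding G v k -> winding G w k.
Proof.
move=> zv H hv; have [->//|wv] := eqVneq w v.
have D : @ncvg R R[i]^o cabs
    (contour_sum G (fun z => (z - w)^-1 - (z - v)^-1 : R[i]^o)) 0.
  pose q z := 1 + (z - v)^-1 * (v - w).
  pose q' z := - (z - v) ^- 2 * (v - w).
  pose g z := if (z == v) || (z == w) then q' z / q z else (z - w)^-1 - (z - v)^-1.
  have gE : g = fun z => q' z / q z.
    apply/funext => z; rewrite /g; case: ifPn => //; rewrite negb_or => /andP[n1 n2].
    have m1 : z - v != 0 by rewrite subr_eq0.
    have m2 : z - w != 0 by rewrite subr_eq0.
    have -> : q z = (z - w) / (z - v) by rewrite /q; field.
    by rewrite /q'; field; rewrite m1 m2.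
  have -> : contour_sum G (fun z => (z - w)^-1 - (z - v)^-1 : R[i]^o) =
            contour_sum G (g : R[i] -> R[i]^o).
    apply/funext => n; apply: eq_contour_sum => z zG; rewrite /g.
    rewrite (negbTE (zv _ zG)) /=; case: eqP => // zw.
    by have := slit_neq0 (H z zG); rewrite zw subrr mul0r eqxx.
  rewrite gE; apply: (@contour_primitive R G (fun z => clog (q z))) => z zG.
  apply: sdiffc_clog_comp.
    have m1 : z - v != 0 by rewrite subr_eq0 zv.
    by have -> : q z = (z - w) / (z - v) by [rewrite /q; field]; exact: H.
  have hi := sdiffc_inv (zv _ zG); move=> e e0.
  have c0 : 0 < cabs (v - w) by rewrite cabs_gt0// subr_eq0 eq_sym.
  have [d d0 h] := hi (e / cabs (v - w)) (divr_gt0 e0 c0).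
  exists d => // x x' hx hx'; rewrite /q /q'.
  have -> : 1 + (x' - v)^-1 * (v - w) - (1 + (x - v)^-1 * (v - w)) -
     (x' - x) * (- (x - v) ^- 2 * (v - w)) =
    ((x' - v)^-1 - (x - v)^-1 - (x' - x) * - (x - v) ^- 2) * (v - w) by ring.
  by rewrite cabsM -ler_pdivlMr// mulrAC; exact: h.
have := ncvgD CN D hv; rewrite add0r; rewrite /winding.
have -> // : (fun n => contour_sum G (fun z => (z - w)^-1 - (z - v)^-1 : R[i]^o) n +
   contour_sum G (fun z => (z - v)^-1 : R[i]^o) n) = contour_sum G (fun z => (z - w)^-1 : R[i]^o).
apply/funext => n; rewrite -contour_sumD; congr contour_sum.
by apply/funext => z; rewrite subrK.
Qed.

(** For [w] close to [v] the ratio [(z - w) / (z - v)] is close to 1. *)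
Lemma winding_near G v k : ~ cycle_support G v -> winding G v k ->
  exists2 d : R, 0 < d & forall w, cabs (w - v) < d ->
    ~ cycle_support G w /\ winding G w k.
Proof.
move=> nv hv; have [d d0 dP] := support_dist nv.
exists d => // w wv; split.
  by move=> /dP /(lt_le_trans wv); rewrite ltxx.
have zv z : cycle_support G z -> 0 < cabs (z - v) by move/dP; exact: lt_le_trans.
apply: winding_ratio hv => z zG; first by have := cabs_neq0 (zv z zG); rewrite subr_eq0.
have z0 := cabs_neq0 (zv z zG).
have -> : (z - w) / (z - v) = 1 - (w - v) / (z - v) by field.
apply: Re_slit; have : cabs ((w - v) / (z - v)) < 1.
  by rewrite cabsM cabsV ltr_pdivrMr ?zv// mul1r; apply: lt_le_trans wv _; exact: dP.
have := cabs_ge_Re ((w - v) / (z - v)); set q := _ / _.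
rewrite ler_norml => /andP[_]; case: (q) => a b /=; lra.
Qed.

(** Squares are given by their center and a half diagonal [s], so that the edges
    are the images of the segment from 1 to ['i] under multiplication by [s],
    ['i * s], [- s] and [- 'i * s]. *)
Definition box c s : seq (seq R[i]) :=
  [:: [:: c + s; c + 'i * s; c - s; c - 'i * s]].

Lemma box_edges c s : cycle_edges (box c s) =
  [:: (c + s, c + 'i * s); (c + 'i * s, c - s); (c - s, c - 'i * s); (c - 'i * s, c + s)].
Proof. by []. Qed.

(** The support is the image of the unit sphere of the l1 norm. *)
Lemma box_support c s z : cycle_support (box c s) z ->
  exists x y : R, `|x| + `|y| = 1 /\ z = c + s * (x +i* y).
Proof.
have E (x y : R) : x +i* y = x%:C + 'i * y%:C by rewrite [LHS]complexE.
move=> [e]; rewrite box_edges !inE => eE [t /andP[t0 t1] ->].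
have nt : `|t| = t by rewrite ger0_norm.
have nt' : `|1 - t| = 1 - t by rewrite ger0_norm// subr_ge0.
have nt'' : `|t - 1| = 1 - t by rewrite distrC.
have r1 : (1 - t)%:C = 1 - t%:C :> R[i] by rewrite rmorphB.
have r2 : (t - 1)%:C = t%:C - 1 :> R[i] by rewrite rmorphB.
have r3 : (- t)%:C = - t%:C :> R[i] by rewrite rmorphN.
have i2 : ('i : R[i]) * 'i = -1 by rewrite -expr2 sqr_i.
case/or4P: eE => /eqP ->; rewrite /segment_point /=.
- by exists (1 - t), t; rewrite nt nt' subrK; split => //; rewrite E r1; ring.
- exists (- t), (1 - t); rewrite normrN nt nt' addrC subrK; split => //; rewrite E r1 r3; ring.
- exists (t - 1), (- t); rewrite normrN nt nt'' subrK; split => //; rewrite E r2 r3; ring.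
- exists t, (t - 1); rewrite nt nt'' addrC subrK; split => //; rewrite E r2; ring.
Qed.

(** Each edge contributes the integral of the inverse from 1 to ['i], that is
    [clog 'i - clog 1], a quarter of [2 pi i]. *)
Lemma box_center c s : s != 0 -> winding (box c s) c 1.
Proof.
move=> s0; rewrite /winding mulr1.
pose g (t : R) : R[i]^o := ('i - 1) *: ((segment_point (1, 'i) t)^-1 : R[i]^o).
have hg : @ncvg R R[i]^o cabs (rsum g) (clog 'i - clog 1).
  apply: (@segment_primitive R (@clog R) (fun w => w^-1)) => t t01.
  apply: sdiffc_clog; have si : slit ('i : R[i]).
    by apply/slitP => -[/eqP]; rewrite /= oner_eq0.
  exact: (slit_star si t01).
have i2 : ('i : R[i]) * 'i = -1 by rewrite -expr2 sqr_i.
have sE (e : R[i] * R[i]) (m : R[i]) n : m != 0 -> e.1 - c = m -> e.2 - e.1 = m * ('i - 1) ->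
  rsum (fun t => (e.2 - e.1) *: ((segment_point e t - c)^-1 : R[i]^o)) n = rsum g n.
  move=> m0 h1 h2; apply: eq_rsum => t _; rewrite /g /GRing.scale /= h2.
  have -> : segment_point e t - c = m * segment_point (1, 'i) t.
    have -> : segment_point (1, 'i) t = 1 + t%:C * ('i - 1) by [].
    by rewrite /segment_point h2 -h1; ring.
  by rewrite invfM mulrACA divff// mul1r.
have i0 : 'i != 0 :> R[i] by apply: cabs_neq0; rewrite cabs_i.
have : @ncvg R R[i]^o cabs (fun n => 4 *: rsum g n) (4 *: ((clog 'i - clog 1) : R[i]^o)).
  exact: (ncvgZ CN).
have -> : 4 *: ((clog 'i - clog 1) : R[i]^o) = two_pi_i R.
  rewrite clog_i clog1 subr0 /two_pi_i /GRing.scale /=.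
  by apply/eqP; rewrite eq_complex /=; apply/andP; split; apply/eqP; field.
have -> // : (fun n => 4 *: rsum g n) = contour_sum (box c s) (fun z => (z - c)^-1 : R[i]^o).
have isi : 'i * s * 'i = - s by rewrite mulrAC i2 mulN1r.
apply/funext => n; rewrite contour_sum_rsum box_edges !big_cons big_nil.
rewrite (sE _ s)//=; [|by ring|by ring].
rewrite (sE _ ('i * s))//=; [|by rewrite mulf_neq0|by ring|by rewrite mulrBr isi; ring].
rewrite (sE _ (- s))//=; [|by rewrite oppr_eq0|by ring|by ring].
rewrite (sE _ (- ('i * s)))//=; [|by rewrite oppr_eq0 mulf_neq0|by ring|by rewrite mulNr mulrBr isi; ring].
by rewrite scaler_nat !mulrS mulr0n.
Qed.

(** The segment from the center to an interior point does not meet the support,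
    so both points have the same winding number. *)
Lemma box_winding_in c s (x y : R) : s != 0 -> `|x| + `|y| < 1 ->
  winding (box c s) (c + s * (x +i* y)) 1.
Proof.
move=> s0 xy.
have zc z : cycle_support (box c s) z -> z != c.
  move=> /box_support[a [b [ab ->]]].
  rewrite -subr_eq0 addrC addKr mulf_neq0//; apply/eqP => -[a0 b0].
  by move: ab; rewrite a0 b0 normr0 addr0 => /esym/eqP; rewrite oner_eq0.
apply: winding_ratio (box_center c s0) => // z zG; apply: slit_ratio; first exact: zc.
move=> t t0; have [a [b [ab ->]]] := box_support zG.
apply/eqP; rewrite real_complexD => E.
have {E} : s * ((1 + t%:C) * (a +i* b)) = s * (x +i* y).
  apply: (@addrI _ ((1 + t%:C) * c)).
  transitivity ((1 + t%:C) * (c + s * (a +i* b))); first by ring.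
  by rewrite E; ring.
rewrite -real_complexD.
move/(mulfI s0) => /eqP; rewrite eq_complex /= => /andP[/eqP E1 /eqP E2].
have {}E1 : (1 + t) * a = x by rewrite -E1; ring.
have {}E2 : (1 + t) * b = y by rewrite -E2; ring.
move: xy; rewrite -E1 -E2 !normrM -mulrDr ab mulr1 ger0_norm ?addr_ge0//.
by apply/negP; rewrite -leNgt; lra.
Qed.

End Winding.

(** * Cauchy's theorem on squares, by a discrete Stokes formula *)

Section Stokes.
Variables (R : realType) (V : lmodType R[i]) (N : V -> R).
Hypothesis VN : vnorm N.
Implicit Types (F : R[i] -> V) (a b h p : R[i]).

Let seg F a b n : V := rsum (fun t => (b - a) *: F (segment_point (a, b) t)) n.

Lemma segE F a b n : seg F a b n =
  ((b - a) / n.+1%:R) *: \sum_(k < n.+1) F (a + k%:R * ((b - a) / n.+1%:R)).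
Proof.
rewrite /seg /rsum scaler_sumr; apply: eq_bigr => k _.
rewrite scalerA mulrC; congr (_ *: F _); rewrite /segment_point /=.
by rewrite rmorphM rmorph_nat fmorphV rmorph_nat -mulrA [_^-1 * _]mulrC.
Qed.

(** Riemann sums evaluate at the left end of each step; reversing the segment
    changes that end, whence the correction term. *)
Lemma seg_reverse F a b n :
  seg F b a n = - seg F a b n + ((b - a) / n.+1%:R) *: (F a - F b).
Proof.
have n0 : n.+1%:R != 0 :> R[i] by rewrite pnatr_eq0.
rewrite !segE -(opprB b a) mulNr; set h := (b - a) / _.
have bE : b = a + n.+1%:R * h by rewrite /h mulrCA divff// mulr1 addrC subrK.
pose f k := F (a + k%:R * h).
rewrite scaleNr -[- (h *: \sum_(_ < _) F (a + _))]scalerN -scalerDr -scalerN.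
congr (_ *: _).
rewrite (reindex_inj rev_ord_inj) /=.
have -> : \sum_(k < n.+1) F (b + (n.+1 - k.+1)%:R * - h) = \sum_(k < n.+1) f k.+1.
  apply: eq_bigr => k _; rewrite /f bE; congr F.
  by rewrite natrB//; ring.
have -> : F b = f n.+1 by rewrite bE.
have -> : F a = f 0%N by rewrite /f mul0r addr0.
have tel : f n.+1 - f 0%N = \sum_(k < n.+1) f k.+1 - \sum_(k < n.+1) f k.
  by rewrite -(telescope_sumr f (leq0n _)) big_mkord big_split /= sumrN.
by rewrite -(opprB (f n.+1)) tel opprB addKr.
Qed.

(** The defect of the Cauchy-Riemann equation of [F] at [w], at scale [h]. *)
Definition cr_defect F w h : V := F (w + 'i * h) - F w - 'i *: (F (w + h) - F w).

Lemma sum_telescope (f : nat -> V) n : \sum_(k < n) (f k.+1 - f k) = f n - f 0%N.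
Proof. by rewrite -(telescope_sumr f (leq0n _)) big_mkord. Qed.

(** The cells of a square grid share their inner edges, so the Riemann sum
    along the boundary of a square is the sum of the cell contributions, up to
    the choice of the end of each edge. *)
Lemma box_grid_sum F c s n :
  contour_sum (box c s) F n =
  let h := ('i - 1) * s / n.+1%:R in
  - (\sum_(j < n.+1) \sum_(k < n.+1)
      h *: cr_defect F (c + s + j%:R * h + k%:R * ('i * h)) h)
  + h *: (F (c - 'i * s) - F (c - s) + 'i *: (F (c + s) - F (c - 'i * s))).
Proof.
move=> /=; set h := ('i - 1) * s / n.+1%:R.
have i2 : ('i : R[i]) * 'i = -1 by rewrite -expr2 sqr_i.
have n0 : n.+1%:R != 0 :> R[i] by rewrite pnatr_eq0.
have isi : 'i * ('i * s) = - s by rewrite mulrA i2 mulN1r.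
have nh : n.+1%:R * h = 'i * s - s by rewrite /h mulrCA divff// mulr1; ring.
have nih : n.+1%:R * ('i * h) = - s - 'i * s by rewrite mulrCA nh mulrBr isi.
pose f j k := F (c + s + j%:R * h + k%:R * ('i * h)).
have hE a b : b - a = 'i * s - s -> (b - a) / n.+1%:R = h.
  by move=> ->; rewrite -nh mulrAC divff// mul1r.
have ihE a b : b - a = - s - 'i * s -> (b - a) / n.+1%:R = 'i * h.
  by move=> ->; rewrite -nih mulrAC divff// mul1r.
rewrite contour_sum_rsum box_edges !big_cons big_nil addr0 /=.
rewrite -!/(seg _ _ _ _) (seg_reverse F (c - 'i * s) (c - s)).
rewrite (seg_reverse F (c + s) (c - 'i * s)) !segE.
rewrite (hE (c + s) (c + 'i * s)); last by ring.
rewrite (ihE (c + 'i * s) (c - s)); last by ring.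
rewrite (hE (c - 'i * s) (c - s)); last by ring.
rewrite (ihE (c + s) (c - 'i * s)); last by ring.
have -> : \sum_(k < n.+1) F (c + s + k%:R * h) = \sum_(k < n.+1) f k 0%N.
  by apply: eq_bigr => k _; rewrite /f mul0r addr0.
have -> : \sum_(k < n.+1) F (c + 'i * s + k%:R * ('i * h)) = \sum_(k < n.+1) f n.+1 k.
  by apply: eq_bigr => k _; rewrite /f nh; congr F; ring.
have -> : \sum_(k < n.+1) F (c - 'i * s + k%:R * h) = \sum_(k < n.+1) f k n.+1.
  by apply: eq_bigr => k _; rewrite /f nih; congr F; ring.
have -> : \sum_(k < n.+1) F (c + s + k%:R * ('i * h)) = \sum_(k < n.+1) f 0%N k.
  by apply: eq_bigr => k _; rewrite /f mul0r addr0.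
have -> : \sum_(j < n.+1) \sum_(k < n.+1)
    h *: cr_defect F (c + s + j%:R * h + k%:R * ('i * h)) h =
    h *: (\sum_(j < n.+1) f j n.+1 - \sum_(j < n.+1) f j 0%N) -
    ('i * h) *: (\sum_(k < n.+1) f n.+1 k - \sum_(k < n.+1) f 0%N k).
  transitivity (\sum_(j < n.+1) \sum_(k < n.+1)
     (h *: (f j k.+1 - f j k) - ('i * h) *: (f j.+1 k - f j k))).
    apply: eq_bigr => j _; apply: eq_bigr => k _; rewrite /cr_defect /f.
    rewrite scalerBr scalerA (mulrC h); congr (_ *: (F _ - _) - _ *: (F _ - _)).
      by rewrite -natr1; ring.
    by rewrite -natr1; ring.
  under eq_bigr do rewrite sumrB -!scaler_sumr sum_telescope.
  rewrite sumrB -!scaler_sumr sumrB; congr (_ - _ *: _).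
  rewrite exchange_big /=; under eq_bigr do rewrite (sum_telescope (fun j => f j _)).
  by rewrite sumrB.
set S1 := \sum_(k < n.+1) f k 0%N; set S2 := \sum_(k < n.+1) f n.+1 k.
set S3 := \sum_(k < n.+1) f k n.+1; set S4 := \sum_(k < n.+1) f 0%N k.
have zmod (x1 x2 x3 x4 y z : V) : x1 + (x2 + (- x3 + y + (- x4 + z))) =
    - (x3 - x1 - (x2 - x4)) + (y + z).
  rewrite (addrACA (- x3)) !opprB (addrACA x2) -(opprD x4) (addrC x4) opprD !addrA.
  by rewrite (addrC x1).
have hD (x y : V) : h *: (x + 'i *: y) = h *: x + ('i * h) *: y.
  by rewrite scalerDr scalerA (mulrC h).
by rewrite hD (scalerBr _ S3) (scalerBr _ S2) -zmod.
Qed.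

(** Cauchy's theorem on a square, without derivatives: if the defect is
    [O(h ^ 2)], each of the [n ^ 2] cells contributes [O(n ^ -3)]. *)
Lemma box_stokes F c s :
  (forall w, exists2 d : R, 0 < d & exists2 C : R, 0 < C &
     forall w' h, cabs (w' - w) < d -> cabs h < d ->
     N (cr_defect F w' h) <= C * cabs h ^+ 2) ->
  ncvg N (contour_sum (box c s) F) 0.
Proof.
move=> loc; set l := ('i - 1) * s.
pose pt (t u : R) := c + s + t%:C * l + u%:C * ('i * l).
have [||d d0 dP] := @uniform_scale01_2 R (fun d t u => forall h, cabs h < d ->
    d * N (cr_defect F (pt t u) h) <= cabs h ^+ 2).
- move=> d d' t u dd H h hd; apply: le_trans (H h (lt_le_trans hd dd)).
  by rewrite ler_wpM2r// vnorm_ge0.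
- move=> t u _ _; have [d d0 [C C0 H]] := loc (pt t u).
  pose L := 2 * cabs l + 1; have L0 : 0 < L by rewrite ltr_wpDl// mulr_ge0// cabs_ge0.
  pose d' := Num.min (d / L) (Num.min d C^-1).
  have d'0 : 0 < d' by rewrite !lt_min d0 invr_gt0 C0 divr_gt0.
  exists d' => // t' u' _ _; rewrite !lt_min => /and3P[h1 _ _] /and3P[h2 _ _] h.
  rewrite !lt_min => /and3P[_ h3 _].
  have close : cabs (pt t' u' - pt t u) < d.
    have -> : pt t' u' - pt t u = (t' - t)%:C * l + (u' - u)%:C * ('i * l).
      by rewrite /pt !rmorphB; ring.
    apply: le_lt_trans (cabsD _ _) _.
    rewrite (cabsM _ l) (cabsM _ ('i * l)) (cabsM 'i l) cabs_i mul1r !cabs_real.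
    move: h1 h2; rewrite !ltr_pdivlMr// /L.
    have := normr_ge0 (t' - t); have := normr_ge0 (u' - u); have := cabs_ge0 l.
    lra.
  have := H _ h close h3 => b; have b' : d' <= C^-1 by rewrite !ge_min lexx !orbT.
  apply: le_trans (_ : C^-1 * N (cr_defect F (pt t' u') h) <= _).
    by rewrite ler_wpM2r// vnorm_ge0.
  by rewrite mulrC ler_pdivrMr// mulrC.
pose M := N (F (c - 'i * s) - F (c - s) + 'i *: (F (c + s) - F (c - 'i * s))).
apply: (ncvg_near_le (b := fun n => (cabs l ^+ 3 / d + cabs l * M) / n.+1%:R)).
  by move=> e e0; exact: inv_nat_small.
have hl : \forall n \near \oo, cabs l / n.+1%:R <= d / 2.
  by apply: inv_nat_small; rewrite divr_gt0.
near=> n.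
have hn : cabs l / n.+1%:R < d.
  by apply: le_lt_trans (_ : d / 2 < d); [near: n|lra].
rewrite subr0 box_grid_sum -/l /=; set h := l / n.+1%:R.
have ch : cabs h = cabs l / n.+1%:R by rewrite /h cabsM cabs_invn.
rewrite mulrDl; apply: le_trans (vnormD VN _ _) _; apply: lerD; last first.
  by rewrite (vnormZ VN) ch mulrAC.
rewrite (vnormN VN); apply: le_trans (vnorm_sum VN _ _ _) _.
apply: le_trans (_ : \sum_(j < n.+1) \sum_(k < n.+1) cabs h ^+ 3 / d <= _); last first.
  rewrite !sumr_const !card_ord -[X in X <= _]mulr_natr -[X in X * _ <= _]mulr_natr ch.
  rewrite le_eqVlt; apply/orP; left; apply/eqP; field.
  by rewrite nat1r pnatr_eq0 /= gt_eqF.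
apply: ler_sum => j _; apply: le_trans (vnorm_sum VN _ _ _) _; apply: ler_sum => k _.
rewrite (vnormZ VN) exprS -mulrA ler_wpM2l ?cabs_ge0//.
have -> : c + s + j%:R * h + k%:R * ('i * h) = pt (j%:R / n.+1%:R) (k%:R / n.+1%:R).
  rewrite /pt !rmorphM !rmorph_nat !fmorphV !rmorph_nat /h.
  by move: (n.+1%:R^-1 : R[i]) => x; ring.
rewrite ler_pdivlMr// mulrC; apply: dP; rewrite ?ord_grid01//.
by rewrite ch.
Unshelve. all: by end_near. Qed.

End Stokes.

(** * Inverses and resolvents in Banach algebras *)

(** The norm of the unit may differ from 1: the sum of the norms of the entries
    is [m] on the unit matrix of size [m]. *)
Record banach_norm (R : realType) (B : algType R[i]) (N : B -> R) : Prop := BanachNorm {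
  banach_vnorm : vnorm N;
  banach_normM : forall x y, N (x * y) <= N x * N y;
  banach_complete : forall u : nat -> B,
    (forall e, 0 < e -> exists n0, forall n m, (n0 <= n)%N -> (n0 <= m)%N ->
       N (u n - u m) <= e) ->
    exists l, ncvg N u l }.

Definition invertible (B : nzRingType) (x : B) : Prop := exists y, is_inverse x y.
Definition binv (B : nzRingType) (x : B) : B := xget 0 [set y | is_inverse x y].

Section Inverses.
Variable B : nzRingType.
Implicit Types x y c : B.

Lemma is_inverse_unique x y y' : is_inverse x y -> is_inverse x y' -> y = y'.
Proof. by move=> [_ h] [h' _]; rewrite -[y]mulr1 -h' mulrA h mul1r. Qed.

Lemma binvP x : invertible x -> is_inverse x (binv x).
Proof. by move=> h; apply: (xgetPex 0 h). Qed.

Lemma mulrbV x : invertible x -> x * binv x = 1.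
Proof. by move/binvP => []. Qed.

Lemma mulVbr x : invertible x -> binv x * x = 1.
Proof. by move/binvP => []. Qed.

Lemma binv_eq x y : is_inverse x y -> binv x = y.
Proof. by move=> h; apply: (is_inverse_unique (binvP _) h); exists y. Qed.

Lemma is_inverse_sym x y : is_inverse x y -> is_inverse y x.
Proof. by case. Qed.

Lemma is_inverseM x x' y y' : is_inverse x x' -> is_inverse y y' ->
  is_inverse (x * y) (y' * x').
Proof.
move=> [h1 h2] [h3 h4]; split.
  by rewrite mulrA -(mulrA x) h3 mulr1.
by rewrite mulrA -(mulrA y') h2 mulr1.
Qed.

Lemma invertibleM x y : invertible x -> invertible y -> invertible (x * y).
Proof. by move=> [x' h] [y' h']; exists (y' * x'); exact: is_inverseM. Qed.

Lemma invertible_binv x : invertible x -> invertible (binv x).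
Proof. by move=> /binvP h; exists x; exact: is_inverse_sym. Qed.

Lemma binv_comm c x : invertible x -> c * x = x * c -> c * binv x = binv x * c.
Proof.
move=> h cx; rewrite -[LHS]mul1r -(mulVbr h) -!mulrA; congr (_ * _).
by rewrite !mulrA -cx -mulrA mulrbV// mulr1.
Qed.

End Inverses.

Section BanachAlgebra.
Variables (R : realType) (B : algType R[i]) (N : B -> R).
Hypothesis BN : banach_norm N.
Implicit Types (x y a b : B) (z w : R[i]).

Let VN : vnorm N := banach_vnorm BN.
Let NM := banach_normM BN.
Let N0 x : 0 <= N x := vnorm_ge0 VN x.

Lemma complete_rate (u : nat -> B) (b : nat -> R) :
  (forall n m, N (u n - u m) <= b n + b m) ->
  (forall e, 0 < e -> \forall n \near \oo, b n <= e) -> exists l, ncvg N u l.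
Proof.
move=> h b0; apply: (banach_complete BN) => e e0.
have e20 : 0 < e / 2 by rewrite divr_gt0.
have [n0 _ H] := b0 _ e20; exists n0 => n m hn hm.
by apply: le_trans (h n m) _; rewrite (splitr e) lerD// H.
Qed.

Lemma ncvgMl x (u : nat -> B) l : ncvg N u l -> ncvg N (fun n => x * u n) (x * l).
Proof.
move=> h e e0; have d0 : 0 < e / (N x + 1) by rewrite divr_gt0// ltr_wpDl.
near=> n; rewrite -mulrBr; apply: le_trans (NM _ _) _.
have : N (u n - l) <= e / (N x + 1) by near: n; exact: h.
rewrite ler_pdivlMr ?ltr_wpDl// => i; have := N0 x; have := N0 (u n - l); nra.
Unshelve. all: by end_near. Qed.

Lemma ncvgMr x (u : nat -> B) l : ncvg N u l -> ncvg N (fun n => u n * x) (l * x).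
Proof.
move=> h e e0; have d0 : 0 < e / (N x + 1) by rewrite divr_gt0// ltr_wpDl.
near=> n; rewrite -mulrBl; apply: le_trans (NM _ _) _.
have : N (u n - l) <= e / (N x + 1) by near: n; exact: h.
rewrite ler_pdivlMr ?ltr_wpDl// => i; have := N0 x; have := N0 (u n - l); nra.
Unshelve. all: by end_near. Qed.

Lemma ncvg_commute c (u : nat -> B) l : (forall n, c * u n = u n * c) ->
  ncvg N u l -> c * l = l * c.
Proof.
move=> h ul; apply: (ncvg_unique VN (ncvgMl c ul)).
by rewrite (funext h); exact: ncvgMr.
Qed.

Lemma ncvg_scalar (u : nat -> R[i]^o) (k : R[i]) x :
  @ncvg R R[i]^o cabs u k -> ncvg N (fun n => (u n : R[i]) *: x) (k *: x).
Proof.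
move=> h e e0; have d0 : 0 < e / (N x + 1) by rewrite divr_gt0// ltr_wpDl.
near=> n; rewrite -scalerBl (vnormZ VN).
have : cabs (u n - k : R[i]) <= e / (N x + 1) by near: n; exact: h.
rewrite ler_pdivlMr ?ltr_wpDl// => i.
have := N0 x; have := cabs_ge0 (u n - k : R[i]); lra.
Unshelve. all: by end_near. Qed.

(** As [x - d = x * (1 - y * d)] and [y * d] has norm at most [1 / 2], the
    Neumann series of [y * d] converges, and its sum is bounded by twice its
    first term. *)
Lemma inverse_near x y d : is_inverse x y -> N y * N d <= 1 / 2 ->
  exists y', is_inverse (x - d) y' /\ N y' <= 2 * N y.
Proof.
move=> [xy yx] hd; have [q qE] : exists q, q = y * d by exists (y * d).
have hq : N q <= 2^-1 by rewrite qE; apply: le_trans (NM _ _) _; rewrite -[2^-1]mul1r.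
have hqk k : N (q ^+ k * y) <= 2^-1 ^+ k * N y.
  elim: k => [|k IH]; first by rewrite !expr0 !mul1r.
  rewrite !exprS -!mulrA; apply: le_trans (NM q _) _.
  exact: ler_pM.
pose S n := \sum_(k < n) q ^+ k * y.
pose b n : R := 2 * N y * 2^-1 ^+ n.
have step n m : (n <= m)%N -> N (S m - S n) <= b n - b m.
  move=> /subnK <-; elim: (m - n)%N => [|j IH].
    by rewrite add0n !subrr (vnorm0 VN).
  rewrite addSn /S big_ord_recr /= addrAC; apply: le_trans (vnormD VN _ _) _.
  have := hqk (j + n)%N; move: IH; rewrite /S /b exprS; lra.
have b_ge0 n : 0 <= b n by rewrite !mulr_ge0// exprn_ge0// invr_ge0.
have bsmall e : 0 < e -> \forall n \near \oo, b n <= e.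
  move=> e0; have : \forall n \near \oo, (2 * N y) / n.+1%:R <= e by exact: inv_nat_small.
  apply: filterS => n; apply: le_trans; rewrite /b ler_wpM2l ?mulr_ge0//.
  by rewrite exprVn lef_pV2 ?posrE ?exprn_gt0// -natrX ler_nat ltn_expl.
have [l Sl] : exists l, ncvg N S l.
  apply: (complete_rate (b := b)) => // n m; have [nm|/ltnW nm] := leqP n m.
    by rewrite (vnorm_distC VN); apply: le_trans (step _ _ nm) _; have := b_ge0 m; lra.
  by apply: le_trans (step _ _ nm) _; have := b_ge0 n; lra.
have NS n : N (S n) <= 2 * N y.
  have := step 0%N n (leq0n n); rewrite /S big_ord0 subr0 {1}/b expr0.
  have := b_ge0 n; lra.
exists l; split; last first.
  by apply: (ncvg_norm_le VN Sl); apply: nearW => n.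
have qn n : N (q ^+ n) <= N 1 * 2^-1 ^+ n.
  elim: n => [|n IH]; first by rewrite !expr0 mulr1.
  by rewrite !exprSr mulrA; apply: le_trans (NM _ q) _; apply: ler_pM.
have q0 : ncvg N (fun n => 1 - q ^+ n) 1.
  apply: (ncvg_near_le (b := fun n => N 1 * 2^-1 ^+ n)); last first.
    by apply: nearW => n; rewrite addrAC subrr add0r (vnormN VN).
  move=> e e0; have : \forall n \near \oo, N 1 / n.+1%:R <= e by exact: inv_nat_small.
  apply: filterS => n; apply: le_trans; rewrite ler_wpM2l//.
  by rewrite exprVn lef_pV2 ?posrE ?exprn_gt0// -natrX ler_nat ltn_expl.
have geom n : (\sum_(k < n) q ^+ k) * (1 - q) = 1 - q ^+ n.
  elim: n => [|n IH]; first by rewrite big_ord0 mul0r expr0 subrr.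
  by rewrite big_ord_recr /= mulrDl IH mulrBr mulr1 -exprSr addrA subrK.
have geom' n : (1 - q) * (\sum_(k < n) q ^+ k) = 1 - q ^+ n.
  elim: n => [|n IH]; first by rewrite big_ord0 mulr0 expr0 subrr.
  by rewrite big_ord_recr /= mulrDr IH mulrBl mul1r -exprS addrA subrK.
have xd : x - d = x * (1 - q) by rewrite mulrBr mulr1 qE mulrA xy mul1r.
have SE n : S n = (\sum_(k < n) q ^+ k) * y by rewrite mulr_suml.
split; apply: (ncvg_unique VN).
- exact: (ncvgMl (x - d) Sl).
- have -> : (fun n => (x - d) * S n) = (fun n => x * (1 - q ^+ n) * y).
    by apply/funext => n; rewrite xd SE -geom' !mulrA.
  by have := ncvgMr y (ncvgMl x q0); rewrite mulr1 xy.
- exact: (ncvgMr (x - d) Sl).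
- have -> // : (fun n => S n * (x - d)) = (fun n => 1 - q ^+ n).
  apply/funext => n; rewrite SE xd -geom -!mulrA; congr (_ * _).
  by rewrite mulrA yx mul1r.
Qed.

Lemma norm1_gt0 : 0 < N 1.
Proof.
rewrite lt_def N0 andbT; apply/eqP => /(vnorm_eq0 VN)/eqP.
by rewrite oner_eq0.
Qed.

Section Resolvent.
Variable a : B.
Local Notation res := (resolvent a).
Local Notation rho z := (invertible (z%:A - a)).

Lemma spectrumN z : ~ spectrum a z -> rho z.
Proof. by move/contrapT. Qed.

Lemma res_near z : rho z -> exists2 d : R, 0 < d & exists2 C : R, 0 < C &
  forall w, cabs (w - z) < d -> rho w /\ N (res w) <= C.
Proof.
move=> hz; have iz := binvP hz; set y := binv _ in iz.
have c0 : 0 < 2 * (N y * N 1 + 1) by rewrite mulr_gt0// ltr_wpDl// mulr_ge0.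
exists (2 * (N y * N 1 + 1))^-1; first by rewrite invr_gt0.
exists (2 * N y + 1); first by rewrite ltr_wpDl// mulr_ge0.
move=> w wz; have [|y' [iy' ny']] := inverse_near (d := (z - w)%:A) iz.
  rewrite (vnormZ VN) cabsB; move: wz; rewrite -[X in _ < X]mul1r ltr_pdivlMr//.
  have := cabs_ge0 (w - z); have := N0 y; have := N0 1; lra.
have E : z%:A - a - (z - w)%:A = w%:A - a.
  by rewrite scalerBl opprB addrC addrA subrK.
rewrite E in iy'; split; first by exists y'.
by rewrite /resolvent -/(binv _) (binv_eq iy'); lra.
Qed.

(** [z - a] is a perturbation of [z], whose inverse is small. *)
Lemma res_far z : 2 * N a * N 1 <= cabs z -> z != 0 ->
  rho z /\ N (res z) <= 2 * N 1 / cabs z.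
Proof.
move=> hz z0; have c0 := cabs_gt0 z0.
have iz : is_inverse (z%:A : B) (z^-1)%:A.
  by split; rewrite -scalerAl mul1r scalerA ?mulVf ?divff// scale1r.
have Nz : N ((z^-1)%:A) = N 1 / cabs z by rewrite (vnormZ VN) cabsV mulrC.
have [|y [iy ny]] := inverse_near (d := a) iz.
  by rewrite Nz mulrAC ler_pdivrMr//; lra.
split; first by exists y.
by rewrite /resolvent -/(binv _) (binv_eq iy) -mulrA -Nz.
Qed.

Lemma spectrum_bounded z : spectrum a z -> cabs z <= 2 * N a * N 1.
Proof.
move=> sz; rewrite leNgt; apply/negP => h; apply: sz.
have [] // := @res_far z (ltW h); apply: cabs_neq0; apply: le_lt_trans h.
by rewrite !mulr_ge0.
Qed.

Lemma res_mulr z : rho z -> (z%:A - a) * res z = 1.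
Proof. exact: mulrbV. Qed.

Lemma res_mull z : rho z -> res z * (z%:A - a) = 1.
Proof. exact: mulVbr. Qed.

Lemma res_comm c z : rho z -> c * a = a * c -> c * res z = res z * c.
Proof.
move=> hz ca; apply: binv_comm => //.
by rewrite mulrBr mulrBl ca -scalerAl -scalerAr mul1r mulr1.
Qed.

Lemma res_identity z w : rho z -> rho w ->
  res z - res w = (w - z) *: (res z * res w).
Proof.
move=> hz hw.
have -> : (w - z) *: (res z * res w) = res z * ((w%:A - a) - (z%:A - a)) * res w.
  rewrite opprB addrA subrK -scalerBl -scalerAr -scalerAl.
  by rewrite mulr1 scalerAl.
by rewrite mulrBr mulrBl -[res z * _ * res w]mulrA res_mulr// mulr1 res_mull// mul1r.
Qed.

Lemma res_bounded G : (forall z, cycle_support G z -> ~ spectrum a z) ->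
  exists2 M : R, 0 < M & forall z, cycle_support G z -> N (res z) <= M.
Proof.
move=> H; have [||d d0 dP] := @uniform_scale_support R G (fun d z => d * N (res z) <= 1).
- by move=> d d' z dd; apply: le_trans; rewrite ler_wpM2r.
- move=> z /H/spectrumN/res_near[d d0 [C C0 dP]].
  exists (Num.min d C^-1); first by rewrite lt_min d0 invr_gt0.
  move=> w; rewrite lt_min => /andP[/dP[_ h] _].
  apply: le_trans (_ : C^-1 * N (res w) <= _).
    by rewrite ler_wpM2r// ge_min lexx orbT.
  by rewrite mulrC ler_pdivrMr// mul1r.
exists d^-1; first by rewrite invr_gt0.
by move=> z /dP; rewrite mulrC -ler_pdivlMr// mul1r.
Qed.

End Resolvent.

(** The class of integrands for which convergence of the Riemann sums is
    established; it is closed under products and contains the resolvent and the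
    Cauchy kernels. *)
Definition lip_on (G : seq (seq R[i])) (g : R[i] -> B) : Prop :=
  exists2 C : R, 0 < C & (forall z, cycle_support G z -> N (g z) <= C) /\
    (forall z w, cycle_support G z -> cycle_support G w ->
       N (g z - g w) <= C * cabs (z - w)).

Lemma lip_onM G g g' : lip_on G g -> lip_on G g' -> lip_on G (fun z => g z * g' z).
Proof.
move=> [C C0 [b l]] [C' C'0 [b' l']].
exists (2 * C * C' + 1); first by rewrite ltr_wpDl// !mulr_ge0// ltW.
have CC : 0 < C * C' by rewrite mulr_gt0.
split=> [z zG|z w zG wG].
  apply: le_trans (NM _ _) _; have := ler_pM (N0 _) (N0 _) (b z zG) (b' z zG); lra.
have -> : g z * g' z - g w * g' w = (g z - g w) * g' z + g w * (g' z - g' w).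
  by rewrite mulrBl mulrBr addrA subrK.
apply: le_trans (vnormD VN _ _) _.
have h1 := ler_pM (N0 _) (N0 _) (l z w zG wG) (b' z zG).
have h2 := ler_pM (N0 _) (N0 _) (b w wG) (l' z w zG wG).
have := NM (g z - g w) (g' z); have := NM (g w) (g' z - g' w).
have := cabs_ge0 (z - w); lra.
Qed.

Lemma lip_on_res a G : (forall z, cycle_support G z -> ~ spectrum a z) ->
  lip_on G (resolvent a).
Proof.
move=> H; have [M M0 b] := res_bounded H.
exists (M + M ^+ 2); first by rewrite addr_gt0// exprn_gt0.
have MM : 0 <= M ^+ 2 by rewrite sqr_ge0.
split=> [z zG|z w zG wG]; first by have := b z zG; lra.
rewrite res_identity; [|exact/spectrumN/H|exact/spectrumN/H].
rewrite (vnormZ VN) cabsB mulrC ler_wpM2r ?cabs_ge0//.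
apply: le_trans (NM _ _) _.
have := ler_pM (N0 _) (N0 _) (b z zG) (b w wG); rewrite -expr2; lra.
Qed.

Lemma lip_on_kernel w G : ~ cycle_support G w -> lip_on G (fun z => (z - w)^-1%:A).
Proof.
move=> /support_dist[d d0 dP].
exists (N 1 / d + N 1 / d ^+ 2).
  by rewrite addr_gt0// divr_gt0 ?exprn_gt0 ?norm1_gt0.
have p1 : 0 < N 1 / d by rewrite divr_gt0// norm1_gt0.
have p2 : 0 < N 1 / d ^+ 2 by rewrite divr_gt0 ?exprn_gt0 ?norm1_gt0.
have inv z : cycle_support G z -> cabs (z - w)^-1 <= d^-1.
  by move=> zG; rewrite cabsV lef_pV2 ?posrE ?dP// (lt_le_trans d0)// dP.
split=> [z zG|z z' zG z'G].
  rewrite (vnormZ VN) mulrC; have := ler_wpM2l (N0 1) (inv z zG); lra.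
rewrite -scalerBl (vnormZ VN).
have n1 : z - w != 0 by apply: cabs_neq0; rewrite (lt_le_trans d0)// dP.
have n2 : z' - w != 0 by apply: cabs_neq0; rewrite (lt_le_trans d0)// dP.
have -> : (z - w)^-1 - (z' - w)^-1 = (z' - z) * ((z - w)^-1 * (z' - w)^-1).
  by field; rewrite n1 n2.
rewrite cabsM (cabsB z') cabsM -mulrA mulrC.
apply: ler_wpM2r; first exact: cabs_ge0.
have := ler_pM (cabs_ge0 _) (cabs_ge0 _) (inv z zG) (inv z' z'G).
rewrite -invfM -expr2 => h.
have h' : N 1 * (cabs (z - w)^-1 * cabs (z' - w)^-1) <= N 1 / d ^+ 2 by rewrite ler_wpM2l.
rewrite mulrC; lra.
Qed.

Lemma contour_int_exists G g : lip_on G g -> exists l, ncvg N (contour_sum G g) l.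
Proof.
move=> [C C0 [_ l]].
pose D := (\sum_(e <- cycle_edges G) cabs (e.2 - e.1) ^+ 2) * C.
apply: (complete_rate (b := fun n => D / n.+1%:R)).
  by move=> n m; rewrite -mulrDr; exact: contour_sum_lip (ltW C0) l.
exact: inv_nat_small.
Qed.

End BanachAlgebra.

(** * The contour integral of the resolvent *)

Section ResolventIntegral.
Variables (R : realType) (B : algType R[i]) (N : B -> R).
Hypothesis BN : banach_norm N.
Implicit Types (x y a b : B) (z w h : R[i]).

Let VN : vnorm N := banach_vnorm BN.
Let NM := banach_normM BN.
Let N0 x : 0 <= N x := vnorm_ge0 VN x.

Lemma contour_sumMr G (g : R[i] -> B) x n :
  contour_sum G (fun z => g z * x) n = contour_sum G g n * x.
Proof.
rewrite /contour_sum mulr_suml; apply: eq_bigr => e _; rewrite mulr_suml.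
by apply: eq_bigr => k _; rewrite scalerAl.
Qed.

Lemma contour_sumMl G (g : R[i] -> B) x n :
  contour_sum G (fun z => x * g z) n = x * contour_sum G g n.
Proof.
rewrite /contour_sum mulr_sumr; apply: eq_bigr => e _; rewrite mulr_sumr.
by apply: eq_bigr => k _; rewrite scalerAr.
Qed.

Lemma cabs_i_sub1 : cabs ('i - 1 : R[i]) <= 2.
Proof. by apply: le_trans (cabsD _ _) _; rewrite cabsN cabs1 cabs_i. Qed.

Lemma box0_support (M : R) z : 0 < M -> cycle_support (box 0 M%:C) z -> M / 2 <= cabs z.
Proof.
move=> M0 /box_support[x [y [xy ->]]]; rewrite add0r cabsM cabs_real gtr0_norm//.
rewrite ler_pM2l//; have := cabs_ge_Re (x +i* y); have := cabs_ge_Im (x +i* y).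
by rewrite /=; lra.
Qed.

Lemma box0_length (M : R) : 0 < M -> cycle_length (box 0 M%:C) <= 8 * M.
Proof.
move=> M0; rewrite /cycle_length box_edges !big_cons big_nil /= !sub0r !add0r addr0.
have b (u v : R[i]) : cabs u <= M -> cabs v <= M -> cabs (u - v) <= 2 * M.
  by move=> hu hv; apply: le_trans (cabsD _ _) _; rewrite cabsN; lra.
have m1 : cabs (M%:C : R[i]) <= M by rewrite cabs_real gtr0_norm.
have m2 : cabs ('i * M%:C : R[i]) <= M by rewrite cabsM cabs_i mul1r.
have := b _ _ m2 m1; have : cabs (- M%:C - 'i * M%:C : R[i]) <= 2 * M by apply: b; rewrite ?cabsN.
have : cabs (- ('i * M%:C) - - M%:C : R[i]) <= 2 * M by apply: b; rewrite ?cabsN.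
have : cabs (M%:C - - ('i * M%:C) : R[i]) <= 2 * M by apply: b; rewrite ?cabsN.
lra.
Qed.

(** Liouville's theorem for the quotients of [Q] by the [w - a]: near infinity
    such a quotient is [Q / w + O(1 / w ^ 2)], so that its integral along a
    large square is close to [2 pi i Q], whereas it vanishes by Cauchy's
    theorem. *)
Lemma entire_quotient_eq0 a (Q : B) (F : R[i] -> B) :
  (forall w, F w * (w%:A - a) = Q) ->
  (forall w, exists2 d : R, 0 < d & exists2 C : R, 0 < C &
     forall w' h, cabs (w' - w) < d -> cabs h < d ->
     N (cr_defect F w' h) <= C * cabs h ^+ 2) ->
  Q = 0.
Proof.
move=> FQ FC.
suff : N (two_pi_i R *: Q) = 0.
  rewrite (vnormZ VN) => /eqP; rewrite mulf_eq0 => /orP[/eqP/cabs_eq0/eqP|/eqP].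
    by rewrite (negbTE (two_pi_i_neq0 R)).
  exact: (vnorm_eq0 VN).
apply/eqP; rewrite eq_le N0 andbT; apply: le_forall_eps => e e0; rewrite add0r.
pose D := 8 * (2 * (N (Q * a) * (2 * N 1 * 2))).
have D0 : 0 <= D by rewrite !mulr_ge0.
(* the square is at distance at least [M / 2] from 0, where [res_far] must
   apply, and the integral along it will be [O(D / M)] *)
pose M := 4 * N a * N 1 + D / e + 1.
have NaN1 : 0 <= N a * N 1 by rewrite mulr_ge0.
have De : 0 <= D / e by rewrite divr_ge0// ltW.
have M1 : 1 <= M by rewrite /M; lra.
have M0 : 0 < M by lra.
have DM : D / M <= e.
  rewrite ler_pdivrMr// mulrC -ler_pdivrMr// /M; lra.
have big z : cycle_support (box 0 M%:C) z ->
    [/\ z != 0, invertible (z%:A - a), N (resolvent a z) <= 2 * N 1 * 2 / M & cabs z^-1 <= 2 / M].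
  move=> zG; have c := box0_support M0 zG.
  have z0 : z != 0 by apply: cabs_neq0; lra.
  have iz : (cabs z)^-1 <= 2 / M.
    rewrite -[2 / M]invrK lef_pV2 ?posrE ?invr_gt0 ?divr_gt0 ?cabs_gt0//.
    by rewrite invf_div.
  have [|h1 h2] := @res_far _ _ _ BN a z _ z0; first by rewrite /M in c; lra.
  split => //; last by rewrite cabsV.
  by apply: le_trans h2 _; rewrite -!mulrA !ler_wpM2l.
have s0 : M%:C != 0 :> R[i] by apply: cabs_neq0; rewrite cabs_real gtr0_norm.
have st := box_stokes VN 0 M%:C FC.
have := ncvg_scalar BN Q (box_center 0 s0); rewrite mulr1 => hc.
apply: le_trans DM; rewrite -[_ *: Q]subr0.
apply: (ncvg_dist_le VN hc st); apply: nearW => n.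
rewrite -contour_sum_scalar -contour_sumB.
have -> : contour_sum (box 0 M%:C) (fun z => (z - 0)^-1 *: Q - F z) n =
          contour_sum (box 0 M%:C) (fun z => - (z^-1 *: (Q * a * resolvent a z))) n.
  apply: eq_contour_sum => z /big[z0 hz _ _]; rewrite subr0.
  have -> : F z = Q * resolvent a z by rewrite -(FQ z) -mulrA res_mulr// mulr1.
  have rE : resolvent a z = z^-1 *: (1 + a * resolvent a z).
    rewrite -[X in X + _](res_mulr hz) mulrBl -addrA addNr addr0.
    by rewrite -scalerAl mul1r scalerA mulVf// scale1r.
  rewrite [in LHS]rE -scalerAr mulrDr mulr1 scalerDr opprD addrA subrr add0r.
  by rewrite mulrA.
have K0 : 0 <= 2 / M * (N (Q * a) * (2 * N 1 * 2 / M)).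
  by rewrite !mulr_ge0 ?invr_ge0 ?(ltW M0).
apply: le_trans (vnorm_contour_sum VN _ K0 _) _.
  move=> z /big[z0 hz h1 h2]; rewrite (vnormN VN) (vnormZ VN).
  apply: ler_pM => //; first exact: cabs_ge0.
  by apply: le_trans (NM _ _) _; rewrite ler_wpM2l.
apply: le_trans (ler_wpM2r K0 (box0_length M0)) _.
rewrite le_eqVlt; apply/orP; left; apply/eqP; rewrite /D; field.
by rewrite gt_eqF.
Qed.

Section Winding.
Variables (a : B) (G : seq (seq R[i])) (k : R[i]).
Hypothesis Gspec : forall z, cycle_support G z -> ~ spectrum a z.
Hypothesis Gwind : forall w, spectrum a w -> winding G w k.

Lemma spectrum_notin_support w : spectrum a w -> ~ cycle_support G w.
Proof. by move=> sw /Gspec. Qed.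

(** The Cauchy transform of the resolvent. If [P] denotes the integral of the
    resolvent, it is the quotient of [2 pi i k - P] by [w - a] at each point
    where the winding number is [k]: this is the form of the quotient that
    survives on the spectrum. *)
Definition cauchy_res w : B :=
  xget 0 [set l | ncvg N (contour_sum G (fun z => (z - w)^-1%:A * resolvent a z)) l].

Lemma cauchy_resP w : ~ cycle_support G w ->
  ncvg N (contour_sum G (fun z => (z - w)^-1%:A * resolvent a z)) (cauchy_res w).
Proof.
move=> nw; apply: (xgetPex 0 (P := [set l | ncvg N _ l])).
apply: (contour_int_exists BN); apply: (lip_onM BN).
  exact: (lip_on_kernel BN).
exact: (lip_on_res BN).
Qed.

(** Since [w - a = (z - a) - (z - w)], multiplying the integrand by [w - a]
    leaves [(z - w)^-1] minus the resolvent. *)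
Lemma cauchy_res_mulr (P : B) w : ncvg N (contour_sum G (resolvent a)) P ->
  ~ cycle_support G w -> winding G w k ->
  cauchy_res w * (w%:A - a) = (two_pi_i R * k)%:A - P.
Proof.
move=> hP nw hw; apply: (ncvg_unique VN (ncvgMr BN (w%:A - a) (cauchy_resP nw))).
apply: eq_ncvg (ncvgB VN (ncvg_scalar BN 1 hw) hP) => n.
rewrite -contour_sumMr -contour_sum_scalar -contour_sumB; apply: eq_contour_sum => z zG.
have zw : z - w != 0 by rewrite subr_eq0; apply/eqP => zw; apply: nw; rewrite -zw.
have -> : w%:A - a = (z%:A - a) - (z - w)%:A.
  by rewrite scalerBl opprB [RHS]addrC addrA subrK.
rewrite mulrBr -(mulrA _ _ (z%:A - a)) res_mull; last exact/spectrumN/Gspec.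
by rewrite mulr1 -scalerAr mulr1 -scalerAl mul1r scalerA divff// scale1r.
Qed.

(** The Cauchy-Riemann defect of the kernel [(z - w)^-1] is computed exactly: it
    is [h ^ 2] times three inverses, which are bounded because [w] stays away from
    the support. *)
Lemma cauchy_res_defect w : ~ cycle_support G w ->
  exists2 d : R, 0 < d & exists2 C : R, 0 < C &
    forall w' h, cabs (w' - w) < d -> cabs h < d ->
    N (cr_defect cauchy_res w' h) <= C * cabs h ^+ 2.
Proof.
move=> nw; have [d d0 dP] := support_dist nw.
have [M M0 MP] := res_bounded BN Gspec.
have d40 : 0 < d / 4 by rewrite divr_gt0.
have far z v : cycle_support G z -> cabs (v - w) < d / 2 -> d / 2 <= cabs (z - v).
  move=> /dP h1 h2; have := cabsD (z - v) (v - w); rewrite subrKA; lra.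
have nv v : cabs (v - w) < d / 2 -> ~ cycle_support G v.
  by move=> hv /far/(_ hv); rewrite subrr cabs0; lra.
pose L := cycle_length G * (2 * (2 / d) ^+ 3 * M) + 1.
have dd : 0 < (2 / d) ^+ 3 by rewrite exprn_gt0// divr_gt0.
have C0 : 0 < 2 * (2 / d) ^+ 3 * M by apply: mulr_gt0 => //; exact: mulr_gt0.
exists (d / 4) => //; exists L.
  by rewrite ltr_wpDl// mulr_ge0 ?cycle_length_ge0// ltW.
move=> w' h hw hh.
have b0 : cabs (w' - w) < d / 2 by lra.
have b1 : cabs (w' + h - w) < d / 2.
  by rewrite addrAC; apply: le_lt_trans (cabsD _ _) _; lra.
have b2 : cabs (w' + 'i * h - w) < d / 2.
  by rewrite addrAC; apply: le_lt_trans (cabsD _ _) _; rewrite cabsM cabs_i; lra.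
have lim := ncvgB VN (ncvgB VN (cauchy_resP (nv _ b2)) (cauchy_resP (nv _ b0)))
  (ncvgZ VN 'i (ncvgB VN (cauchy_resP (nv _ b1)) (cauchy_resP (nv _ b0)))).
apply: (ncvg_norm_le VN lim); apply: nearW => n.
rewrite -!contour_sumB -contour_sumZ -contour_sumB.
have cc : 0 <= cabs h ^+ 2 by rewrite sqr_ge0.
apply: le_trans (@vnorm_contour_sum _ _ _ VN _ _ _ (2 * (2 / d) ^+ 3 * M * cabs h ^+ 2) _ _) _.
- by rewrite mulr_ge0// ltW.
- move=> z zG; rewrite -!mulrBl -!scalerBl scalerAl scalerA -mulrBl -scalerBl.
  rewrite -[(_ *: 1) * _]scalerAl mul1r (vnormZ VN).
  have [f0 [f1 f2]] := (far _ _ zG b0, (far _ _ zG b1, far _ _ zG b2)).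
  have n0 : z - w' != 0 by apply: cabs_neq0; lra.
  have n1 : z - (w' + h) != 0 by apply: cabs_neq0; lra.
  have n2 : z - (w' + 'i * h) != 0 by apply: cabs_neq0; lra.
  have -> : (z - (w' + 'i * h))^-1 - (z - w')^-1 - 'i * ((z - (w' + h))^-1 - (z - w')^-1) =
    'i * h * (('i - 1) * h) * ((z - w')^-1 * (z - (w' + h))^-1 * (z - (w' + 'i * h))^-1).
    by field; rewrite n0 n1 n2.
  rewrite !cabsM cabs_i mul1r.
  have inv v : d / 2 <= cabs v -> cabs v^-1 <= 2 / d.
    move=> hv; rewrite cabsV -[2 / d]invrK invf_div lef_pV2 ?posrE//; lra.
  have i2 := ler_pM (cabs_ge0 _) (cabs_ge0 _) (inv _ f0) (inv _ f1).
  have i3 := ler_pM (mulr_ge0 (cabs_ge0 _) (cabs_ge0 _)) (cabs_ge0 _) i2 (inv _ f2).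
  have c1 := cabs_i_sub1.
  have c2 : cabs h * (cabs ('i - 1) * cabs h) <= 2 * cabs h ^+ 2.
    rewrite mulrCA -expr2; exact: ler_wpM2r.
  have := ler_pM (mulr_ge0 (cabs_ge0 _) (mulr_ge0 (cabs_ge0 _) (cabs_ge0 _)))
     (mulr_ge0 (mulr_ge0 (cabs_ge0 _) (cabs_ge0 _)) (cabs_ge0 _)) c2 i3.
  move=> c3.
  apply: le_trans (ler_pM _ (N0 _) c3 (MP z zG)) _.
    by rewrite !mulr_ge0 ?cabs_ge0.
  by rewrite le_eqVlt; apply/orP; left; apply/eqP; ring.
- rewrite /L; move: (2 * (2 / d) ^+ 3 * M) (cabs h ^+ 2) cc => x y y0; lra.
Qed.

(** The same computation as for the Cauchy kernel, by the resolvent identity. *)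
Lemma res_defect Q w : ~ spectrum a w ->
  exists2 d : R, 0 < d & exists2 C : R, 0 < C &
    forall w' h, cabs (w' - w) < d -> cabs h < d ->
    N (cr_defect (fun v => Q * resolvent a v) w' h) <= C * cabs h ^+ 2.
Proof.
move=> /spectrumN/(res_near BN)[d d0 [C C0 dP]].
exists (d / 2); first by rewrite divr_gt0.
exists (2 * N Q * C ^+ 3 + 1).
  by rewrite ltr_wpDl// !mulr_ge0// ltW.
move=> w' h hw hh.
have [|r0 n0] := dP w'; first by lra.
have [|r1 n1] := dP (w' + h).
  by rewrite addrAC; apply: le_lt_trans (cabsD _ _) _; lra.
have [|r2 n2] := dP (w' + 'i * h).
  by rewrite addrAC; apply: le_lt_trans (cabsD _ _) _; rewrite cabsM cabs_i; lra.
have -> : cr_defect (fun v => Q * resolvent a v) w' h =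
  ('i * h * (('i - 1) * h)) *: (Q * (resolvent a (w' + 'i * h) * resolvent a (w' + h) * resolvent a w')).
  rewrite /cr_defect -!mulrBr scalerAr -mulrBr [RHS]scalerAr; congr (Q * _).
  rewrite !res_identity//.
  have -> : w' - (w' + 'i * h) = - ('i * h) by ring.
  have -> : w' - (w' + h) = - h by ring.
  rewrite scalerA mulrN -scalerBr -mulrBl res_identity//.
  have -> : w' + h - (w' + 'i * h) = - (('i - 1) * h) by ring.
  by rewrite -scalerAl scalerA mulrNN.
rewrite (vnormZ VN) !cabsM cabs_i mul1r.
have c2 : cabs h * (cabs ('i - 1) * cabs h) <= 2 * cabs h ^+ 2.
  by rewrite mulrCA -expr2; apply: ler_wpM2r; rewrite ?sqr_ge0// cabs_i_sub1.
have m1 := le_trans (NM _ _) (ler_pM (N0 _) (N0 _) n2 n1).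
have m2 := le_trans (NM _ _) (ler_pM (N0 _) (N0 _) m1 n0).
have m3 := le_trans (NM _ _) (ler_pM (N0 _) (N0 _) (lexx (N Q)) m2).
apply: le_trans (ler_pM _ (N0 _) c2 m3) _; first by rewrite !mulr_ge0 ?cabs_ge0.
have := sqr_ge0 (cabs h); rewrite (_ : C * C * C = C ^+ 3); last by ring.
lra.
Qed.

(** If [P] is the integral, [Q = 2 pi i k - P] has a quotient by [w - a] for every [w]: the
    Cauchy transform on the spectrum and [Q] times the resolvent elsewhere. The
    two agree near the spectrum, so the quotient is entire, and [Q] vanishes by
    Liouville's theorem. *)
Lemma contour_resolvent :
  ncvg N (contour_sum G (resolvent a)) (two_pi_i R * k)%:A.
Proof.
have [P hP] := contour_int_exists BN (lip_on_res BN Gspec).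
pose Q := (two_pi_i R * k)%:A - P.
suff Q0 : Q = 0 by move/eqP: Q0; rewrite subr_eq0 => /eqP ->.
pose F w := if `[< spectrum a w >] then cauchy_res w else Q * resolvent a w.
(* near the spectrum the two expressions of the quotient agree *)
have FK w : ~ cycle_support G w -> winding G w k -> F w = cauchy_res w.
  move=> nw hw; rewrite /F; case: asboolP => // sw.
  by rewrite /Q -(cauchy_res_mulr hP nw hw) -mulrA res_mulr ?mulr1//; exact: spectrumN.
apply: (@entire_quotient_eq0 a Q F) => w.
- have [sw|sw] := pselect (spectrum a w).
    rewrite FK; [|exact: spectrum_notin_support|exact: Gwind].
    by apply: cauchy_res_mulr => //; [exact: spectrum_notin_support|exact: Gwind].
  rewrite /F; case: asboolP => // _.
  by rewrite -mulrA res_mull ?mulr1//; exact: spectrumN.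
- have [sw|sw] := pselect (spectrum a w).
    have [d1 d10 h1] := winding_near (spectrum_notin_support sw) (Gwind sw).
    have [d2 d20 [C C0 h2]] := cauchy_res_defect (spectrum_notin_support sw).
    exists (Num.min (d1 / 2) d2); first by rewrite lt_min d20 divr_gt0.
    exists C => // w' h; rewrite !lt_min => /andP[a1 a2] /andP[b1 b2].
    have FKn v : cabs (v - w) < d1 -> F v = cauchy_res v.
      by move=> /h1[]; exact: FK.
    rewrite /cr_defect (FKn w'); last by lra.
    rewrite (FKn (w' + h)); last first.
      by rewrite addrAC; apply: le_lt_trans (cabsD _ _) _; lra.
    rewrite (FKn (w' + 'i * h)); first exact: h2.
    by rewrite addrAC; apply: le_lt_trans (cabsD _ _) _; rewrite cabsM cabs_i; lra.
  have [d1 d10 [C1 C10 h1]] := res_near BN (spectrumN sw).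
  have [d2 d20 [C C0 h2]] := res_defect Q sw.
  exists (Num.min (d1 / 2) d2); first by rewrite lt_min d20 divr_gt0.
  exists C => // w' h; rewrite !lt_min => /andP[a1 a2] /andP[b1 b2].
  have FKn v : cabs (v - w) < d1 -> F v = Q * resolvent a v.
    by move=> /h1[iv _]; rewrite /F; case: asboolP => // sv; case: sv.
  rewrite /cr_defect (FKn w'); last by lra.
  rewrite (FKn (w' + h)); last first.
    by rewrite addrAC; apply: le_lt_trans (cabsD _ _) _; lra.
  rewrite (FKn (w' + 'i * h)); first exact: h2.
  by rewrite addrAC; apply: le_lt_trans (cabsD _ _) _; rewrite cabsM cabs_i; lra.
Qed.

End Winding.

End ResolventIntegral.

(** * Separated and positive spectra *)

Section AxisParallelSquare.
Variable R : realType.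
Implicit Types (c w z : R[i]) (M : R).

(** The square with sides of length [2 * M] parallel to the axes: its half
    diagonal is [M * (1 + 'i)]. *)
Definition square c M : seq (seq R[i]) := box c (M%:C * (1 + 'i)).

Lemma square_half_diagonal_neq0 M : 0 < M -> M%:C * (1 + 'i) != 0 :> R[i].
Proof.
move=> M0; rewrite mulf_eq0 negb_or; apply/andP; split.
  by apply: cabs_neq0; rewrite cabs_real gtr0_norm.
by apply/eqP => -[/eqP]; rewrite addr0 oner_eq0.
Qed.

Lemma rot45E M (x y : R) :
  M%:C * (1 + 'i) * (x +i* y) = (M * (x - y)) +i* (M * (x + y)).
Proof. by apply/eqP; rewrite eq_complex /=; apply/andP; split; apply/eqP; ring. Qed.

Lemma square_support c M z : 0 < M -> cycle_support (square c M) z ->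
  [/\ `|complex.Re (z - c)| <= M, `|complex.Im (z - c)| <= M &
      `|complex.Re (z - c)| = M \/ `|complex.Im (z - c)| = M].
Proof.
move=> M0 /box_support[x [y [xy ->]]].
rewrite addrC addKr rot45E /= !normrM (gtr0_norm M0).
have h1 : `|x - y| <= 1 by rewrite -xy; exact: ler_normB.
have h2 : `|x + y| <= 1 by rewrite -xy; exact: ler_normD.
split; [nra|nra|].
have : `|x - y| = 1 \/ `|x + y| = 1.
  case: (lerP 0 x) => hx; case: (lerP 0 y) => hy.
  - by right; rewrite ger0_norm ?addr_ge0// -xy !ger0_norm.
  - left; rewrite ger0_norm; last lra.
    by rewrite -xy (ger0_norm hx) (ltr0_norm hy).
  - left; rewrite ler0_norm; last lra.
    by rewrite -xy (ger0_norm hy) (ltr0_norm hx); ring.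
  - right; rewrite ler0_norm; last lra.
    by rewrite -xy (ltr0_norm hy) (ltr0_norm hx); ring.
by case=> ->; [left|right]; rewrite mulr1.
Qed.

Lemma square_inside c M w : 0 < M ->
  `|complex.Re (w - c)| < M -> `|complex.Im (w - c)| < M ->
  ~ cycle_support (square c M) w /\ winding (square c M) w 1.
Proof.
move=> M0 h1 h2; split.
  by move=> /(square_support M0)[_ _ [] e]; rewrite e ltxx in h1 h2.
pose X := complex.Re (w - c); pose Y := complex.Im (w - c).
have -> : w = c + (M%:C * (1 + 'i)) * (((X + Y) / (2 * M)) +i* ((Y - X) / (2 * M))).
  rewrite rot45E.
  have -> : M * ((X + Y) / (2 * M) - (Y - X) / (2 * M)) = X by field; rewrite gt_eqF.
  have -> : M * ((X + Y) / (2 * M) + (Y - X) / (2 * M)) = Y by field; rewrite gt_eqF.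
  have -> : X +i* Y = w - c by rewrite /X /Y; case: (w - c).
  by rewrite addrC subrK.
apply: box_winding_in; first exact: square_half_diagonal_neq0.
rewrite !normrM [`|_^-1|]ger0_norm ?invr_ge0 ?mulr_ge0 ?ltW//.
rewrite -mulrDl ltr_pdivrMr ?mulr_gt0// mul1r.
move: h1 h2; rewrite -/X -/Y; case: (lerP 0 (X + Y)) => hx; case: (lerP 0 (Y - X)) => hy;
  rewrite ?(ger0_norm hx) ?(ger0_norm hy) ?(ltr0_norm hx) ?(ltr0_norm hy) !ltr_norml;
  move=> /andP[h1 h2] /andP[h3 h4]; lra.
Qed.

End AxisParallelSquare.

Section SeparatedSpectra.
Variables (R : realType) (B : algType R[i]) (N : B -> R).
Hypothesis BN : banach_norm N.
Implicit Types (x y a b : B) (z w : R[i]).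

Let VN : vnorm N := banach_vnorm BN.

(** Sylvester's equation. Along a square of the closed right half-plane that
    surrounds the spectrum of [a] only, the product of the two resolvents times [a - b] is
    their difference, whose integral is [2 pi i - 0]. So the integral of the
    product is an inverse of [a - b], up to [2 pi i]. *)
Lemma separated_invertible a b : a * b = b * a ->
  (forall w, spectrum a w -> 0 < complex.Re w) ->
  (forall w, spectrum b w -> complex.Re w < 0) -> invertible (a - b).
Proof.
move=> ab ha hb.
have N0 x : 0 <= N x := vnorm_ge0 VN x.
pose M := 2 * N a * N 1 + 1.
have M0 : 0 < M by rewrite ltr_wpDl// !mulr_ge0.
pose G := square M%:C M.
have ReM z : complex.Re (z - M%:C) = complex.Re z - M by case: z.
have ImM z : complex.Im (z - M%:C) = complex.Im z by case: z => x y /=; rewrite subr0.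
have ina w : spectrum a w -> ~ cycle_support G w /\ winding G w 1.
  move=> wa; have h1 := ha _ wa; have h2 := spectrum_bounded BN wa.
  have h3 := cabs_ge_Re w; have h4 := cabs_ge_Im w.
  have h5 : complex.Re w <= `|complex.Re w| by exact: ler_norm.
  apply: square_inside => //; last by rewrite ImM; rewrite /M; lra.
  by rewrite ReM ltr_norml; apply/andP; split; rewrite /M; lra.
have Re0 z : cycle_support G z -> 0 <= complex.Re z.
  by move=> /(square_support M0)[]; rewrite ReM ler_norml => /andP[h _] _ _; lra.
have outa z : cycle_support G z -> ~ spectrum a z by move=> zG /ina[].
have outb z : cycle_support G z -> ~ spectrum b z.
  by move=> /Re0 h1 /hb; rewrite ltNge h1.
have wb w : spectrum b w -> winding G w 0.
  move=> /hb hw; apply: (@winding_slit _ _ _ 1) => z zG; rewrite mul1r.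
  apply: Re_slit; have := Re0 z zG.
  have -> : complex.Re (z - w) = complex.Re z - complex.Re w by case: (z) (w) => [? ?] [].
  lra.
have ca := contour_resolvent BN outa (fun w h => (ina w h).2).
have cb := contour_resolvent BN outb wb.
rewrite mulr1 in ca; rewrite mulr0 scale0r in cb.
have ra z zG := spectrumN (outa z zG); have rb z zG := spectrumN (outb z zG).
have [T hT] := contour_int_exists BN (lip_onM BN (lip_on_res BN outa) (lip_on_res BN outb)).
have key z : cycle_support G z ->
    (a - b) * (resolvent a z * resolvent b z) = resolvent a z - resolvent b z.
  move=> zG; have -> : a - b = (z%:A - b) - (z%:A - a).
    by rewrite opprB [RHS]addrC addrA subrK.
  rewrite mulrBl; congr (_ - _); last by rewrite mulrA res_mulr ?mul1r//; exact: ra.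
  have cab : (z%:A - b) * resolvent a z = resolvent a z * (z%:A - b).
    apply: res_comm; first exact: ra.
    by rewrite mulrBl mulrBr ab -scalerAl -scalerAr mul1r mulr1.
  by rewrite mulrA cab -mulrA res_mulr ?mulr1//; exact: rb.
have TE : (a - b) * T = (two_pi_i R)%:A.
  apply: (ncvg_unique VN (ncvgMl BN (a - b) hT)).
  rewrite -[_%:A]subr0; apply: eq_ncvg (ncvgB VN ca cb) => n.
  by rewrite -contour_sumMl -contour_sumB; apply: eq_contour_sum => z /key.
have comT : (a - b) * T = T * (a - b).
  apply: (ncvg_commute BN _ hT) => n.
  rewrite -contour_sumMl -contour_sumMr; apply: eq_contour_sum => z zG.
  have c1 : (a - b) * resolvent a z = resolvent a z * (a - b).
    by apply: res_comm; [exact: ra|rewrite mulrBl mulrBr ab].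
  have c2 : (a - b) * resolvent b z = resolvent b z * (a - b).
    by apply: res_comm; [exact: rb|rewrite mulrBl mulrBr ab].
  by rewrite mulrA c1 -mulrA c2 mulrA.
have p0 := two_pi_i_neq0 R.
exists ((two_pi_i R)^-1 *: T); split.
  by rewrite -scalerAr TE scalerA mulVf// scale1r.
by rewrite -scalerAl -comT TE scalerA mulVf// scale1r.
Qed.

Definition pos_spectrum (x : B) : Prop := forall z, spectrum x z -> 0 < z.

Lemma pos_spectrum_inv x z : pos_spectrum x -> ~~ (0 < z) -> invertible (z%:A - x).
Proof. by move=> px nz; apply: spectrumN => /px h; rewrite h in nz. Qed.

Lemma invertibleZ c x : c != 0 -> invertible x -> invertible (c *: x).
Proof.
move=> c0 [y [h1 h2]]; exists (c^-1 *: y); split.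
  by rewrite -scalerAl -scalerAr scalerA divff// scale1r.
by rewrite -scalerAl -scalerAr scalerA mulVf// scale1r.
Qed.

Lemma invertibleN x : invertible x -> invertible (- x).
Proof. by rewrite -scaleN1r; apply: invertibleZ; rewrite oppr_eq0 oner_neq0. Qed.

Lemma pos_spectrum_invertible x : pos_spectrum x -> invertible x.
Proof.
move=> px; have := @pos_spectrum_inv x 0 px; rewrite ltxx scale0r sub0r => /(_ isT).
by move/invertibleN; rewrite opprK.
Qed.

(** If [z] is not a positive number, multiplication by a suitable [u] sends the
    positive half-line to the right and [z] to the left of the imaginary axis.
    This separates the spectra of [u x] and [u z y ^-1], so that their
    difference, which is [u (x y - z) y ^-1], is invertible. *)
Lemma pos_spectrumM x y : x * y = y * x -> pos_spectrum x -> pos_spectrum y ->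
  pos_spectrum (x * y).
Proof.
move=> xy px py z; apply: contraPT => nz; apply; rewrite -/(invertible _).
have iy := pos_spectrum_invertible py.
have [z0|z0] := eqVneq z 0.
  by rewrite z0 scale0r sub0r; apply/invertibleN/invertibleM => //; exact: pos_spectrum_invertible.
pose d := binv y; have cz := cabs_gt0 z0.
(* [u] has positive real part, unlike [u * z = z - cabs z] *)
have [u uE] : exists u : R[i], u = 1 - (z^*)%C / (cabs z)%:C by eexists.
have zz : z * (z^*)%C = ((cabs z) ^+ 2)%:C.
  by rewrite sqr_cabs; case: (z) => p q; apply/eqP; rewrite eq_complex /=; apply/andP; split; apply/eqP; ring.
have cz0 : (cabs z)%:C != 0 :> R[i] by rewrite -[0]/(0%:C) (inj_eq (@complexI _)) gt_eqF.
have uz : u * z = z - (cabs z)%:C.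
  rewrite uE mulrBl mul1r mulrAC [_^* * z]mulrC zz rmorphXn expr2 mulfK//.
have Rez : complex.Re z < cabs z.
  rewrite ltNge; apply/negP => h; move/negP: nz; apply.
  have i0 : complex.Im z ^+ 2 <= 0 by have := sqr_cabs z; nra.
  rewrite ltcE; apply/andP; split; last by rewrite /=; lra.
  by rewrite /= -sqrf_eq0 eq_le i0 sqr_ge0.
have ReuE : complex.Re u = 1 - complex.Re z / cabs z.
  rewrite uE -fmorphV /=; case: (z) => p q /=; ring.
have Reu : 0 < complex.Re u by rewrite ReuE subr_gt0 ltr_pdivrMr// mul1r.
have Reuz : complex.Re (u * z) < 0.
  by rewrite uz; move: Rez; case: (z) => p q /=; lra.
have u0 : u != 0 by apply: contraTneq Reu => ->; rewrite ltxx.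
have dy : d * y = 1 by exact: mulVbr.
have yd : y * d = 1 by exact: mulrbV.
have iuv : invertible (u *: x - (u * z) *: d).
  apply: separated_invertible.
  - rewrite -!scalerAl -!scalerAr !scalerA; congr (_ *: _); first by ring.
    exact: binv_comm.
  - move=> w; apply: contraPT => nw; apply.
    have -> : w%:A - u *: x = u *: ((w / u)%:A - x).
      by rewrite scalerBr scalerA mulrCA divff// mulr1.
    apply: invertibleZ => //; apply: pos_spectrum_inv => //.
    apply: contraNN nw => /=; rewrite ltcE => /andP[/eqP i r].
    have -> : w = u * (complex.Re (w / u))%:C.
      by rewrite -[LHS](divfK u0) mulrC; congr (_ * _); move: i r; case: (w / u) => p q /= ->.
    by move: Reu r; case: (u) => p q /=; rewrite mulr0 subr0; nra.
  - move=> w; apply: contraPT; rewrite -leNgt => nw; apply.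
    have -> : w%:A - (u * z) *: d = (w *: y - (u * z)%:A) * d.
      by rewrite mulrBl -!scalerAl yd mul1r.
    apply: invertibleM; last exact: invertible_binv.
    have [w0|w0] := eqVneq w 0.
      rewrite w0 scale0r sub0r; apply/invertibleN/invertibleZ; first by rewrite mulf_neq0.
      by exists 1; split; rewrite mulr1.
    have -> : w *: y - (u * z)%:A = - (w *: ((u * z / w)%:A - y)).
      by rewrite scalerBr opprB scalerA mulrCA divff// mulr1.
    apply/invertibleN/invertibleZ => //; apply: pos_spectrum_inv => //.
    apply/negP; rewrite ltcE => /andP[/eqP i r].
    have E : u * z = w * (complex.Re (u * z / w))%:C.
      by rewrite -[LHS](divfK w0) mulrC; congr (_ * _); move: i r; case: (u * z / w) => p q /= ->.
    move: Reuz; rewrite E; move: r; set t := complex.Re (_ / _); rewrite /= => r.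
    by move: nw; case: (w) => p q /=; rewrite mulr0 subr0; nra.
have -> : z%:A - x * y = - (u^-1 *: ((u *: x - (u * z) *: d) * y)).
  rewrite mulrBl -!scalerAl dy scalerBr !scalerA mulVf// mulrA mulVf// mul1r scale1r.
  by rewrite opprB.
by apply/invertibleN/invertibleZ; rewrite ?invr_eq0//; exact: invertibleM.
Qed.

(** The segment from the unit to [x], along which the logarithm of [x] is the
    integral of [(x - 1) * (1 + t (x - 1)) ^-1]. *)
Definition unit_segment (t : R) (x : B) : B := 1 + t%:C *: (x - 1).

Lemma unit_segment_inv t x : pos_spectrum x -> 0 <= t <= 1 -> invertible (unit_segment t x).
Proof.
move=> px /andP[t0 t1]; have [->|tn] := eqVneq t 0.
  by rewrite /unit_segment scale0r addr0; exists 1; split; rewrite mulr1.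
have tc : t%:C != 0 :> R[i] by rewrite -[0]/(0%:C) (inj_eq (@complexI _)).
have -> : unit_segment t x = - (t%:C *: ((1 - t^-1)%:C%:A - x)).
  have E : t%:C *: (1 - t^-1)%:C%:A = (t%:C - 1)%:A :> B.
    by rewrite scalerA -rmorphM mulrBr mulr1 divff// rmorphB.
  by rewrite /unit_segment !scalerBr E scalerBl scale1r !opprB addrCA.
apply/invertibleN/invertibleZ => //; apply: pos_spectrum_inv => //.
have tp : 0 < t by rewrite lt_def tn.
by rewrite ltcR -leNgt subr_le0 invf_ge1.
Qed.

Lemma pos_spectrum_segment t x : pos_spectrum x -> 0 <= t <= 1 ->
  pos_spectrum (unit_segment t x).
Proof.
move=> px /andP[t0 t1] z; apply: contraPT => nz; apply; rewrite -/(invertible _).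
have [tE|tn] := eqVneq t 0.
  rewrite tE /unit_segment scale0r addr0 -scaleN1r -scalerDl.
  apply: invertibleZ; last by exists 1; split; rewrite mulr1.
  by rewrite subr_eq0; apply: contraNneq nz => ->; exact: ltr01.
have tp : 0 < t by rewrite lt_def tn.
have tc : t%:C != 0 :> R[i] by rewrite -[0]/(0%:C) (inj_eq (@complexI _)).
have -> : z%:A - unit_segment t x = t%:C *: (((z - 1) / t%:C + 1)%:A - x).
  have E : t%:C *: ((z - 1) / t%:C + 1)%:A = (z - 1)%:A + t%:C%:A :> B.
    by rewrite scalerA mulrDr mulrCA divff// !mulr1 scalerDl.
  rewrite /unit_segment !scalerBr E scalerBl scale1r opprD opprB addrA.
  by rewrite [t%:C *: 1 - _]addrC !addrA addrAC.
apply: invertibleZ => //; apply: pos_spectrum_inv => //.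
apply: contraNN nz; rewrite !ltcE -fmorphV => /andP[/eqP i r].
move: i r; case: z => p q /=; rewrite !subr0 !mulr0 !addr0 subr0 => i r.
have {i} -> : q = 0.
  by have /eqP := i; rewrite add0r mulf_eq0 invr_eq0 (negbTE tn) orbF => /eqP.
rewrite eqxx /=.
have : 0 < t * ((p - 1) / t + 1) by rewrite mulr_gt0.
by rewrite mulrDr mulrCA divff// !mulr1; lra.
Qed.

End SeparatedSpectra.

(** * The exponential in a Banach algebra *)

(** [u ^ m - v ^ m] telescopes, even for non-commuting [u] and [v]. *)
Lemma norm_exprB (R : realType) (B : nzRingType) (N : B -> R) (u v : B) (K : R) (n : nat) :
  (forall x y, N (x + y) <= N x + N y) -> (forall x y, N (x * y) <= N x * N y) ->
  (forall x, 0 <= N x) -> N 0 = 0 -> N 1 <= 1 -> N u <= K -> N v <= K ->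
  N (u ^+ n.+1 - v ^+ n.+1) <= n.+1%:R * N (u - v) * K ^+ n.
Proof.
move=> ND NM N0 N00 N1 uK vK.
have K0 : 0 <= K by exact: le_trans (N0 _) uK.
have uX j : N (u ^+ j) <= K ^+ j.
  elim: j => [|j IH]; first by rewrite !expr0.
  by rewrite !exprS; apply: le_trans (NM _ _) _; apply: ler_pM.
elim: n => [|n IH]; first by rewrite !expr1 mulr1 mul1r.
have -> : u ^+ n.+2 - v ^+ n.+2 = u ^+ n.+1 * (u - v) + (u ^+ n.+1 - v ^+ n.+1) * v.
  by rewrite mulrBr mulrBl -!exprSr addrA subrK.
have h1 : N (u ^+ n.+1 * (u - v)) <= K ^+ n.+1 * N (u - v).
  by apply: le_trans (NM _ _) _; exact: ler_wpM2r.
have h2 : N ((u ^+ n.+1 - v ^+ n.+1) * v) <= n.+1%:R * N (u - v) * K ^+ n * K.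
  by apply: le_trans (NM _ _) _; exact: ler_pM.
apply: le_trans (ND _ _) _; apply: le_trans (lerD h1 h2) _.
rewrite -(natr1 n.+1) -mulrA -exprSr mulrDl mul1r mulrDl addrC lerD2l.
by rewrite mulrC.
Qed.

Section ScalarExponential.
Variable R : realType.
Implicit Types z : R[i].

Definition exp_approx n z : R[i] := (1 + z / n.+1%:R) ^+ n.+1.

Lemma cexpX z n : cexp z ^+ n = cexp (z *+ n).
Proof.
elim: n => [|n IH]; first by rewrite expr0 mulr0n cexp0.
by rewrite exprS IH -cexpD mulrS.
Qed.

Lemma expR_divX (t : R) n : expR t = expR (t / n.+1%:R) ^+ n.+1.
Proof. by rewrite -expRM_natl mulrC divfK. Qed.

Lemma one_plus_expR_le (t : R) n : 0 <= t -> (1 + t / n.+1%:R) ^+ n.+1 <= expR t.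
Proof.
move=> t0; rewrite (expR_divX t n) lerXn2r ?nnegrE ?addr_ge0 ?divr_ge0 ?expR_ge0//.
exact: expR_ge1Dx.
Qed.

(** [cexp z] is the power of [cexp (z / n)] with exponent [n], so the difference
    of powers is controlled by that of the bases, which is [O(1 / n ^ 2)]. *)
Lemma cexp_approx_rate (M : R) : 0 <= M -> exists2 C : R, 0 < C &
  forall n z, cabs z <= M -> cabs (cexp z - exp_approx n z) <= C / n.+1%:R.
Proof.
move=> M0; have e0 := expR_gt0 M.
exists (8 * M ^+ 2 * expR M + 4 * M * expR M + 1).
  by rewrite ltr_wpDl// addr_ge0// !mulr_ge0 ?sqr_ge0// ltW.
move=> n z zM; have n0 : 0 < n.+1%:R :> R by rewrite ltr0n.
have zn : cabs (z / n.+1%:R) = cabs z / n.+1%:R by rewrite cabsM cabs_invn.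
pose K := expR (M / n.+1%:R).
have uK : cabs (cexp (z / n.+1%:R)) <= K.
  rewrite cabs_cexp ler_expR; apply: le_trans (ler_norm _) _.
  by apply: le_trans (cabs_ge_Re _) _; rewrite zn ler_pM2r// invr_gt0.
have vK : cabs (1 + z / n.+1%:R) <= K.
  apply: le_trans (cabsD _ _) _; rewrite cabs1 zn.
  by apply: le_trans (expR_ge1Dx _); rewrite lerD2l ler_pM2r// invr_gt0.
have KM j : (j <= n.+1)%N -> K ^+ j <= expR M.
  move=> jn; have K1 : 1 <= K by rewrite -expR0 ler_expR divr_ge0.
  apply: le_trans (_ : K ^+ n.+1 <= _); first by rewrite ler_weXn2l.
  by rewrite /K -expR_divX.
have zE : cexp z = cexp (z / n.+1%:R) ^+ n.+1.
  by rewrite cexpX; congr cexp; rewrite -[RHS]mulr_natr divfK// pnatr_eq0.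
(* when [n] is small compared with [M] each term is bounded by [expR M] *)
have [small|big] := leP (2 * M) n.+1%:R.
- have h : cabs (z / n.+1%:R) <= 1 / 2.
    by rewrite zn ler_pdivrMr//; lra.
  have N1 : cabs (1 : R[i]) <= 1 by rewrite cabs1.
  have NM (x y : R[i]) : cabs (x * y) <= cabs x * cabs y by rewrite cabsM.
  have := norm_exprB n (@cabsD R) NM (@cabs_ge0 R) (cabs0 R) N1 uK vK.
  rewrite -zE => /le_trans; apply.
  have d : cabs (cexp (z / n.+1%:R) - (1 + z / n.+1%:R)) <= 8 * (M ^+ 2 / n.+1%:R ^+ 2).
    rewrite opprD addrA; apply: le_trans (cexp_sub1_le h) _.
    by rewrite zn exprMn exprVn ler_pM2l// ler_pM2r ?invr_gt0 ?exprn_gt0// lerXn2r ?nnegrE ?cabs_ge0.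
  apply: le_trans (_ : n.+1%:R * (8 * (M ^+ 2 / n.+1%:R ^+ 2)) * expR M <= _).
    by apply: ler_pM; rewrite ?mulr_ge0 ?cabs_ge0 ?exprn_ge0 ?expR_ge0 ?ler_wpM2l// KM.
  have -> : n.+1%:R * (8 * (M ^+ 2 / n.+1%:R ^+ 2)) * expR M = 8 * M ^+ 2 * expR M / n.+1%:R.
    by field; rewrite nat1r pnatr_eq0.
  rewrite ler_pM2r ?invr_gt0// -addrA lerDl.
  by rewrite addr_ge0// !mulr_ge0// ltW.
- apply: le_trans (cabsD _ _) _; rewrite cabsN zE /exp_approx !cabsX.
  have b1 : cabs (cexp (z / n.+1%:R)) ^+ n.+1 <= expR M.
    by apply: le_trans (KM n.+1 (leqnn _)); rewrite lerXn2r ?nnegrE ?cabs_ge0 ?expR_ge0.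
  have b2 : cabs (1 + z / n.+1%:R) ^+ n.+1 <= expR M.
    by apply: le_trans (KM n.+1 (leqnn _)); rewrite lerXn2r ?nnegrE ?cabs_ge0 ?expR_ge0.
  apply: le_trans (lerD b1 b2) _; rewrite ler_pdivlMr//.
  have : (expR M + expR M) * n.+1%:R <= (expR M + expR M) * (2 * M).
    by apply: ler_wpM2l; [lra|exact: ltW].
  have : 0 <= 8 * M ^+ 2 * expR M by rewrite !mulr_ge0 ?sqr_ge0// ltW.
  lra.
Qed.

(** With a remainder that is uniform on discs, this provides primitives for the
    powers of affine functions. *)
Lemma expr_expansion (rho : R) n : 0 <= rho -> exists2 C : R, 0 <= C &
  forall w w' : R[i], cabs w <= rho -> cabs w' <= rho ->
    cabs (w' ^+ n.+1 - w ^+ n.+1 - n.+1%:R * (w' - w) * w ^+ n) <= C * cabs (w' - w) ^+ 2.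
Proof.
move=> r0; elim: n => [|n [C C0 IH]].
  exists 0 => // w w' _ _; rewrite !expr1 expr0 mulr1 mul1r subrr cabs0.
  by rewrite mul0r.
exists (rho * C + n.+1%:R * rho ^+ n).
  by rewrite addr_ge0 ?mulr_ge0 ?exprn_ge0.
move=> w w' hw hw'.
have -> : w' ^+ n.+2 - w ^+ n.+2 - n.+2%:R * (w' - w) * w ^+ n.+1 =
   w' * (w' ^+ n.+1 - w ^+ n.+1 - n.+1%:R * (w' - w) * w ^+ n) +
   n.+1%:R * (w' - w) ^+ 2 * w ^+ n.
  by rewrite -(natr1 n.+1) !exprS; ring.
apply: le_trans (cabsD _ _) _; rewrite mulrDl; apply: lerD.
  rewrite cabsM -(mulrA rho); exact: (ler_pM (cabs_ge0 _) (cabs_ge0 _) hw' (IH _ _ hw hw')).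
rewrite (cabsM _ (w ^+ n)) (cabsM n.+1%:R) !cabsX mulrAC.
apply: ler_wpM2r; first by rewrite sqr_ge0.
have -> : cabs (n.+1%:R : R[i]) = n.+1%:R by rewrite -(rmorph_nat (real_complex R)) cabs_real ger0_norm.
by rewrite ler_wpM2l// lerXn2r ?nnegrE ?cabs_ge0.
Qed.

Lemma contour_affine_expr G (c : R[i]) n : c != 0 ->
  @ncvg R R[i]^o cabs (contour_sum G (fun z => (1 + z * c) ^+ n : R[i]^o)) 0.
Proof.
move=> c0; have n0 : n.+1%:R != 0 :> R[i] by rewrite pnatr_eq0.
apply: (@contour_primitive R G (fun z => (1 + z * c) ^+ n.+1 / (c * n.+1%:R))) => z _ e e0.
have cc := cabs_gt0 c0.
pose rho := cabs (1 + z * c) + cabs c.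
have r0 : 0 <= rho by rewrite addr_ge0 ?cabs_ge0.
have [C C0 H] := expr_expansion n r0.
pose d := Num.min 1 (e / (2 * (C * cabs c + 1))).
have D0 : 0 < C * cabs c + 1 by rewrite ltr_wpDl// mulr_ge0// ltW.
have d0 : 0 < d by rewrite lt_min ltr01 divr_gt0// mulr_gt0.
exists d => // w w' hw hw'.
have bnd v : cabs (v - z) < d -> cabs (1 + v * c) <= rho.
  rewrite lt_min => /andP[v1 _].
  have -> : 1 + v * c = (1 + z * c) + (v - z) * c by ring.
  apply: le_trans (cabsD _ _) _; by rewrite lerD2l cabsM; apply: ler_piMl; exact: ltW.
have := H _ _ (bnd _ hw) (bnd _ hw').
have -> : 1 + w' * c - (1 + w * c) = (w' - w) * c by ring.
set X := _ - _ - _ => hX.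
have -> : (1 + w' * c) ^+ n.+1 / (c * n.+1%:R) - (1 + w * c) ^+ n.+1 / (c * n.+1%:R) -
   (w' - w) * (1 + w * c) ^+ n = X / (c * n.+1%:R).
  rewrite /X; move: (1 + w' * c) (1 + w * c) => p q; move: (p ^+ n.+1) (q ^+ n.+1) (q ^+ n) n0 => p1 q1 q2.
  by move: (n.+1%:R : R[i]) => m m0; field; rewrite m0 c0.
have cn : cabs (n.+1%:R : R[i]) = n.+1%:R by rewrite -(rmorph_nat (real_complex R)) cabs_real ger0_norm.
rewrite cabsM cabsV cabsM cn ler_pdivrMr ?mulr_gt0//.
apply: le_trans hX _; rewrite cabsM.
have ww : cabs (w' - w) <= 2 * d.
  by have := cabsD (w' - z) (z - w); rewrite subrKA (cabsB z w); lra.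
have dC : 2 * d * (C * cabs c + 1) <= e.
  have : d <= e / (2 * (C * cabs c + 1)) by rewrite ge_min lexx orbT.
  by rewrite ler_pdivlMr ?mulr_gt0//; lra.
have n1 : 1 <= n.+1%:R :> R by rewrite ler1n.
have W0 := cabs_ge0 (w' - w); set W := cabs (w' - w) in ww W0 *.
rewrite exprMn; move: (cabs c) cc dC D0 => k k0 dC D0.
have q1 : C * k * W <= e.
  apply: le_trans dC; have : C * k * W <= C * k * (2 * d) by rewrite ler_wpM2l// mulr_ge0// ltW.
  lra.
have q2 : C * k * W * (W * k) <= e * (W * k).
  by rewrite ler_wpM2r// mulr_ge0// ltW.
have q3 : e * (W * k) * 1 <= e * (W * k) * n.+1%:R.
  by rewrite ler_wpM2l// !mulr_ge0// ltW.
move: q2 q3; rewrite expr2; lra.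
Qed.

End ScalarExponential.

Section FunctionalCalculus.
Variables (R : realType) (B : algType R[i]) (N : B -> R).
Hypothesis BN : banach_norm N.
Implicit Types (x y a b : B) (z w : R[i]).

Let VN : vnorm N := banach_vnorm BN.
Let NM := banach_normM BN.
Let N0 x : 0 <= N x := vnorm_ge0 VN x.

(** On the cycle the resolvent is bounded, so uniform approximations of [f] give
    integrals that are close at all finer subdivisions at once, and the two
    limits can be exchanged. This computes the Cauchy integral of [f] at [a]
    from the values at [a] of simpler functions, and the answer does not mention
    the cycle. *)
Lemma contour_approx a G (f : R[i] -> R[i]) (fN : nat -> R[i] -> R[i]) (x : nat -> B) (C : R) :
  (forall z, cycle_support G z -> ~ spectrum a z) -> 0 <= C ->
  (forall n z, cycle_support G z -> cabs (f z - fN n z) <= C / n.+1%:R) ->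
  (forall n, ncvg N (contour_sum G (fun z => fN n z *: resolvent a z)) (two_pi_i R *: x n)) ->
  (exists l, ncvg N x l) /\
  (forall l, ncvg N x l ->
     ncvg N (contour_sum G (fun z => (f z / two_pi_i R) *: resolvent a z)) l).
Proof.
move=> Ga C0 hf hx; have [M M0 hM] := res_bounded BN Ga.
have p0 := two_pi_i_neq0 R; have cp := cabs_gt0 p0.
pose D := cycle_length G * (C * M).
have D0 : 0 <= D by rewrite !mulr_ge0 ?cycle_length_ge0// ltW.
have est n j : N (contour_sum G (fun z => f z *: resolvent a z) j -
    contour_sum G (fun z => fN n z *: resolvent a z) j) <= D / n.+1%:R.
  rewrite -contour_sumB.
  have -> : D / n.+1%:R = cycle_length G * (C / n.+1%:R * M) by rewrite /D; ring.
  apply: (vnorm_contour_sum VN); first by rewrite !mulr_ge0 ?invr_ge0// ltW.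
  move=> z zG; rewrite -scalerBl (vnormZ VN); apply: ler_pM => //.
  - exact: cabs_ge0.
  - exact: hf.
  - exact: hM.
split.
- apply: (complete_rate BN (b := fun n => D / cabs (two_pi_i R) / n.+1%:R)); last exact: inv_nat_small.
  move=> n m.
  have : N (two_pi_i R *: x n - two_pi_i R *: x m) <= D / n.+1%:R + D / m.+1%:R.
    apply: (ncvg_dist_le VN (hx n) (hx m)); apply: nearW => j.
    apply: le_trans (vnorm_triangle VN (contour_sum G (fun z => f z *: resolvent a z) j) _ _) _.
    by apply: lerD; [rewrite (vnorm_distC VN)|].
  rewrite -scalerBr (vnormZ VN) -ler_pdivlMl// => /le_trans; apply.
  by rewrite le_eqVlt; apply/orP; left; apply/eqP; ring.
- move=> l xl; rewrite -[l](scalerK p0).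
  apply: (eq_ncvg (u := fun j => (two_pi_i R)^-1 *: contour_sum G (fun z => f z *: resolvent a z) j)).
    move=> j; rewrite -contour_sumZ; apply: eq_contour_sum => z _.
    by rewrite scalerA mulrC.
  apply: (ncvgZ VN) => e e0; have e30 : 0 < e / 3 by rewrite divr_gt0.
  have s1 : \forall n \near \oo, D / n.+1%:R <= e / 3 by exact: inv_nat_small.
  have s2 : \forall n \near \oo, N (two_pi_i R *: x n - two_pi_i R *: l) <= e / 3 by exact: (ncvgZ VN).
  near \oo => n.
  have t1 : D / n.+1%:R <= e / 3 by near: n.
  have t2 : N (two_pi_i R *: x n - two_pi_i R *: l) <= e / 3 by near: n.
  have s3 := hx n _ e30; move: s3; apply: filterS => j t3.
  apply: le_trans (vnorm_triangle VN (two_pi_i R *: x n) _ _) _.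
  have := vnorm_triangle VN (contour_sum G (fun z => fN n z *: resolvent a z) j)
    (contour_sum G (fun z => f z *: resolvent a z) j) (two_pi_i R *: x n).
  have t0 := le_trans (est n j) t1; lra.
Unshelve. all: by end_near. Qed.

Definition alg_exp_approx n x : B := (1 + n.+1%:R^-1 *: x) ^+ n.+1.
Definition alg_exp x : B := xget 0 [set l | ncvg N (fun n => alg_exp_approx n x) l].

Section Exponential.
Variables (a : B) (G : seq (seq R[i])).
Hypothesis Gspec : forall z, cycle_support G z -> ~ spectrum a z.
Hypothesis Gwind : forall w, spectrum a w -> winding G w 1.

(** By induction on [n]: [(1 + z c) R(z) = (1 + c a) R(z) + c] for the resolvent
    [R], and the polynomial term integrates to 0 along a cycle. *)
Lemma contour_affine_power (c : R[i]) n : c != 0 ->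
  ncvg N (contour_sum G (fun z => (1 + z * c) ^+ n *: resolvent a z))
    (two_pi_i R *: (1 + c *: a) ^+ n).
Proof.
move=> c0; elim: n => [|n IH].
  have := contour_resolvent BN Gspec Gwind; rewrite mulr1 expr0; apply: eq_ncvg => j.
  by apply: eq_contour_sum => z _; rewrite expr0 scale1r.
have h2 := ncvg_scalar BN (c *: 1) (contour_affine_expr G n c0); rewrite scale0r in h2.
have := ncvgD VN (ncvgMl BN (1 + c *: a) IH) h2.
rewrite addr0 -scalerAr -exprS; apply: eq_ncvg => j.
rewrite -contour_sumMl -contour_sum_scalar -contour_sumD; apply: eq_contour_sum => z zG.
have rz := spectrumN (Gspec zG).
have E : (1 + z * c) *: resolvent a z = (1 + c *: a) * resolvent a z + c *: 1.
  rewrite -[X in _ = _ + c *: X](res_mulr rz) mulrBl scalerBr -!scalerAl mulrDl !mul1r.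
  by rewrite -scalerAl scalerA addrA addrAC addrK (mulrC z) scalerDl scale1r.
by rewrite exprSr -scalerA E scalerDr scalerAr.
Qed.

Lemma contour_exp :
  (exists l, ncvg N (fun n => alg_exp_approx n a) l) /\
  (forall l, ncvg N (fun n => alg_exp_approx n a) l ->
     ncvg N (contour_sum G (fun z => (cexp z / two_pi_i R) *: resolvent a z)) l).
Proof.
have [M M0 hM] := support_bounded G.
have [C C0 hC] := cexp_approx_rate (ltW M0).
apply: (@contour_approx a G (@cexp R) (@exp_approx R) _ C) => //.
- exact: ltW.
- by move=> n z /hM; exact: hC.
- by move=> n; apply: contour_affine_power; rewrite invr_eq0 pnatr_eq0.
Qed.

End Exponential.

Definition big_square a : seq (seq R[i]) := square 0 (2 * N a * N 1 + 1).

Lemma big_square_winding a w : spectrum a w ->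
  ~ cycle_support (big_square a) w /\ winding (big_square a) w 1.
Proof.
move=> /(spectrum_bounded BN) h; apply: square_inside.
- by rewrite ltr_wpDl// !mulr_ge0.
- by rewrite subr0; apply: le_lt_trans (cabs_ge_Re w) _; lra.
- by rewrite subr0; apply: le_lt_trans (cabs_ge_Im w) _; lra.
Qed.

Lemma big_square_spectrum a z : cycle_support (big_square a) z -> ~ spectrum a z.
Proof. by move=> zG /big_square_winding[]. Qed.

(** Convergence is read off the Cauchy integral along a large square. *)
Lemma alg_expP a : ncvg N (fun n => alg_exp_approx n a) (alg_exp a).
Proof.
have [h _] := contour_exp (@big_square_spectrum a) (fun w h => (big_square_winding h).2).
exact: (xgetPex 0 h).
Qed.

Lemma ncvgM (u v : nat -> B) l k :
  ncvg N u l -> ncvg N v k -> ncvg N (fun n => u n * v n) (l * k).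
Proof.
move=> ul vk.
have small : ncvg N (fun n => (u n - l) * (v n - k)) 0.
  move=> e e0; near=> n; rewrite subr0; apply: le_trans (NM _ _) _.
  rewrite -[e]mul1r; apply: ler_pM => //; near: n; [exact: ul|exact: vk].
have := ncvgB VN (ncvgD VN small (ncvgD VN (ncvgMl BN l vk) (ncvgMr BN k ul))) (ncvg_cst VN (l * k)).
rewrite add0r addrK; apply: eq_ncvg => n.
have E (p q r s : B) : p - q - (r - s) + (r + q) - s = p.
  by rewrite opprB -(addrA (p - q)) subrKA (addrC s) subrKA addrK.
by rewrite mulrBl !mulrBr E.
Unshelve. all: by end_near. Qed.

(** For commuting [x] and [y] the product [(1 + x / n) * (1 + y / n)] differs from
    [1 + (x + y) / n] by [x y / n ^ 2]; their powers with exponent [n] then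
    differ by [O(1 / n)]. As the unit has norm 1, such powers are bounded by
    [expR (N x + N y)]. *)
Lemma alg_expD x y : N 1 = 1 -> x * y = y * x -> alg_exp (x + y) = alg_exp x * alg_exp y.
Proof.
move=> N1 xy; apply/esym/(ncvg_unique VN (ncvgM (alg_expP x) (alg_expP y))).
pose C := N (x * y) * expR (N x + N y).
have close n : N (alg_exp_approx n x * alg_exp_approx n y - alg_exp_approx n (x + y)) <= C / n.+1%:R.
  pose c : R[i] := n.+1%:R^-1.
  have cc : cabs c = n.+1%:R^-1 by exact: cabs_invn.
  have n0 : 0 < n.+1%:R :> R by rewrite ltr0n.
  pose u := (1 + c *: x) * (1 + c *: y); pose v := 1 + c *: (x + y).
  have uE : alg_exp_approx n x * alg_exp_approx n y = u ^+ n.+1.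
    rewrite /u exprMn_comm//; apply: commrD; first exact: commr1.
    apply: commr_sym; apply: commrD; first exact: commr1.
    by rewrite /GRing.comm -!scalerAl -!scalerAr xy.
  have uv : u - v = c ^+ 2 *: (x * y).
    have -> : u = v + c ^+ 2 *: (x * y).
      rewrite /u /v mulrDl !mulrDr !mul1r !mulr1 -scalerAl -scalerAr scalerA -expr2 scalerDr.
      by rewrite -!addrA; congr (1 + _); rewrite addrCA.
    by rewrite addrAC subrr add0r.
  have aff (w : B) : N (1 + c *: w) <= 1 + N w / n.+1%:R.
    by apply: le_trans (vnormD VN _ _) _; rewrite N1 (vnormZ VN) cc mulrC.
  pose K := (1 + N x / n.+1%:R) * (1 + N y / n.+1%:R).
  have x0 : 0 <= N x / n.+1%:R by rewrite divr_ge0.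
  have y0 : 0 <= N y / n.+1%:R by rewrite divr_ge0.
  have uK : N u <= K by apply: le_trans (NM _ _) _; exact: ler_pM.
  have vK : N v <= K.
    apply: le_trans (aff _) _; apply: le_trans (_ : 1 + (N x + N y) / n.+1%:R <= _).
      by rewrite lerD2l ler_pM2r ?invr_gt0//; exact: vnormD.
    rewrite /K mulrDl; move: (N x / _) (N y / _) x0 y0 => p q p0 q0.
    by have := mulr_ge0 p0 q0; lra.
  have K1 : 1 <= K.
    rewrite /K; move: (N x / _) (N y / _) x0 y0 => p q p0 q0.
    by have := mulr_ge0 p0 q0; lra.
  have Kn : K ^+ n <= expR (N x + N y).
    apply: le_trans (_ : K ^+ n.+1 <= _); first by rewrite ler_weXn2l.
    rewrite /K exprMn expRD; apply: ler_pM; rewrite ?exprn_ge0 ?addr_ge0//.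
      exact: one_plus_expR_le.
    exact: one_plus_expR_le.
  have N11 : N 1 <= 1 by rewrite N1.
  have := norm_exprB n (vnormD VN) NM N0 (vnorm0 VN) N11 uK vK.
  rewrite uE => /le_trans; apply.
  rewrite uv (vnormZ VN) cabsX cc.
  have -> : C / n.+1%:R = n.+1%:R * (n.+1%:R^-1 ^+ 2 * N (x * y)) * expR (N x + N y).
    by rewrite /C; field; rewrite nat1r pnatr_eq0.
  by rewrite ler_wpM2l// !mulr_ge0// exprn_ge0// invr_ge0.
have z0 := ncvg_inv_nat (u := fun n => alg_exp_approx n x * alg_exp_approx n y - alg_exp_approx n (x + y)) (l := 0).
have {}z0 : ncvg N (fun n => alg_exp_approx n x * alg_exp_approx n y - alg_exp_approx n (x + y)) 0.
  by apply: (z0 N C) => n; rewrite subr0.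
have := ncvgD VN z0 (alg_expP (x + y)); rewrite add0r; apply: eq_ncvg => n.
by rewrite subrK.
Qed.

End FunctionalCalculus.

(** * The logarithm of elements with positive spectrum *)

Section ScalarLogarithm.
Variable R : realType.
Implicit Types z : R[i].

Definition log_approx n z : R[i] :=
  rsum (fun t => (z - 1) * (1 + t%:C * (z - 1))^-1 : R[i]^o) n.

(** [clog (1 + t (z - 1))] is a primitive of the integrand, since the segment
    from 1 to [z] stays in the slit plane. *)
Lemma log_approx_cvg z : slit z ->
  @ncvg R R[i]^o cabs (fun n => log_approx n z : R[i]^o) (clog z).
Proof.
move=> sz.
have := @segment_primitive R (fun w => clog (1 + w * (z - 1)))
  (fun w => (z - 1) / (1 + w * (z - 1))) 0 1.
have -> : 1 + 1 * (z - 1) = z by ring.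
have -> : 1 + 0 * (z - 1) = 1 by ring.
rewrite clog1 (subr0 (clog z)).
have pt (t : R) : segment_point (0, 1) t = t%:C :> R[i].
  by rewrite /segment_point subr0 mulr1 add0r.
move=> H; apply: eq_ncvg (H _) => [n|t t01].
  by apply: eq_rsum => t t01; rewrite pt subr0 scale1r.
apply: (@sdiffc_clog_comp R (fun w => 1 + w * (z - 1)) (fun=> z - 1)); last exact: sdiffc_affine.
by rewrite pt; exact: slit_star.
Qed.

Lemma slit_segment_low G : (forall z, cycle_support G z -> slit z) ->
  exists2 d : R, 0 < d & forall z t, cycle_support G z -> 0 <= t <= 1 ->
    d <= cabs (1 + t%:C * (z - 1)).
Proof.
move=> H.
have [||d d0 dP] := @uniform_scale_support R G
    (fun d z => forall t, 0 <= t <= 1 -> d <= cabs (1 + t%:C * (z - 1))).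
- by move=> d d' z dd h t t01; apply: le_trans dd (h t t01).
- move=> z zG; have [||d d0 dP] := @uniform_scale01 R (fun d t => d <= cabs (1 + t%:C * (z - 1))).
  + by move=> d d' t dd; exact: le_trans.
  + move=> t t01; have c0 := cabs_gt0 (slit_neq0 (slit_star (H z zG) t01)).
    set c := cabs _ in c0; have k0 : 0 < cabs (z - 1) + 1 by rewrite ltr_wpDl// cabs_ge0.
    exists (Num.min (c / 2) (c / (2 * (cabs (z - 1) + 1)))).
      by rewrite lt_min !divr_gt0// mulr_gt0.
    move=> s s01; rewrite lt_min => /andP[_]; rewrite ltr_pdivlMr ?mulr_gt0// => st.
    rewrite ge_min; apply/orP; left.
    have := cabsD ((t - s)%:C * (z - 1)) (1 + s%:C * (z - 1)).
    have -> : (t - s)%:C * (z - 1) + (1 + s%:C * (z - 1)) = 1 + t%:C * (z - 1).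
      by rewrite rmorphB; ring.
    rewrite -/c cabsM cabs_real distrC; have := normr_ge0 (s - t); lra.
  + exists (d / 2); first by rewrite divr_gt0.
    move=> w wz t t01; have := dP t t01.
    have := cabsD (t%:C * (z - w)) (1 + t%:C * (w - 1)).
    have -> : t%:C * (z - w) + (1 + t%:C * (w - 1)) = 1 + t%:C * (z - 1) by ring.
    rewrite cabsM cabs_real cabsB; have := cabs_ge0 (w - z).
    move: t01 => /andP[t0 t1]; rewrite ger0_norm//; nra.
by exists d => // z t zG; exact: dP.
Qed.

Lemma log_approx_rate G : (forall z, cycle_support G z -> slit z) ->
  exists2 C : R, 0 <= C & forall n z, cycle_support G z ->
    cabs (clog z - log_approx n z) <= C / n.+1%:R.
Proof.
move=> H; have [d d0 low] := slit_segment_low H; have [M M0 hM] := support_bounded G.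
have C0 : 0 <= (M + 1) ^+ 2 / d ^+ 2 by rewrite divr_ge0 ?sqr_ge0.
exists ((M + 1) ^+ 2 / d ^+ 2) => // n z zG; rewrite cabsB.
have sz := H z zG; apply: (rsum_rate (vnorm_cabs R) n C0 _ (log_approx_cvg sz)) => s t s01 t01.
have ls := low z s zG s01; have lt := low z t zG t01.
have n1 : 1 + s%:C * (z - 1) != 0 by apply: cabs_neq0; lra.
have n2 : 1 + t%:C * (z - 1) != 0 by apply: cabs_neq0; lra.
have -> : (z - 1) / (1 + s%:C * (z - 1)) - (z - 1) / (1 + t%:C * (z - 1)) =
  (t - s)%:C * ((z - 1) * (z - 1)) * ((1 + s%:C * (z - 1))^-1 * (1 + t%:C * (z - 1))^-1).
  by rewrite rmorphB; field; rewrite n1 n2.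
have zM : cabs (z - 1) <= M + 1.
  by apply: le_trans (cabsD _ _) _; rewrite cabsN cabs1 lerD2r hM.
have inv v : d <= v -> v^-1 <= d^-1 by move=> dv; rewrite lef_pV2 ?posrE//; lra.
have h1 : cabs ((z - 1) * (z - 1)) <= (M + 1) ^+ 2.
  by rewrite cabsM expr2; apply: ler_pM; rewrite ?cabs_ge0.
have h2 : cabs ((1 + s%:C * (z - 1))^-1 * (1 + t%:C * (z - 1))^-1) <= d ^- 2.
  rewrite cabsM !cabsV -exprVn expr2; apply: ler_pM; rewrite ?invr_ge0 ?cabs_ge0 ?inv//.
move: ((z - 1) * (z - 1)) (_^-1 * _^-1) h1 h2 => p q h1 h2.
rewrite !cabsM cabs_real distrC [leRHS]mulrC -mulrA ler_wpM2l//.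
by apply: ler_pM; rewrite ?cabs_ge0.
Qed.

End ScalarLogarithm.

Section Logarithm.
Variables (R : realType) (B : algType R[i]) (N : B -> R).
Hypothesis BN : banach_norm N.
Implicit Types (x y a : B) (z w : R[i]) (s t : R).

Let VN : vnorm N := banach_vnorm BN.
Let NM := banach_normM BN.
Let N0 x : 0 <= N x := vnorm_ge0 VN x.

Definition jinv t x : B := binv (unit_segment t x).
Definition log_integrand t x : B := (x - 1) * jinv t x.
Definition alg_log x : B := xget 0 [set l | ncvg N (rsum (log_integrand^~ x)) l].

Lemma binvB (u v : B) : invertible u -> invertible v ->
  binv u - binv v = binv u * (v - u) * binv v.
Proof. by move=> hu hv; rewrite mulrBr mulrBl -mulrA mulrbV// mulVbr// mulr1 mul1r. Qed.

Lemma unit_segmentB t t' x : unit_segment t x - unit_segment t' x = (t - t')%:C *: (x - 1).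
Proof. by rewrite /unit_segment opprD addrACA subrr add0r -scalerBl rmorphB. Qed.

Lemma unit_segmentBr t x y : unit_segment t x - unit_segment t y = t%:C *: (x - y).
Proof.
by rewrite /unit_segment opprD addrACA subrr add0r -scalerBr opprB addrA subrK.
Qed.

Lemma unit_segment_commute t c x : c * x = x * c -> c * unit_segment t x = unit_segment t x * c.
Proof.
by move=> cx; rewrite /unit_segment mulrDr mulrDl mulr1 mul1r -scalerAr -scalerAl mulrBr mulrBl cx mulr1 mul1r.
Qed.

Lemma jinv_commute t c x : invertible (unit_segment t x) -> c * x = x * c ->
  c * jinv t x = jinv t x * c.
Proof. by move=> ix cx; apply: binv_comm => //; exact: unit_segment_commute. Qed.

(** The parameter [s] is for paths of elements, along which the logarithm is
    differentiated; the bound comes from compactness in [t] and [s]. *)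
Lemma jinv_bounded (p q : B) :
  (forall t s, 0 <= t <= 1 -> 0 <= s <= 1 -> invertible (unit_segment t (p + s%:C *: q))) ->
  exists2 C : R, 0 < C & forall t s, 0 <= t <= 1 -> 0 <= s <= 1 ->
    N (jinv t (p + s%:C *: q)) <= C.
Proof.
move=> H.
have [||d d0 dP] := @uniform_scale01_2 R (fun d t s => d * N (jinv t (p + s%:C *: q)) <= 1).
- by move=> d d' t s dd; apply: le_trans; rewrite ler_wpM2r.
- move=> t s t01 s01; have iy := binvP (H t s t01 s01); set y := binv _ in iy.
  pose K := N y * (N (p + s%:C *: q - 1) + N q) + N y + 1.
  have K0 : 0 < K by rewrite ltr_wpDl// addr_ge0// mulr_ge0// addr_ge0.
  exists (2 * K)^-1; first by rewrite invr_gt0 mulr_gt0.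
  move=> t' s' t'01 s'01 ht hs.
  pose e := (t - t')%:C *: (p + s%:C *: q - 1) + t'%:C *: ((s - s')%:C *: q).
  have Ne : N e <= (2 * K)^-1 * (N (p + s%:C *: q - 1) + N q).
    apply: le_trans (vnormD VN _ _) _; rewrite !(vnormZ VN) !cabs_real mulrDr.
    apply: lerD; first by rewrite ler_wpM2r// distrC ltW.
    move: t'01 => /andP[t0 t1]; rewrite (ger0_norm t0).
    apply: le_trans (_ : 1 * (`|s - s'| * N q) <= _).
      by rewrite ler_wpM2r// mulr_ge0.
    by rewrite mul1r ler_wpM2r// distrC ltW.
  have [|y' [iy' ny']] := inverse_near BN (d := e) iy.
    have Nn : 0 <= N (p + s%:C *: q - 1) + N q by rewrite addr_ge0.
    apply: le_trans (ler_wpM2l (N0 y) Ne) _.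
    rewrite mulrCA mulrC ler_pdivrMr ?mulr_gt0// /K.
    have := N0 y; lra.
  have E : unit_segment t (p + s%:C *: q) - e = unit_segment t' (p + s'%:C *: q).
    apply/eqP; rewrite subr_eq; apply/eqP.
    rewrite /e /unit_segment rmorphB scalerBl.
    have -> : t'%:C *: ((s - s')%:C *: q) =
        t'%:C *: (p + s%:C *: q - 1) - t'%:C *: (p + s'%:C *: q - 1).
      rewrite -scalerBr; congr (_ *: _).
      by rewrite opprB addrA subrK opprD addrACA subrr add0r -scalerBl rmorphB.
    rewrite subrKA -[RHS]addrA; congr (1 + _).
    by rewrite [RHS]addrC subrK.
  rewrite E in iy'; rewrite /jinv (binv_eq iy') mulrC ler_pdivrMr ?mulr_gt0// mul1r.
  apply: le_trans ny' _; rewrite ler_pM2l// /K.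
  have : 0 <= N y * (N (p + s%:C *: q - 1) + N q) by rewrite mulr_ge0// addr_ge0.
  lra.
exists d^-1; first by rewrite invr_gt0.
by move=> t s t01 s01; have := dP t s t01 s01; rewrite mulrC -ler_pdivlMr// mul1r.
Qed.

Lemma jinv_bounded1 x : pos_spectrum x ->
  exists2 C : R, 0 < C & forall t, 0 <= t <= 1 -> N (jinv t x) <= C.
Proof.
move=> px; have [|C C0 H] := @jinv_bounded x 0.
  by move=> t s t01 _; rewrite scaler0 addr0; exact: unit_segment_inv.
exists C => // t t01; have := H t 0 t01; rewrite scaler0 addr0; apply.
by rewrite lexx ler01.
Qed.

Lemma log_integrand_lip x : pos_spectrum x -> exists2 C : R, 0 <= C &
  forall s t, 0 <= s <= 1 -> 0 <= t <= 1 ->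
    N (log_integrand s x - log_integrand t x) <= C * `|s - t|.
Proof.
move=> px; have [C C0 H] := jinv_bounded1 px.
exists (N (x - 1) * (C * N (x - 1) * C)); first by rewrite !mulr_ge0// ltW.
move=> s t s01 t01; rewrite /log_integrand -mulrBr.
have is_ := unit_segment_inv px s01; have it := unit_segment_inv px t01.
rewrite /jinv binvB// unit_segmentB -scalerAr -scalerAl -scalerAr (vnormZ VN) cabs_real distrC mulrC.
apply: ler_wpM2r => //; apply: le_trans (NM _ _) _; rewrite ler_wpM2l//.
apply: le_trans (NM _ _) _; apply: ler_pM => //; last exact: H.
apply: le_trans (NM _ _) _; apply: ler_pM => //; exact: H.
Qed.

Lemma alg_logP x : pos_spectrum x -> ncvg N (rsum (log_integrand^~ x)) (alg_log x).
Proof.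
move=> px; have [C C0 H] := log_integrand_lip px.
apply: (xgetPex 0 (P := [set l | ncvg N _ l])).
apply: (complete_rate BN (b := fun n => C / n.+1%:R)); last exact: inv_nat_small.
by move=> n m; exact: rsum_dist.
Qed.

Lemma alg_log_commute c x : pos_spectrum x -> c * x = x * c -> c * alg_log x = alg_log x * c.
Proof.
move=> px cx; apply: (ncvg_commute BN _ (alg_logP px)) => n.
rewrite /rsum mulr_sumr mulr_suml; apply: eq_bigr => k _.
rewrite -scalerAr -scalerAl; congr (_ *: _); rewrite /log_integrand mulrA.
rewrite mulrBr mulr1 cx -{2}[c]mul1r -mulrBl -!mulrA; congr (_ * _).
by apply: jinv_commute => //; apply: unit_segment_inv => //; exact: ord_grid01.
Qed.

Section Contour.
Variables (a : B) (G : seq (seq R[i])).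
Hypothesis apos : pos_spectrum a.
Hypothesis Gspec : forall z, cycle_support G z -> ~ spectrum a z.
Hypothesis Gwind : forall w, spectrum a w -> winding G w 1.
Hypothesis Gslit : forall z, cycle_support G z -> slit z.
Hypothesis Gwind0 : forall r : R, r <= 0 -> winding G r%:C 0.

(** The pole [1 - t^-1] of the kernel lies on the half-line of nonpositive reals,
    around which the cycle does not wind. *)
Lemma winding_log_kernel t : 0 <= t <= 1 ->
  @ncvg R R[i]^o cabs (contour_sum G (fun z => (1 + t%:C * (z - 1))^-1 : R[i]^o)) 0.
Proof.
move=> /andP[t0 t1]; have [->|tn] := eqVneq t 0.
  apply: (@contour_primitive R G (fun z => 0 + z * 1)) => z _.
  have -> : (fun z => (1 + 0%:C * (z - 1))^-1) = (fun=> 1 : R[i]).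
    by apply/funext => w; rewrite mul0r addr0 invr1.
  exact: sdiffc_affine.
have tp : 0 < t by rewrite lt_def tn.
have tc : t%:C != 0 :> R[i] by rewrite -[0]/(0%:C) (inj_eq (@complexI _)).
have r0 : 1 - t^-1 <= 0 by rewrite subr_le0 invf_ge1.
have := ncvgZ (vnorm_cabs R) (t%:C)^-1 (Gwind0 r0); rewrite mulr0 scaler0.
apply: eq_ncvg => n; rewrite -contour_sumZ; congr contour_sum; apply/funext => z.
rewrite /GRing.scale /= -invfM; congr (_^-1).
by rewrite rmorphB fmorphV /= mulrBr mulrBr divff// mulrBr; ring.
Qed.

(** Partial fractions: the integrand is [log_integrand t a] times the resolvent,
    plus [jinv t a] times the scalar kernel, which integrates to 0. *)
Lemma contour_log_kernel t : 0 <= t <= 1 ->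
  ncvg N (contour_sum G (fun z => ((z - 1) / (1 + t%:C * (z - 1))) *: resolvent a z))
    (two_pi_i R *: log_integrand t a).
Proof.
move=> t01; have ia := unit_segment_inv apos t01.
have h1 := ncvg_scalar BN (jinv t a) (winding_log_kernel t01); rewrite scale0r in h1.
have h2 := ncvgMl BN (log_integrand t a) (contour_resolvent BN Gspec Gwind).
have := ncvgD VN h2 h1; rewrite addr0 mulr1 -scalerAr mulr1; apply: eq_ncvg => n.
rewrite -contour_sumMl -contour_sum_scalar -contour_sumD; apply: eq_contour_sum => z zG.
have rz := spectrumN (Gspec zG).
set p := 1 + t%:C * (z - 1); set X := unit_segment t a.
have p0 : p != 0 by apply: slit_neq0; exact: slit_star (Gslit zG) t01.
have E1 : (z - 1) *: X = (z%:A - a) + p *: (a - 1).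
  rewrite /X /unit_segment /p scalerDr scalerA (mulrC (z - 1)) scalerDl scale1r addrA.
  by rewrite scalerBl scale1r subrKA.
have E2 : (z - 1) *: resolvent a z = jinv t a + p *: (log_integrand t a * resolvent a z).
  have -> : (z - 1) *: resolvent a z = (z - 1) *: X * jinv t a * resolvent a z.
    by rewrite -!scalerAl mulrbV// mul1r.
  rewrite E1 mulrDl mulrDl -!scalerAl; congr (_ + _).
  have -> : (z%:A - a) * jinv t a = jinv t a * (z%:A - a).
    apply: jinv_commute => //; by rewrite mulrBl mulrBr -scalerAl -scalerAr mul1r mulr1.
  by rewrite -mulrA res_mulr// mulr1.
by rewrite mulrC -scalerA E2 scalerDr scalerA mulVf// scale1r addrC.
Qed.

Lemma contour_log : ncvg N
  (contour_sum G (fun z => (clog z / two_pi_i R) *: resolvent a z)) (alg_log a).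
Proof.
have [C C0 hC] := log_approx_rate Gslit.
have approx n : ncvg N (contour_sum G (fun z => log_approx n z *: resolvent a z))
    (two_pi_i R *: rsum (log_integrand^~ a) n).
  rewrite /rsum scaler_sumr.
  apply: (eq_ncvg (u := fun j => \sum_(k < n.+1) contour_sum G (fun z => (n.+1%:R^-1 : R[i]) *:
      (((z - 1) / (1 + (k%:R / n.+1%:R)%:C * (z - 1))) *: resolvent a z)) j)).
    move=> j; rewrite -contour_sum_sum; apply: eq_contour_sum => z zG.
    by rewrite /log_approx /rsum scaler_suml; apply: eq_bigr => k _; rewrite scalerA.
  apply: (ncvg_sum VN) => k; rewrite scalerA (mulrC (two_pi_i R)) -scalerA.
  apply: eq_ncvg (ncvgZ VN n.+1%:R^-1 (contour_log_kernel (ord_grid01 R k))) => j.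
  by rewrite contour_sumZ.
have [_] := contour_approx BN Gspec C0 hC approx.
by apply; exact: alg_logP.
Qed.

End Contour.

(** The derivative of the logarithm at [x], along elements commuting with [x], is
    the inverse of [x]: the difference of the integrands is
    [(y - x) * jinv t x * jinv t y], and the integral of [jinv t x] squared is
    the inverse of [x]. *)
Lemma alg_log_expansion x y (C : R) : x * y = y * x -> pos_spectrum x -> pos_spectrum y ->
  (forall t, 0 <= t <= 1 -> N (jinv t x) <= C) ->
  (forall t, 0 <= t <= 1 -> N (jinv t y) <= C) ->
  N (alg_log y - alg_log x - (y - x) * binv x) <= N (y - x) ^+ 2 * C ^+ 3.
Proof.
move=> xy px py hx hy.
have ix t (t01 : 0 <= t <= 1) := unit_segment_inv px t01.
have iy t (t01 : 0 <= t <= 1) := unit_segment_inv py t01.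
have C0 : 0 <= C by apply: le_trans (N0 _) (hx 0 _); rewrite lexx ler01.
have dx t : 0 <= t <= 1 -> (y - x) * jinv t x = jinv t x * (y - x).
  by move=> t01; apply: jinv_commute; [exact: ix|rewrite mulrBl mulrBr xy].
have dy t : 0 <= t <= 1 -> (y - x) * jinv t y = jinv t y * (y - x).
  by move=> t01; apply: jinv_commute; [exact: iy|rewrite mulrBl mulrBr xy].
(* [t *: jinv t x] is a primitive of the square of [jinv t x] *)
have hinv : ncvg N (rsum (fun t => jinv t x * jinv t x)) (binv x).
  have -> : binv x = 1%:C *: jinv 1 x - 0%:C *: jinv 0 x.
    by rewrite scale0r subr0 scale1r /jinv /unit_segment scale1r addrC subrK.
  apply: (rsum_derivative VN (u := fun t => t%:C *: jinv t x)) => t e t01 e0.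
  pose K := C * N (x - 1) * C * C + 1.
  have K0 : 0 < K by rewrite ltr_wpDl// !mulr_ge0.
  exists (e / (2 * K)); first by rewrite divr_gt0// mulr_gt0.
  move=> s s' s01 s'01 st s't.
  have ss : `|s' - s| * K <= e.
    have : `|s' - s| < e / (2 * K) + e / (2 * K).
      by have := ler_distD t s' s; rewrite (distrC t s); lra.
    have -> : e / (2 * K) + e / (2 * K) = e / K by field; rewrite gt_eqF.
    by rewrite ltr_pdivlMr// => /ltW.
  have E : s'%:C *: jinv s' x - s%:C *: jinv s x = (s' - s)%:C *: (jinv s' x * jinv s x).
    have -> : s'%:C *: jinv s' x - s%:C *: jinv s x =
        jinv s' x * (s'%:C *: unit_segment s x - s%:C *: unit_segment s' x) * jinv s x.
      rewrite mulrBr mulrBl -!scalerAr -!scalerAl /jinv mulVbr ?mul1r; last exact: ix.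
      by rewrite -mulrA mulrbV ?mulr1//; exact: ix.
    have -> : s'%:C *: unit_segment s x - s%:C *: unit_segment s' x = (s' - s)%:C *: 1.
      rewrite /unit_segment !scalerDr !scalerA (mulrC s%:C) opprD addrACA subrr addr0.
      by rewrite -scalerBl rmorphB.
    by rewrite -scalerAr mulr1 -scalerAl.
  rewrite E -scalerBr -mulrBl /jinv binvB; [|exact: ix|exact: ix].
  rewrite unit_segmentB (vnormZ VN) cabs_real mulrC; apply: ler_wpM2r => //.
  apply: le_trans ss; rewrite -scalerAr -scalerAl -scalerAl (vnormZ VN) cabs_real distrC.
  apply: ler_wpM2l => //.
  apply: le_trans (NM _ _) _; apply: le_trans (_ : C * N (x - 1) * C * C <= _); last by rewrite /K lerDl.
  apply: ler_pM => //; last exact: hx.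
  apply: le_trans (NM _ _) _; apply: ler_pM => //; last exact: hx.
  by apply: le_trans (NM _ _) _; apply: ler_pM => //; exact: hx.
apply: (ncvg_dist_le VN (ncvgB VN (alg_logP py) (alg_logP px)) (ncvgMl BN (y - x) hinv)).
apply: nearW => n.
have -> : (y - x) * rsum (fun t => jinv t x * jinv t x) n =
    rsum (fun t => (y - x) * (jinv t x * jinv t x)) n.
  by rewrite /rsum mulr_sumr; apply: eq_bigr => k _; rewrite [RHS]scalerAr.
rewrite -!rsumB; apply: (vnorm_rsum VN) => t t01.
have E : log_integrand t y - log_integrand t x = jinv t y * (y - x) * jinv t x.
  have -> : y - x = (y - 1) * unit_segment t x - unit_segment t y * (x - 1).
    rewrite /unit_segment (mulrDr (y - 1)) (mulrDl 1) mulr1 mul1r -scalerAr -scalerAl opprD addrACA.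
    by rewrite subrr addr0 opprB addrA subrK.
  have yy : (y - 1) * jinv t y = jinv t y * (y - 1).
    by apply: jinv_commute; [exact: iy|rewrite mulrBl mulrBr mul1r mulr1].
  rewrite mulrBr mulrBl mulrA -yy -(mulrA _ (unit_segment t x)) /jinv mulrbV; last exact: ix.
  by rewrite mulr1 (mulrA (binv (unit_segment t y))) mulVbr ?mul1r//; exact: iy.
rewrite E -dy// -mulrA -mulrBr -mulrBl {1}/jinv binvB; [|exact: iy|exact: ix].
rewrite unit_segmentBr -/(jinv t y) -/(jinv t x) -scalerAr -scalerAl -scalerAl -scalerAr.
rewrite (vnormZ VN) cabs_real; have /andP[t0 t1] := t01; rewrite (ger0_norm t0).
have -> : N (y - x) ^+ 2 * C ^+ 3 = 1 * (N (y - x) * (C * N (x - y) * C * C)).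
  by rewrite (vnorm_distC VN x y); ring.
apply: ler_pM => //; apply: le_trans (NM _ _) _; apply: ler_pM => //.
apply: le_trans (NM _ _) _; apply: ler_pM => //; last exact: hx.
apply: le_trans (NM _ _) _; apply: ler_pM => //; last exact: hx.
by apply: le_trans (NM _ _) _; apply: ler_pM => //; exact: hy.
Qed.

(** Along the path [X s = x * (1 + s (y - 1))] the derivative of the logarithm is
    [(y - 1) * (1 + s (y - 1)) ^-1], in which [x] has cancelled: it is the
    integrand that defines the logarithm of [y]. *)
Lemma alg_logM x y : x * y = y * x -> pos_spectrum x -> pos_spectrum y ->
  alg_log (x * y) = alg_log x + alg_log y.
Proof.
move=> xy px py.
(* [q] is kept opaque: only [X s = x + s q] matters for the bounds *)
have [q qE] : exists q, q = x * (y - 1) by eexists.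
pose X s := x + s%:C *: q.
have XE s : X s = x * unit_segment s y.
  by rewrite /X qE /unit_segment (mulrDr x 1) mulr1 -scalerAr.
have cs s : x * unit_segment s y = unit_segment s y * x by exact: unit_segment_commute.
have pX s : 0 <= s <= 1 -> pos_spectrum (X s).
  move=> s01; rewrite XE; apply: (pos_spectrumM BN) => //.
  exact: pos_spectrum_segment.
have [|C C0 hC] := @jinv_bounded x q.
  by move=> t s t01 s01; apply: unit_segment_inv => //; exact: pX.
have XB s s' : X s' - X s = (s' - s)%:C *: q.
  by rewrite /X opprD addrACA subrr add0r -scalerBl rmorphB.
have XX s s' : X s * X s' = X s' * X s.
  have qx : q * x = x * q by rewrite qE -!mulrA; congr (_ * _); rewrite mulrBl mulrBr xy mulr1 mul1r.
  rewrite /X !mulrDl !mulrDr -!scalerAl -!scalerAr qx !scalerA mulrC.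
  by rewrite -!addrA; congr (_ + _); rewrite addrCA.
have lim : ncvg N (rsum (log_integrand^~ y)) (alg_log (X 1) - alg_log (X 0)).
  apply: (rsum_derivative VN (u := fun s => alg_log (X s))) => t e t01 e0.
  pose K := N q ^+ 2 * C ^+ 3 + 1.
  have K0 : 0 < K by rewrite ltr_wpDl// mulr_ge0 ?sqr_ge0// exprn_ge0// ltW.
  exists (e / (2 * K)); first by rewrite divr_gt0// mulr_gt0.
  move=> s s' s01 s'01 st s't.
  have ss : `|s' - s| * K <= e.
    have : `|s' - s| < e / (2 * K) + e / (2 * K).
      by have := ler_distD t s' s; rewrite (distrC t s); lra.
    have -> : e / (2 * K) + e / (2 * K) = e / K by field; rewrite gt_eqF.
    by rewrite ltr_pdivlMr// => /ltW.
  have := @alg_log_expansion (X s) (X s') C (XX _ _) (pX _ s01) (pX _ s'01)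
    (fun t t01 => hC t s t01 s01) (fun t t01 => hC t s' t01 s'01).
  have -> : (X s' - X s) * binv (X s) = (s' - s)%:C *: log_integrand s y.
    have iS := unit_segment_inv py s01; have ix := pos_spectrum_invertible px.
    rewrite XB XE -scalerAl; congr (_ *: _).
    rewrite (binv_eq (is_inverseM (binvP ix) (binvP iS))) qE /log_integrand.
    have cxy : x * (y - 1) = (y - 1) * x by rewrite mulrBl mulrBr xy mulr1 mul1r.
    rewrite cxy -!mulrA; congr (_ * _); rewrite mulrA.
    rewrite (_ : x * binv (unit_segment s y) = binv (unit_segment s y) * x); last exact: binv_comm.
    by rewrite -mulrA mulrbV// mulr1.
  move=> /le_trans; apply; rewrite XB (vnormZ VN) cabs_real.
  have d0 := normr_ge0 (s' - s); have p := ler_wpM2r d0 ss.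
  apply: le_trans p; rewrite /K exprMn expr2 mulrDr mulrDl mulr1.
  have -> : `|s' - s| * `|s' - s| * N q ^+ 2 * C ^+ 3 = `|s' - s| * (N q ^+ 2 * C ^+ 3) * `|s' - s| by ring.
  by rewrite lerDl mulr_ge0.
have X1 : X 1 = x * y by rewrite XE /unit_segment scale1r addrC subrK.
have X0 : X 0 = x by rewrite /X scale0r addr0.
have := ncvg_unique VN lim (alg_logP py); rewrite X1 X0 => /eqP.
by rewrite subr_eq addrC => /eqP.
Qed.

End Logarithm.

(** * Holomorphic functional calculus in C*-algebras and their matrix algebras *)

Section Hfc.
Variables (R : realType) (B : preTopologicalAlgType R[i]) (N : B -> R).
Hypothesis BN : banach_norm N.
Hypothesis BT : forall (u : nat -> B) l, u n @[n --> \oo] --> l <-> ncvg N u l.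
Implicit Types (a b : B).

Let VN : vnorm N := banach_vnorm BN.

Lemma hfc_eq (f : R[i] -> R[i]) a b :
  is_hfc f a b -> (forall b', is_hfc f a b' -> b' = b) -> hfc f a = b.
Proof. by move=> h u; apply: u; apply: (xgetPex 0 (P := [set b | is_hfc f a b])); exists b. Qed.

(** A large square witnesses that a Cauchy integral exists; any other choice of
    domain and cycle has the same value, as [contour_exp] applies to it too. *)
Lemma hfc_cexp a : hfc (@cexp R) a = alg_exp N a.
Proof.
apply: hfc_eq => [|b [U [G [_ [sG hG _ /BT hb]]]]].
- exists setT, (big_square N a); split; split.
  + exact: openT.
  + by [].
  + by move=> z _; exact: cexp_derivable.
  + by move=> z zG; split=> //; exact: (big_square_spectrum BN).
  + by move=> w /(big_square_winding BN)[_ h]; apply/winding_numberP.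
  + by move=> w; case.
  + apply/BT; have [_] := contour_exp BN (big_square_spectrum BN (a := a))
      (fun w h => (big_square_winding BN h).2).
    by apply; exact: alg_expP.
- apply: (ncvg_unique VN hb).
  have [_] := @contour_exp R B N BN a G (fun z zG => (sG z zG).2)
      (fun w h => (winding_numberP _ _ _).1 (hG w h)).
  by apply; exact: alg_expP.
Qed.

(** Zero has a neighbourhood of points outside the spectrum, which leaves room for
    a cycle in the open right half-plane. *)
Lemma pos_spectrum_gap a : pos_spectrum a -> exists2 d : R, 0 < d &
  forall z, spectrum a z -> exists2 t : R, d <= t & z = t%:C.
Proof.
move=> pa; have i0 : invertible (0%:A - a) by apply: pos_spectrum_inv => //; rewrite ltxx.
have [d d0 [C C0 H]] := res_near BN i0; exists d => // z sz.
have := pa z sz; rewrite ltcE => /andP[/eqP zi zr].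
have zE : z = (complex.Re z)%:C by move: zi; case: (z) => p q /= ->.
exists (complex.Re z) => //; rewrite leNgt; apply/negP => zd.
by case: sz; have [] := H z _; rewrite // subr0 zE cabs_real gtr0_norm.
Qed.

(** Existence: a square in the right half-plane surrounds the spectrum.
    Uniqueness: by [derivable_clog_slit] no domain on which [clog] is holomorphic
    meets the half-line of nonpositive reals, so no admissible cycle winds
    around a point of that half-line. *)
Lemma hfc_clog a : pos_spectrum a -> hfc (@clog R) a = alg_log N a.
Proof.
move=> pa; apply: hfc_eq => [|b [U [G [[_ sU hU] [sG hG oG /BT hb]]]]].
- have [d d0 hd] := pos_spectrum_gap pa.
  pose M := 2 * N a * N 1 + 1.
  have M0 : 0 < M by rewrite ltr_wpDl// !mulr_ge0// vnorm_ge0.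
  pose c := (d / 2 + M)%:C : R[i]; pose G := square c M.
  have Rec z : complex.Re (z - c) = complex.Re z - (d / 2 + M) by case: z.
  have Imc z : complex.Im (z - c) = complex.Im z by case: z => p q /=; rewrite subr0.
  have inside w : spectrum a w -> ~ cycle_support G w /\ winding G w 1.
    move=> sw; have := spectrum_bounded BN sw; have [t dt wE] := hd w sw.
    rewrite wE cabs_real => tM; have := ler_norm t => tn.
    apply: square_inside => //.
      by rewrite Rec /= ltr_norml; apply/andP; split; rewrite /M; lra.
    by rewrite Imc /= normr0.
  have ReG z : cycle_support G z -> 0 < complex.Re z.
    by move=> /(square_support M0)[]; rewrite Rec ler_norml => /andP[h _] _ _; lra.
  have out z : cycle_support G z -> ~ spectrum a z by move=> zG /inside[].
  have left w : complex.Re w <= 0 -> winding G w 0.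
    move=> w0; apply: (@winding_slit _ _ _ 1) => z /ReG z0; rewrite mul1r.
    apply: Re_slit; have -> : complex.Re (z - w) = complex.Re z - complex.Re w.
      by case: (z) (w) => [? ?] [].
    lra.
  exists [set z : R[i]^o | 0 < complex.Re z], G; split; split.
  + have -> : [set z : R[i]^o | 0 < complex.Re z] = (@complex.Re R : R[i]^o -> R) @^-1` [set x | 0 < x] by [].
    apply: open_comp; last exact: open_gt.
    by move=> z _; exact: Re_continuous.
  + by move=> z /hd[t dt ->] /=; lra.
  + by move=> z /Re_slit; exact: clog_derivable.
  + by move=> z zG; split; [exact: ReG|exact: out].
  + by move=> w /inside[_ h]; apply/winding_numberP.
  + by move=> w /negP; rewrite -leNgt => w0; apply/winding_numberP; exact: left.
  + apply/BT; apply: contour_log => //.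
    * by move=> w /inside[].
    * by move=> z /ReG; exact: Re_slit.
    * by move=> r r0; exact: left.
- apply: (ncvg_unique VN hb).
  have slitU z : U z -> slit z by move=> /hU; exact: derivable_clog_slit.
  apply: contour_log => //.
  + by move=> z /sG[].
  + by move=> w h; apply/winding_numberP; exact: hG.
  + by move=> z /sG[/slitU].
  + move=> r r0; apply/winding_numberP; apply: oG => /slitU/slitP; apply.
    by split.
Qed.

End Hfc.

Section CStarNorm.
Variables (R : realType) (A : cstarAlgType R).
Implicit Types x y : A.

Definition cstar_norm x : R := complex.Re `|x|.

Lemma cstar_normE x : `|x| = (cstar_norm x)%:C.
Proof.
have := normr_ge0 x; rewrite /cstar_norm lecE => /andP[/eqP h _].
by move: h; case: (`|x|) => p q /= ->.
Qed.

Lemma cstar_vnorm : vnorm cstar_norm.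
Proof.
split=> [x y|c x|x x0].
- by rewrite -lecR real_complexD -!cstar_normE ler_normD.
- apply: (@complexI R); rewrite rmorphM /= -!cstar_normE -cabs_normE.
  exact: normrZ.
- by apply: normr0_eq0; rewrite cstar_normE x0.
Qed.

Lemma cstar_cvgP (u : nat -> A) l : u n @[n --> \oo] --> l <-> ncvg cstar_norm u l.
Proof.
split=> [ul e e0|h].
- move/cvgrPdist_le : ul => /(_ e%:C); rewrite ltcR => /(_ e0).
  by apply: filterS => n; rewrite distrC cstar_normE lecR.
- apply/cvgrPdist_le => e; rewrite ltcE => /andP[/eqP ei er].
  have eE : e = (complex.Re e)%:C by move: ei; case: (e) => p q /= ->.
  rewrite eE; apply: filterS (h _ er) => n.
  by rewrite distrC cstar_normE lecR.
Qed.

Lemma cstar_banach : @banach_norm R A cstar_norm.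
Proof.
split; first exact: cstar_vnorm.
- move=> x y; rewrite -lecR rmorphM /= -!cstar_normE; exact: cstar_normM.
- move=> u hu.
  have : cvgn u.
    apply/cauchy_cvgP/cauchy_exP => e; rewrite ltcE => /andP[/eqP ei er].
    have eE : e = (complex.Re e)%:C by move: ei; case: (e) => p q /= ->.
    have [n0 hn] := hu (complex.Re e / 2) (divr_gt0 er (ltr0n _ 2)).
    exists (u n0); exists n0 => // n /= nn.
    rewrite -ball_normE /= eE cstar_normE ltcR.
    by apply: le_lt_trans (hn _ _ (leqnn _) nn) _; rewrite /= in er *; lra.
  by move=> /cvg_ex[l /cstar_cvgP ul]; exists l.
Qed.

(** The C*-identity at the unit, which is self-adjoint and not 0. *)
Lemma cstar_norm1 : cstar_norm (1 : A) = 1.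
Proof.
have h := @cstar_norm_adjM R A (1 : A).
have a1 : cstar_adj (1 : A) = 1.
  have e : cstar_adj (1 : A) = cstar_mul (cstar_adj (1 : A)) 1 by rewrite cstar_mulr1.
  by rewrite e -[X in cstar_mul _ X](@cstar_adjK R A) -cstar_adjM cstar_mulr1 cstar_adjK.
move: h; rewrite a1 (cstar_mul1r (1 : A)) => h.
have n0 : cstar_norm (1 : A) != 0.
  apply/eqP => /(vnorm_eq0 cstar_vnorm)/eqP; by rewrite (negbTE (@oner_neq0 A)).
apply: (mulfI n0); rewrite mulr1; apply: (@complexI R).
by rewrite rmorphM /= -cstar_normE -expr2 -h.
Qed.

Section Matrices.
Variable m : nat.
Implicit Types X Y : mxalg A m.+1.

(** This norm is submultiplicative and complete, and it induces entrywise
    convergence. *)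
Definition mx_sum_norm X : R := \sum_i \sum_j cstar_norm (X i j).

Let A0 x : 0 <= cstar_norm x := vnorm_ge0 cstar_vnorm x.

Lemma mx_entry_le X i j : cstar_norm (X i j) <= mx_sum_norm X.
Proof.
rewrite /mx_sum_norm (bigD1 i) //= (bigD1 j) //= -addrA lerDl.
by rewrite addr_ge0// sumr_ge0// => k _; rewrite ?sumr_ge0.
Qed.

Lemma mx_vnorm : @vnorm R (mxalg A m.+1) mx_sum_norm.
Proof.
split=> [X Y|c X|X X0].
- rewrite /mx_sum_norm -big_split /=; apply: ler_sum => i _.
  rewrite -big_split /=; apply: ler_sum => j _; rewrite mxE.
  exact: (vnormD cstar_vnorm).
- rewrite /mx_sum_norm mulr_sumr; apply: eq_bigr => i _.
  rewrite mulr_sumr; apply: eq_bigr => j _.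
  by rewrite mxE (vnormZ cstar_vnorm).
- apply/matrixP => i j; rewrite mxE; apply: (vnorm_eq0 cstar_vnorm).
  by apply/eqP; rewrite eq_le A0 -X0 mx_entry_le.
Qed.

Lemma mx_normM X Y : mx_sum_norm (X * Y) <= mx_sum_norm X * mx_sum_norm Y.
Proof.
have NM := banach_normM cstar_banach.
rewrite {1}/mx_sum_norm [leRHS]mulr_suml; apply: ler_sum => i _.
apply: le_trans (_ : \sum_j \sum_k cstar_norm (X i k) * cstar_norm (Y k j) <= _).
  apply: ler_sum => j _; rewrite mxE; apply: le_trans (vnorm_sum cstar_vnorm _ _ _) _.
  by apply: ler_sum => k _; exact: NM.
rewrite exchange_big /= mulr_suml; apply: ler_sum => k _.
rewrite -mulr_sumr ler_wpM2l//.
rewrite /mx_sum_norm [leRHS](bigD1 k)//= lerDl.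
by rewrite sumr_ge0// => k' _; rewrite sumr_ge0.
Qed.

Lemma mx_ncvgP (u : nat -> mxalg A m.+1) l :
  ncvg mx_sum_norm u l <-> forall i j, ncvg cstar_norm (fun n => u n i j) (l i j).
Proof.
split=> [h i j e e0|h].
- apply: filterS (h e e0) => n; apply: le_trans.
  by have := mx_entry_le (u n - l) i j; rewrite !mxE.
- move=> e e0; pose d := e / (m.+1%:R * m.+1%:R).
  have d0 : 0 < d by rewrite divr_gt0// mulr_gt0.
  have : \forall n \near \oo, forall i j, cstar_norm (u n i j - l i j) <= d.
    have H i : \forall n \near \oo, forall j, cstar_norm (u n i j - l i j) <= d.
      by apply: filter_forall => j; exact: h.
    by apply: filter_forall => i; exact: H.
  apply: filterS => n hn.
  apply: le_trans (_ : \sum_(i < m.+1) \sum_(j < m.+1) d <= _).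
    by apply: ler_sum => i _; apply: ler_sum => j _; rewrite !mxE.
  rewrite !sumr_const !card_ord -[X in X <= _]mulr_natr -[X in X * _ <= _]mulr_natr.
  by rewrite -mulrA /d divfK// mulf_neq0.
Qed.

Lemma mx_cvgP (u : nat -> mxalg A m.+1) (l : mxalg A m.+1) :
  u n @[n --> \oo] --> l <-> ncvg mx_sum_norm u l.
Proof.
apply: iff_trans (iff_sym (mx_ncvgP u l)); split=> [h i j|h].
- apply/cstar_cvgP => P lP.
  have : nbhs l [set X : mxalg A m.+1 | P (X i j)].
    exists (fun i' j' => [set x | (i' == i) && (j' == j) -> P x]).
      move=> i' j'; case: (i' =P i) => [->|_]; case: (j' =P j) => [->|_] /=;
        [|exact: nearW|exact: nearW|exact: nearW].
      by apply: filterS lP => x Px _.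
    by move=> X /(_ i j); rewrite /= !eqxx; apply.
  exact: h.
- move=> P [Q lQ QP].
  have H : \forall n \near \oo, forall i j, Q i j (u n i j).
    have H i : \forall n \near \oo, forall j, Q i j (u n i j).
      apply: filter_forall => j.
      by have /cstar_cvgP c := h i j; apply: (c (Q i j)); exact: lQ.
    by apply: filter_forall => i; exact: H.
  by apply: filterS H => n hn; apply: QP.
Qed.

Lemma mx_banach : @banach_norm R (mxalg A m.+1) mx_sum_norm.
Proof.
split; [exact: mx_vnorm|exact: mx_normM|].
move=> u hu.
have entry i j : exists l, ncvg cstar_norm (fun n => u n i j) l.
  apply: (banach_complete cstar_banach) => e e0; have [n0 h] := hu e e0.
  exists n0 => n k hn hk; apply: le_trans (h n k hn hk).
  by have := mx_entry_le (u n - u k) i j; rewrite !mxE.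
have [f hf] := choice (fun p : 'I_m.+1 * 'I_m.+1 => entry p.1 p.2).
exists (\matrix_(i, j) f (i, j)); apply/mx_ncvgP => i j; rewrite mxE.
exact: (hf (i, j)).
Qed.

End Matrices.

Section Commutation.
Variable m : nat.
Implicit Types X Y : 'M[A]_m.+1.

Lemma mulmx_scalarl (c : A) X i j : ((c%:M : 'M[A]_m.+1) * X) i j = c * X i j.
Proof.
rewrite mxE (bigD1 i)//= mxE eqxx mulr1n big1 ?addr0// => k ki.
by rewrite mxE eq_sym (negbTE ki) mulr0n mul0r.
Qed.

Lemma mulmx_scalarr (c : A) X i j : (X * (c%:M : 'M[A]_m.+1)) i j = X i j * c.
Proof.
rewrite mxE (bigD1 j)//= mxE eqxx mulr1n big1 ?addr0// => k kj.
by rewrite mxE (negbTE kj) mulr0n mulr0.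
Qed.

(** Commuting with all entries of a matrix is commuting with it as a scalar
    matrix; so compatibility passes to functions of the matrix. *)
Lemma scalar_mx_commuteP (c : A) X : (c%:M : 'M[A]_m.+1) * X = X * c%:M <->
  (forall i j, c * X i j = X i j * c).
Proof.
split=> [h i j|h]; first by rewrite -mulmx_scalarl h mulmx_scalarr.
by apply/matrixP => i j; rewrite mulmx_scalarl mulmx_scalarr.
Qed.

End Commutation.

End CStarNorm.

Theorem proposition6p9 (R : realType) (A : cstarAlgType R) (S : {pred A})
    (S_star_subalg : star_subalg_closed S)
    (S_hfc : hfc_closed S)
    (MS_hfc : forall n : nat, (2 <= n.+1)%N -> mx_hfc_closed S n)
    (m : nat) (h h' : 'M[A]_m.+1)
    (h_pos : GLpos S h) (h'_pos : GLpos S h')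
    (hh'_compatible : mx_compatible h h')
    (hh'_comm : h *m h' = h' *m h) :
  GLpos S (h *m h') /\
  det (h *m h') = det h * det h' /\
  det h * det h' = det h' * det h.
Proof.
pose B := mxalg A m.+1; pose N := @mx_sum_norm R A m.
have BN : @banach_norm R B N := mx_banach A m.
have [Sh [k Sk hk] [hadj hspec]] := h_pos.
have [Sh' [k' Sk' hk'] [hadj' hspec']] := h'_pos.
have hhB : (h : B) * (h' : B) = (h' : B) * (h : B) by exact: hh'_comm.
have pos (x : B) y : is_inverse x y -> spectrum x `<=` [set z | 0 <= z] -> pos_spectrum x.
  move=> xy sx z sz; rewrite lt_def; apply/andP; split; last exact: sx.
  apply/eqP => z0; apply: sz; rewrite z0 scale0r sub0r.
  by apply: invertibleN; exists y.
have ph : pos_spectrum (h : B) by exact: pos hk hspec.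
have ph' : pos_spectrum (h' : B) by exact: pos hk' hspec'.
have phh : pos_spectrum ((h : B) * h') by exact: (pos_spectrumM BN).
have mulS (X Y : 'M[A]_m.+1) : X \is a mxOver S -> Y \is a mxOver S -> X *m Y \is a mxOver S.
  move=> /mxOverP SX /mxOverP SY; apply/mxOverP => i j; rewrite mxE.
  have [[S1 Slin SM] _] := S_star_subalg.
  elim/big_ind: _ => [|x y Sx Sy|k0 _]; last exact: SM.
  - by have := Slin (-1) 1 1 S1 S1; rewrite scaleN1r addNr.
  - by have := Slin 1 x y Sx Sy; rewrite scale1r.
have logE (x : B) : pos_spectrum x -> mx_log x = alg_log N x.
  by move=> px; exact: (hfc_clog BN (@mx_cvgP R A m)).
have expE := hfc_cexp (cstar_banach A) (@cstar_cvgP R A).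
have trD : \tr (mx_log (h *m h')) = \tr (mx_log h) + \tr (mx_log h').
  rewrite -raddfD (logE _ phh) (logE _ ph) (logE _ ph') -(alg_logM BN hhB ph ph').
  by [].
(* the entries of [h'] commute with [h], hence with its logarithm; so the entries
   of that logarithm commute with [h'], hence with its logarithm *)
have entries i j k0 l : alg_log N (h : B) i j * alg_log N (h' : B) k0 l =
    alg_log N (h' : B) k0 l * alg_log N (h : B) i j.
  have c1 k1 l1 : forall i j, h' k1 l1 * alg_log N (h : B) i j = alg_log N (h : B) i j * h' k1 l1.
    apply/scalar_mx_commuteP; apply: (alg_log_commute BN ph).
    by apply/scalar_mx_commuteP => i1 j1; rewrite hh'_compatible.
  have /scalar_mx_commuteP c2 : ((alg_log N (h : B) i j)%:M : 'M[A]_m.+1) * alg_log N (h' : B) =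
     alg_log N (h' : B) * (alg_log N (h : B) i j)%:M.
    apply: (alg_log_commute BN ph').
    by apply/scalar_mx_commuteP => i1 j1; rewrite c1.
  exact: c2.
have trC : \tr (mx_log h) * \tr (mx_log h') = \tr (mx_log h') * \tr (mx_log h).
  have -> : mx_log h = alg_log N (h : B) by exact: logE.
  have -> : mx_log h' = alg_log N (h' : B) by exact: logE.
  apply: commr_sum => k0 _; apply: commr_sym; apply: commr_sum => i _; apply: commr_sym.
  exact: entries.
have N1 := cstar_norm1 A; have AB := cstar_banach A.
split; last first.
  have dE (X : 'M[A]_m.+1) : det X = alg_exp (@cstar_norm R A) (\tr (mx_log X)) by exact: expE.
  have d1 : det h * det h' = alg_exp (@cstar_norm R A) (\tr (mx_log h) + \tr (mx_log h')).
    exact: etrans (f_equal2 _ (dE h) (dE h')) (esym (alg_expD AB N1 trC)).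
  have d2 : det h' * det h = alg_exp (@cstar_norm R A) (\tr (mx_log h') + \tr (mx_log h)).
    exact: etrans (f_equal2 _ (dE h') (dE h)) (esym (alg_expD AB N1 (esym trC))).
  split; first exact: etrans (etrans (dE _) (f_equal _ trD)) (esym d1).
  exact: etrans d1 (etrans (f_equal (alg_exp (@cstar_norm R A)) (@addrC A _ _)) (esym d2)).
split.
- exact: mulS.
- exists (k' *m k); first exact: mulS.
  exact: is_inverseM.
- split; last by move=> z /phh /ltW.
  rewrite -[h *m h']/((h : B) * (h' : B)) adjM hadj hadj'; exact/esym.
Qed.
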